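(* Let $(M,g)$ be a globally hyperbolic, spherically symmetric spacetime whose centre of symmetry is a smooth timelike world line $\gamma\subset M$, parametrized by retarded coordinates $(u,s,\vartheta,\varphi)$ around $\gamma$, and let $\mathcal C_0=\{u=0\}$ be the forward light cone with tip at the point $u=0$ of $\gamma$. Let $\mathcal A(M)$ be the $*$-algebra of the massless minimally coupled free Klein--Gordon field $\phi$ on $M$, and let $\omega$ be a quasi-free Hadamard state on $\mathcal A(M)$, with two-point function $\omega_2(f,g)=\omega(\phi(f)\phi(g))$, such that: 1. the semiclassical Einstein equations $G_{\mu\nu}=8\pi\,\omega(T_{\mu\nu})$ are satisfied by $\omega$ and $M$; 2. $R^{(0)}_{ss}=8\pi\,\omega(T_{ss})$ (the $ss$ component of the Ricci tensor of the background metric $g$) is positive on $\mathcal C_0$; 3. there is a constant $C>0$ such that, for every (real, smooth, compactly supported) $f$ supported in $J^+(\mathcal C_0)$, $$|\omega_2(f,f)|\le C\,\|s\,\psi_f\|_2\,\|\partial_s(s\,\psi_f)\|_2 ,$$ where $\psi_f=\Delta(f)|_{\mathcal C_0}$, with $\Delta$ the causal propagator of the unperturbed metric $g$, and $\|\cdot\|_2$ is the $L^2$ norm on $\mathcal C_0$ with respect to the product measure $ds\,d\mathbb S^2$, $d\mathbb S^2$ being the standard measure on the unit two-sphere. Let $f$ be a real-valued, spherically symmetric, smooth compactly supported function with $\omega_2(f,f)\neq 0$, supported in an open region $\mathcal O\subset J^+(\mathcal C_0)$ chosen in such a way that $J^-(\mathcal O)\cap\mathcal C_0$ is formed by points in the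 past of the sphere $\{s=s_2\}$ of $\mathcal C_0$ (i.e. points of $\mathcal C_0$ with retarded distance smaller than $s_2$). Suppose further that there is an $s_1$ with $s_1<s_2<\frac32 s_1$ such that $$\|\partial_s\psi_f\|_2^2\le 8\pi\int_{s_1}^{s_2}|\partial_s\psi_f|^2\,ds .$$ Set $\bar s:=1/\sqrt{12\,C}$. If $s_2<\bar s$, then the expansion parameter $\theta$ of the congruence of null geodesics defining $\mathcal C_0$, for the metric satisfying the perturbed equation $G_{\mu\nu}=8\pi\,\omega_f(T_{\mu\nu})$, vanishes on a sphere contained in $\mathcal C_0$, and thus $J^+(\mathcal C_0)$ contains a trapped surface.
   Context: Conventions. Units $G=\hbar=c=1$; metric signature $(-,+,+,+)$. $J^\pm$ denote causal future/past. Field, algebra and states. $\phi$ satisfies $\Box\phi=0$; $\mathcal A(M)$ is the $*$-algebra generated by the smeared fields $\phi(f)$, $f\in C_0^\infty(M)$, with $\phi(f)^*=\phi(\bar f)$, $\phi(\Box f)=0$ and $[\phi(f),\phi(g)]=i\langle f,\Delta(g)\rangle\,1$ up to the overall sign convention for $\Delta$, where $\Delta$ is the causal propagator (difference of the advanced and retarded fundamental solutions of $\Box$) and $\langle f,h\rangle=\int_M f h\,d\mu_g$. For $f\in C_0^\infty(M)$, $\Delta(f)\in C^\infty(M)$ is a solution of $\Box\Delta(f)=0$ supported in $J^+(\mathrm{supp} f)\cup J^-(\mathrm{supp} f)$. For real $f$ with $\omega_2(f,f)\ne0$, the prepared state is $$\omega_f(A)=\frac{\omega(\phi(f)\,A\,\phi(f))}{\omega(\phi(f)\phi(f))},\qquad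 A\in\mathcal A(M).$$ Stress tensor. $\omega(T_{\mu\nu})$ is the expectation value of the renormalized stress-energy tensor of the massless minimally coupled scalar field (classically $T_{\mu\nu}=\partial_\mu\phi\,\partial_\nu\phi-\frac12 g_{\mu\nu}\,\partial_\rho\phi\,\partial^\rho\phi$). The difference $\langle T_{\mu\nu}\rangle_{f,0}:=\omega_f(T_{\mu\nu})-\omega(T_{\mu\nu})$ does not depend on renormalization ambiguities: it is the coincidence limit $y\to x$ of $\partial_\mu^x\partial_{\nu}^{y}-\frac12 g_{\mu\nu}g^{\rho\sigma}\partial^x_\rho\partial^y_\sigma$ applied to the smooth function $\omega_f(\phi(x)\phi(y))-\omega(\phi(x)\phi(y))$. Retarded coordinates. $u$ is the proper-time parameter along $\gamma$; $\mathcal C_u$ is the forward light cone formed by all future-directed null geodesics emanating from the point $u$ of $\gamma$, topologically $\mathbb R^+\times\mathbb S^2$. Each such geodesic is labelled by its angular direction in $\mathbb S^2$ and parametrized by an affine parameter $s$ (the retarded distance), with $s=0$ on $\gamma$ and normalized so that the scalar product at $u$ of its tangent vector with the unit tangent of $\gamma$ has absolute value one. In these coordinates a spherically symmetric metric has the form $$ds^2=-A(u,s)\,du^2-2\,ds\,du+r(u,s)^2\,d\mathbb S^2 ,$$ so in particular $g_{ss}=0$. The coordinates cover (a normal neighbourhood forming) the relevant part of $M$, containing $\mathcal O$. Perturbed metric and expansion. The change of the stress tensor due to the preparation of $\omega_f$ is evaluated over the fixed background metric $g$ and used as source for gravity: along $\mathcal C_0$, with affine parameter $s$, the metric satisfying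 the perturbed equation has $$R_{ss}=8\pi\,\omega_f(T_{ss})=R^{(0)}_{ss}+8\pi\,\langle T_{ss}\rangle_{f,0},$$ where $\langle T_{ss}\rangle_{f,0}$ is computed with the background metric. The perturbed quantities are assumed spherically symmetric, so the expansion $\theta=\theta(s)$ of the congruence of null geodesics forming $\mathcal C_0$ satisfies the Raychaudhuri equation without shear and vorticity terms, $$\frac{d\theta}{ds}=-\frac{\theta^2}{2}-R_{ss},\qquad \theta\sim\frac2s\ \text{ as } s\to0^+ .$$ In this spherically symmetric setting, the criterion used for the formation of a trapped surface in $J^+(\mathcal C_0)$ is the vanishing of $\theta$ on a sphere of constant $s$. *)

(* Defs.v *)
From HB Require Import structures.
From mathcomp Require Import all_boot all_order all_fingroup all_algebra.
From mathcomp Require Import all_classical all_reals all_analysis.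
From mathcomp Require Import complex.
From Stdlib Require Import Relation_Operators.

Set Implicit Arguments.
Unset Strict Implicit.
Unset Printing Implicit Defensive.

Import Order.TTheory GRing.Theory Num.Theory numFieldNormedType.Exports.

Local Open Scope classical_set_scope.
Local Open Scope ring_scope.
Local Open Scope complex_scope.

Section Calculus.
Context {R : realType}.

Definition pd n (i : 'I_n.+1) (f : 'rV[R]_n.+1 -> R) : 'rV[R]_n.+1 -> R :=
  fun z => 'D_(delta_mx 0 i) f z.

Definition iter_pd n (s : seq 'I_n.+1) (f : 'rV[R]_n.+1 -> R) :=
  foldr (@pd n) f s.

(* [U] is meant to be open. *)
Definition Ck_on n (k : nat) (U : set 'rV[R]_n.+1) (f : 'rV[R]_n.+1 -> R) :=
  forall (s : seq 'I_n.+1) z, (size s <= k)%N -> U z ->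
    {for z, continuous (iter_pd s f)} /\
    ((size s < k)%N -> forall i, derivable (iter_pd s f) z (delta_mx 0 i)).

Definition smooth_on n (U : set 'rV[R]_n.+1) (f : 'rV[R]_n.+1 -> R) :=
  forall k, Ck_on k U f.

(* Iterated one-dimensional Lebesgue integrals; only used for continuous
   functions with compact support. *)
Fixpoint integral_rV n : ('rV[R]_n -> R) -> R :=
  match n with
  | 0%N => fun h => h 0
  | m.+1 => fun h => \int[lebesgue_measure]_(t in setT)
      integral_rV (fun v : 'rV[R]_m => h (row_mx (t%:M : 'rV[R]_1) v))
  end.

(* The Euclidean norm; the library norm on matrices is the sup norm. *)
Definition enorm n (p : 'rV[R]_n) : R := Num.sqrt (\sum_i p 0 i ^+ 2).

Definition dot n (p q : 'rV[R]_n) : R := \sum_i p 0 i * q 0 i.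

Definition unit_sphere : set 'rV[R]_3 := [set n | enorm n = 1].

Definition SO3 : set 'M[R]_3 := [set Q | Q *m Q^T = 1%:M /\ \det Q = 1].

Definition direction (theta phi : R) : 'rV[R]_3 :=
  \row_(i < 3) if i == 0%N :> nat then sin theta * cos phi
               else if i == 1%N :> nat then sin theta * sin phi
               else cos theta.

Definition sphere_integral (h : 'rV[R]_3 -> \bar R) : \bar R :=
  (\int[lebesgue_measure]_(theta in [set t : R | (0 <= t <= pi)%R])
     \int[lebesgue_measure]_(phi in [set t : R | (0 <= t <= pi *+ 2)%R])
       ((sin theta)%:E * h (direction theta phi)))%E.

(* The squared norm and the norm of L^2(]0, smax[ x S^2, ds dS^2). *)
Definition cone_L2sq (smax : \bar R) (h : R -> 'rV[R]_3 -> R) : \bar R :=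
  sphere_integral (fun n =>
    (\int[lebesgue_measure]_(s in [set s : R | (0 < s)%R /\ s%:E < smax])
       ((h s n) ^+ 2)%:E)%E).

Definition cone_L2norm (smax : \bar R) (h : R -> 'rV[R]_3 -> R) : \bar R :=
  (cone_L2sq smax h `^ 2^-1)%E.

(* The principal branch, for z outside ]-oo, 0]. *)
Definition Clog (z : R[i]) : R[i] :=
  let m := Num.sqrt (complex.Re z ^+ 2 + complex.Im z ^+ 2) in
  ln m +i* (Num.sg (complex.Im z) * acos (complex.Re z / m)).

End Calculus.

(* Four-dimensional manifolds with a metric and a time orientation, given by
   components in the charts of an atlas.  The atlas need not be maximal, so
   requiring that a compatible chart belong to it is no restriction. *)

Record chart (R : realType) (M : topologicalType) := Chart {
  dom : set M;
  crd : M -> 'rV[R]_4;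
  par : 'rV[R]_4 -> M }.

Record spacetime (R : realType) := Spacetime {
  event :> topologicalType;
  atlas : set (chart R event);
  metric : chart R event -> event -> 'M[R]_4;
  tdir : chart R event -> event -> 'rV[R]_4 }.

Arguments atlas {R} s _.

Section Geometry.
Context {R : realType} {M : spacetime R}.
Implicit Types (k l : chart R M) (x y : M) (f : M -> R) (c : R -> M).

Definition img k : set 'rV[R]_4 := crd k @` dom k.

Definition rep k f : 'rV[R]_4 -> R := fun z => f (par k z).

Definition rep2 k l (F : M -> M -> R) : 'rV[R]_8 -> R :=
  fun z => F (par k (@lsubmx R 1 4 4 z)) (par l (@rsubmx R 1 4 4 z)).

Definition Ck2_on (m : nat) k l (D D' : set M) (F : M -> M -> R) :=
  Ck_on m [set z : 'rV[R]_8 | (crd k @` D) (@lsubmx R 1 4 4 z) /\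
                              (crd l @` D') (@rsubmx R 1 4 4 z)] (rep2 k l F).

Definition smooth f := forall k, atlas M k -> smooth_on (img k) (rep k f).

Definition smooth2 (F : M -> M -> R) :=
  forall k l m, atlas M k -> atlas M l -> Ck2_on m k l (dom k) (dom l) F.

(* Entry (i, j) is d(y_j o F)/dx_i, for row vectors of components. *)
Definition jacobian k l (F : M -> M) x : 'M[R]_4 :=
  \matrix_(i, j) pd i (fun z => crd l (F (par k z)) 0 j) (crd k x).

Definition smooth_map (F : M -> M) :=
  (forall x, {for x, continuous F}) /\
  forall k l j, atlas M k -> atlas M l ->
    smooth_on (crd k @` (dom k `&` F @^-1` dom l))
              (fun z => crd l (F (par k z)) 0 j).

Definition ip k x (v w : 'rV[R]_4) : R := (v *m metric k x *m w^T) 0 0.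

Definition future_causal k x (v : 'rV[R]_4) :=
  ip k x v v <= 0 /\ ip k x v (tdir k x) < 0.

Record is_chart k : Prop := {
  chart_dom : open (dom k);
  chart_img : open (img k);
  chart_crdK : forall x, dom k x -> par k (crd k x) = x;
  chart_crd : forall x, dom k x -> {for x, continuous (crd k)};
  chart_par : forall z, img k z -> {for z, continuous (par k)} }.

Definition minkowski : 'M[R]_4 :=
  diag_mx (\row_i if i == 0 then -1 else 1).

Record is_spacetime : Prop := {
  st_hausdorff : hausdorff_space M;
  st_countable : @second_countable M;
  st_connected : connected [set: M];
  st_chart : forall k, atlas M k -> is_chart k;
  st_cover : forall x, exists2 k, atlas M k & dom k x;
  st_transition : smooth_map id;
  st_metric_smooth : forall k i j, atlas M k ->
    smooth_on (img k) (rep k (fun x => metric k x i j));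
  st_signature : forall k x, atlas M k -> dom k x ->
    exists2 P, P \in unitmx & metric k x = P *m minkowski *m P^T;
  st_metric_change : forall k l x, atlas M k -> atlas M l ->
    dom k x -> dom l x ->
    metric k x = jacobian k l id x *m metric l x *m (jacobian k l id x)^T;
  st_tdir_smooth : forall k i, atlas M k ->
    smooth_on (img k) (rep k (fun x => tdir k x 0 i));
  st_tdir_timelike : forall k x, atlas M k -> dom k x ->
    ip k x (tdir k x) (tdir k x) < 0;
  st_tdir_change : forall k l x, atlas M k -> atlas M l ->
    dom k x -> dom l x -> tdir l x = tdir k x *m jacobian k l id x }.

(* Curvature, in the convention R^a_{bcd} = d_c Gamma^a_{db} - ...,
   R_{bd} = R^a_{bad}. *)

Definition gco k i j := rep k (fun x => metric k x i j).

Definition ginv k i j := rep k (fun x => invmx (metric k x) i j).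

Definition Gamma k (a i j : 'I_4) (z : 'rV[R]_4) : R :=
  2^-1 * \sum_b ginv k a b z *
    (pd i (gco k j b) z + pd j (gco k i b) z - pd b (gco k i j) z).

Definition Riem k (a b i j : 'I_4) (z : 'rV[R]_4) : R :=
  pd i (Gamma k a j b) z - pd j (Gamma k a i b) z
  + \sum_m (Gamma k a i m z * Gamma k m j b z
            - Gamma k a j m z * Gamma k m i b z).

Definition Ric k (i j : 'I_4) (z : 'rV[R]_4) : R := \sum_a Riem k a i a j z.

Definition scal k (z : 'rV[R]_4) : R :=
  \sum_i \sum_j ginv k i j z * Ric k i j z.

Definition ricci k x : 'M[R]_4 := \matrix_(i, j) Ric k i j (crd k x).

Definition einstein k x : 'M[R]_4 :=
  ricci k x - (2^-1 * scal k (crd k x)) *: metric k x.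

Definition hess k (h : 'rV[R]_4 -> R) (i j : 'I_4) (z : 'rV[R]_4) : R :=
  pd i (pd j h) z - \sum_a Gamma k a i j z * pd a h z.

Definition lapl k (h : 'rV[R]_4 -> R) (z : 'rV[R]_4) : R :=
  \sum_i \sum_j ginv k i j z * hess k h i j z.

Definition box k f x : R := lapl k (rep k f) (crd k x).

Definition grad_ip k f f' x : R :=
  \sum_i \sum_j ginv k i j (crd k x) *
    pd i (rep k f) (crd k x) * pd j (rep k f') (crd k x).

(* [is_box f h] : h = Box f. *)
Definition is_box f (h : M -> R) :=
  forall k x, atlas M k -> dom k x -> box k f x = h x.

Definition cov1 k (t : 'I_4 -> 'I_4 -> 'rV[R]_4 -> R)
    (m i j : 'I_4) (z : 'rV[R]_4) : R :=
  pd m (t i j) z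
  - \sum_a (Gamma k a m i z * t a j z + Gamma k a m j z * t i a z).

Definition cov2 k (t : 'I_4 -> 'I_4 -> 'rV[R]_4 -> R)
    (n m i j : 'I_4) (z : 'rV[R]_4) : R :=
  pd n (cov1 k t m i j) z
  - \sum_a (Gamma k a n m z * cov1 k t a i j z
            + Gamma k a n i z * cov1 k t m a j z
            + Gamma k a n j z * cov1 k t m i a z).

(* Metric variations of the integrals of R^2 and of R_{ab} R^{ab}: the
   conserved local curvature tensors of the dimension of T_{ab}. *)
Definition curv1 k (i j : 'I_4) (z : 'rV[R]_4) : R :=
  2 * scal k z * Ric k i j z - 2^-1 * gco k i j z * scal k z ^+ 2
  - 2 * hess k (scal k) i j z + 2 * gco k i j z * lapl k (scal k) z.

Definition curv2 k (i j : 'I_4) (z : 'rV[R]_4) : R :=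
  2 * (\sum_e \sum_m \sum_d
        Ric k e m z * ginv k m d z * Riem k e i d j z)
  - 2^-1 * gco k i j z *
      (\sum_a \sum_b \sum_d \sum_e
        ginv k a d z * ginv k b e z * Ric k a b z * Ric k d e z)
  - hess k (scal k) i j z
  + (\sum_m \sum_n ginv k m n z * cov2 k (Ric k) m n i j z)
  + 2^-1 * gco k i j z * lapl k (scal k) z.

Definition coord k c (i : 'I_4) : R -> R := fun t => crd k (c t) 0 i.

Definition velocity k c (t : R) : 'rV[R]_4 := \row_i derive1 (coord k c i) t.

Definition causal_segment x y := exists c a b a0 b0,
  [/\ a0 < a, a < b, b < b0, c a = x & c b = y] /\
  forall t, a0 < t < b0 -> {for t, continuous c} /\
    forall k, atlas M k -> dom k (c t) ->
      (forall i, derivable (coord k c i) t 1 /\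
                 {for t, continuous (derive1 (coord k c i))}) /\
      future_causal k (c t) (velocity k c t).

(* Piecewise C^1 future-directed causal curves, and x = y. *)
Definition causal_le x y := clos_refl_trans M causal_segment x y.

Definition Jplus (A : set M) : set M :=
  [set y | exists2 x, A x & causal_le x y].

Definition Jminus (A : set M) : set M :=
  [set x | exists2 y, A y & causal_le x y].

Record globally_hyperbolic : Prop := {
  gh_causal : forall x y, causal_le x y -> causal_le y x -> x = y;
  gh_diamond : forall x y, compact (Jplus [set x] `&` Jminus [set y]) }.

Definition geodesic c (a b : R) := forall t, a < t < b ->
  {for t, continuous c} /\
  forall k, atlas M k -> dom k (c t) -> forall m,
    [/\ \forall t' \near t, derivable (coord k c m) t' 1,
        derivable (derive1 (coord k c m)) t 1 &
        derive1 (derive1 (coord k c m)) t +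
        \sum_i \sum_j Gamma k m i j (crd k (c t))
          * velocity k c t 0 i * velocity k c t 0 j = 0].

Record worldline (J : set R) (gamma : R -> M) : Prop := {
  wl_interval : open J /\ is_interval J;
  wl_zero : J 0;
  wl_continuous : forall u, J u -> {for u, continuous gamma};
  wl_smooth : forall u k i n, J u -> atlas M k -> dom k (gamma u) ->
    derivable (derive1n n (coord k gamma i)) u 1;
  wl_proper_time : forall u k, J u -> atlas M k -> dom k (gamma u) ->
    ip k (gamma u) (velocity k gamma u) (velocity k gamma u) = -1;
  wl_future : forall u k, J u -> atlas M k -> dom k (gamma u) ->
    future_causal k (gamma u) (velocity k gamma u) }.

Record rotation_action (rot : 'M[R]_3 -> M -> M) : Prop := {
  rot_one : forall x, rot 1%:M x = x;
  rot_mul : forall P Q x, SO3 P -> SO3 Q -> rot (P *m Q) x = rot Q (rot P x);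
  rot_smooth : forall Q, SO3 Q -> smooth_map (rot Q);
  rot_isometry : forall Q k l x, SO3 Q -> atlas M k -> atlas M l ->
    dom k x -> dom l (rot Q x) ->
    metric k x =
      jacobian k l (rot Q) x *m metric l (rot Q x)
        *m (jacobian k l (rot Q) x)^T }.

(* The retarded coordinates (u, s, n), n a unit vector, are encoded by the
   chart [k] with Cartesian coordinates (u, s n), away from s = 0. *)
Definition ucoord (z : 'rV[R]_4) : R := (@lsubmx R 1 1 3 z) 0 0.

Definition pcoord (z : 'rV[R]_4) : 'rV[R]_3 := @rsubmx R 1 1 3 z.

Definition retpoint k (u s : R) (n : 'rV[R]_3) : M :=
  par k (row_mx (u%:M : 'rV[R]_1) (s *: n)).

Definition ds_vec (n : 'rV[R]_3) : 'rV[R]_4 := row_mx (0 : 'rV[R]_1) n.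

Definition contract_ss (t : 'M[R]_4) (n : 'rV[R]_3) : R :=
  (ds_vec n *m t *m (ds_vec n)^T) 0 0.

Definition ret_region k (J : set R) (gamma : R -> M) : set M :=
  dom k `|` gamma @` J.

(* [smax u] is the range of the retarded distance on the light cone of
   gamma(u). *)
Record retarded_coordinates (J : set R) (gamma : R -> M)
    (rot : 'M[R]_3 -> M -> M) k (A r : R -> R -> R) (smax : R -> \bar R)
    : Prop := {
  ret_atlas : atlas M k;
  ret_smax : forall u, J u -> (0 < smax u)%E;
  ret_img : forall z, img k z <->
    J (ucoord z) /\ pcoord z <> 0 /\
    ((enorm (pcoord z))%:E < smax (ucoord z))%E;
  ret_axis : forall u, J u -> ~ dom k (gamma u);
  ret_open : open (ret_region k J gamma);
  (* future-directed null geodesics issued from gamma, normalized at s = 0 *)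
  ret_ray : forall u n, J u -> unit_sphere n ->
    exists c a, [/\ a < 0, c 0 = gamma u,
      forall s, 0 < s -> (s%:E < smax u)%E -> c s = retpoint k u s n,
      forall b, 0 < b -> (b%:E <= smax u)%E -> geodesic c a b &
      forall l, atlas M l -> dom l (gamma u) ->
        [/\ future_causal l (gamma u) (velocity l c 0),
            ip l (gamma u) (velocity l c 0) (velocity l c 0) = 0 &
            ip l (gamma u) (velocity l c 0) (velocity l gamma u) = -1]];
  ret_r_gt0 : forall u s, J u -> 0 < s -> (s%:E < smax u)%E -> 0 < r u s;
  (* - A du^2 - 2 ds du + r^2 dS^2, with ds = n . dp and
     dS^2 = (|dp|^2 - (n . dp)^2) / s^2, for p = s n *)
  ret_metric : forall u s n (a : R) (w : 'rV[R]_3), J u -> unit_sphere n ->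
    0 < s -> (s%:E < smax u)%E ->
    let v : 'rV[R]_4 := row_mx (a%:M : 'rV[R]_1) w in
    ip k (retpoint k u s n) v v =
      - A u s * a ^+ 2 - 2 * dot n w * a
      + (r u s / s) ^+ 2 * (dot w w - dot n w ^+ 2);
  ret_rot_axis : forall Q u, SO3 Q -> J u -> rot Q (gamma u) = gamma u;
  ret_rot : forall Q u s n, SO3 Q -> J u -> unit_sphere n ->
    0 < s -> (s%:E < smax u)%E ->
    rot Q (retpoint k u s n) = retpoint k u s (n *m Q) }.

Definition cone_sphere k (s : R) : set M :=
  [set x | exists2 n, unit_sphere n & x = retpoint k 0 s n].

(* C_0, with its tip. *)
Definition light_cone k (gamma : R -> M) (smax : R -> \bar R) : set M :=
  [set x | x = gamma 0 \/
     exists s, [/\ 0 < s, (s%:E < smax 0%R)%E & cone_sphere k s x]].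

Definition spherical (rot : 'M[R]_3 -> M -> M) f :=
  forall Q x, SO3 Q -> f (rot Q x) = f x.

Definition supp (V : nmodType) (f : M -> V) : set M :=
  closure [set x | f x != 0].

Definition test f := smooth f /\ compact (supp f).

Definition fRe (h : M -> R[i]) : M -> R := fun x => complex.Re (h x).
Definition fIm (h : M -> R[i]) : M -> R := fun x => complex.Im (h x).
Definition toC f : M -> R[i] := fun x => (f x)%:C.

Definition testC (h : M -> R[i]) :=
  [/\ smooth (fRe h), smooth (fIm h) & compact (supp h)].

(* The integral of smooth compactly supported functions against the metric
   volume; by a partition of unity, the conditions determine it. *)
Record volume_integral (I : (M -> R) -> R) : Prop := {
  vol_linear : forall a f f', test f -> test f' ->
    I (fun x => a * f x + f' x) = a * I f + I f';
  vol_chart : forall k f, atlas M k -> test f -> supp f `<=` dom k ->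
    I f = integral_rV (fun z => if `[< img k z >]
      then f (par k z) * Num.sqrt `|\det (metric k (par k z))| else 0) }.

Definition volC (I : (M -> R) -> R) (h : M -> R[i]) : R[i] :=
  I (fRe h) +i* I (fIm h).

Definition kernel_pair (I : (M -> R) -> R) (K : M -> M -> R[i])
    (h h' : M -> R[i]) : R[i] :=
  volC I (fun x => h x * volC I (fun y => K x y * h' y)).

(* Fundamental solutions of Box, with supp (E f) in J (supp f). *)
Record fundamental_solution (J : set M -> set M) (E : (M -> R) -> (M -> R))
    : Prop := {
  fs_linear : forall a f f', test f -> test f' ->
    forall x, E (fun y => a * f y + f' y) x = a * E f x + E f' x;
  fs_smooth : forall f, test f -> smooth (E f);
  fs_right : forall f, test f -> is_box (E f) f;
  fs_left : forall f h, test f -> test h -> is_box f h ->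
    forall x, E h x = f x;
  fs_supp : forall f, test f -> [set x | E f x != 0] `<=` J (supp f) }.

Definition propagator (Eret Eadv : (M -> R) -> (M -> R)) f : M -> R :=
  fun x => Eret f x - Eadv f x.

Definition extC (L : (M -> R) -> (M -> R)) (h : M -> R[i]) : M -> R[i] :=
  fun x => L (fRe h) x +i* L (fIm h) x.

Record star_algebra (A : algType R[i]) (star : A -> A) : Prop := {
  star_invol : forall a, star (star a) = a;
  star_antilinear : forall (z : R[i]) a b,
    star (z *: a + b) = conjc z *: star a + star b;
  star_mul : forall a b, star (a * b) = star b * star a }.

(* With Box = - d_t^2 + ... and Delta = Eret - Eadv, this sign is the one of
   [phi(t, x), d_t phi(t, y)] = i delta(x, y). *)
Record field_relations (I : (M -> R) -> R) (Delta : (M -> R) -> (M -> R))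
    (A : algType R[i]) (star : A -> A) (phi : (M -> R[i]) -> A) : Prop := {
  field_linear : forall (z : R[i]) h h', testC h -> testC h' ->
    phi (fun x => z * h x + h' x) = z *: phi h + phi h';
  field_star : forall h, testC h ->
    star (phi h) = phi (fun x => conjc (h x));
  field_box : forall h h', testC h -> testC h' ->
    is_box (fRe h) (fRe h') -> is_box (fIm h) (fIm h') -> phi h' = 0;
  field_comm : forall h h', testC h -> testC h' ->
    phi h * phi h' - phi h' * phi h =
      ('i * volC I (fun x => h x * extC Delta h' x)) *: 1 }.

Record star_morphism (A B : algType R[i]) (starA : A -> A) (starB : B -> B)
    (m : A -> B) : Prop := {
  sm_linear : forall (z : R[i]) a b, m (z *: a + b) = z *: m a + m b;
  sm_one : m 1 = 1;
  sm_mul : forall a b, m (a * b) = m a * m b;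
  sm_star : forall a, m (starA a) = starB (m a) }.

(* A(M), as the universal unital *-algebra generated by the smeared fields. *)
Record field_algebra (I : (M -> R) -> R) (Delta : (M -> R) -> (M -> R))
    (A : algType R[i]) (star : A -> A) (phi : (M -> R[i]) -> A) : Prop := {
  fa_star : star_algebra star;
  fa_relations : field_relations I Delta star phi;
  fa_universal : forall (B : algType R[i]) (starB : B -> B)
      (phiB : (M -> R[i]) -> B),
    star_algebra starB -> field_relations I Delta starB phiB ->
    exists m : A -> B,
      [/\ star_morphism star starB m,
          forall h, testC h -> m (phi h) = phiB h &
          forall m' : A -> B, star_morphism star starB m' ->
            (forall h, testC h -> m' (phi h) = phiB h) -> m' =1 m] }.

Record state (A : algType R[i]) (star : A -> A) (omega : A -> R[i])
    : Prop := {
  state_linear : forall (z : R[i]) a b,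
    omega (z *: a + b) = z * omega a + omega b;
  state_one : omega 1 = 1;
  state_pos : forall a, 0 <= omega (star a * a) }.

Definition two_point (A : algType R[i]) (phi : (M -> R[i]) -> A)
    (omega : A -> R[i]) (h h' : M -> R[i]) : R[i] :=
  omega (phi h * phi h').

(* The sum over the pairings of {0, ..., n - 1}, i.e. over the involutions
   without fixed point. *)
Definition quasi_free (A : algType R[i]) (phi : (M -> R[i]) -> A)
    (omega : A -> R[i]) :=
  forall n (h : 'I_n -> M -> R[i]), (forall i, testC (h i)) ->
    omega (\prod_i phi (h i)) =
    \sum_(p : {perm 'I_n} | [forall i, (p (p i) == i) && (p i != i)])
      \prod_(i < n | (i < p i)%N) two_point phi omega (h i) (h (p i)).

Definition prepared (A : algType R[i]) (phi : (M -> R[i]) -> A)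
    (omega : A -> R[i]) f : A -> R[i] :=
  fun a => omega (phi (toC f) * a * phi (toC f)) /
           omega (phi (toC f) * phi (toC f)).

Definition geodesic_in (D : set M) x y c :=
  [/\ c 0 = x, c 1 = y, forall t, 0 <= t <= 1 -> D (c t) &
      exists2 e, 0 < e & geodesic c (- e) (1 + e)].

(* [D] is a geodesically convex open set, [sg] half the squared geodesic
   distance, [T] a time function; [U] and [V n] solve the transport equations
   which make U / sg + (sum_n V n sg^n) ln sg a formal solution of Box = 0 in
   its first argument. *)
Record hadamard_data k (D : set M) (sg : M -> M -> R) (T : M -> R)
    (U : M -> M -> R) (V : nat -> M -> M -> R) : Prop := {
  hd_open : open D;
  hd_dom : D `<=` dom k;
  hd_convex : forall x y, D x -> D y ->
    exists2 c, geodesic_in D x y c &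
      forall c', geodesic_in D x y c' ->
        forall t, 0 <= t <= 1 -> c' t = c t;
  hd_sg : forall x y c, D x -> D y -> geodesic_in D x y c ->
    sg x y = 2^-1 * ip k x (velocity k c 0) (velocity k c 0);
  hd_sg_smooth : forall m, Ck2_on m k k D D sg;
  hd_U_smooth : forall m, Ck2_on m k k D D U;
  hd_V_smooth : forall n m, Ck2_on m k k D D (V n);
  hd_T_smooth : smooth_on (crd k @` D) (rep k T);
  hd_T_future : forall x v, D x -> future_causal k x v ->
    0 < \sum_i v 0 i * pd i (rep k T) (crd k x);
  hd_U_diag : forall x, D x -> U x x = 1;
  hd_U : forall x y, D x -> D y ->
    2 * grad_ip k (sg^~ y) (U^~ y) x
    + (box k (sg^~ y) x - 4) * U x y = 0;
  hd_V0 : forall x y, D x -> D y ->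
    2 * grad_ip k (sg^~ y) (V 0%N ^~ y) x
    + (box k (sg^~ y) x - 2) * V 0%N x y = - box k (U^~ y) x;
  hd_VS : forall n x y, D x -> D y ->
    n.+1%:R * (2 * grad_ip k (sg^~ y) (V n.+1 ^~ y) x
               + (box k (sg^~ y) x + n.*2%:R) * V n.+1 x y)
    = - box k (V n ^~ y) x }.

Definition parametrix (lam : R) (sg : M -> M -> R) (T : M -> R)
    (U : M -> M -> R) (V : nat -> M -> M -> R) (N : nat) (e : R)
    (x y : M) : R[i] :=
  let sge : R[i] := (sg x y + e ^+ 2 / 2) +i* (e * (T x - T y)) in
  ((8 * pi ^+ 2)^-1)%:C *
  ((U x y)%:C / sge
   + (\sum_(n < N.+1) V n x y * sg x y ^+ n)%:C
     * Clog (sge / (lam ^+ 2)%:C)).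

(* On D x D, omega_2 is the limit e -> 0+ of the parametrix of order N, plus
   the C^N function [w]. *)
Definition regular_part (I : (M -> R) -> R) (lam : R)
    (W2 : (M -> R[i]) -> (M -> R[i]) -> R[i]) k (D : set M)
    (sg : M -> M -> R) (T : M -> R) (U : M -> M -> R)
    (V : nat -> M -> M -> R) (N : nat) (w : M -> M -> R[i]) :=
  [/\ Ck2_on N k k D D (fun x y => complex.Re (w x y)),
      Ck2_on N k k D D (fun x y => complex.Im (w x y)) &
      forall h h', testC h -> testC h' -> supp h `<=` D -> supp h' `<=` D ->
      let rest := W2 h h' - kernel_pair I w h h' in
      complex.Re (kernel_pair I (parametrix lam sg T U V N e) h h')
        @[e --> 0^'+] --> complex.Re rest /\
      complex.Im (kernel_pair I (parametrix lam sg T U V N e) h h')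
        @[e --> 0^'+] --> complex.Im rest].

Definition hadamard (I : (M -> R) -> R) (lam : R)
    (W2 : (M -> R[i]) -> (M -> R[i]) -> R[i]) :=
  forall k x, atlas M k -> dom k x ->
    exists D sg T U V, [/\ D x, hadamard_data k D sg T U V &
      forall N, exists w, regular_part I lam W2 k D sg T U V N w].

(* The limit y -> x of
   (d_i^x d_j^y - 1/2 g_ij g^{ab} d_a^x d_b^y) F(x, y). *)
Definition point_split k (F : M -> M -> R) x : 'M[R]_4 :=
  let B : 'M[R]_4 := \matrix_(i, j)
    pd (@lshift 4 4 i : 'I_8) (pd (@rshift 4 4 j : 'I_8) (rep2 k k F))
       (row_mx (crd k x) (crd k x)) in
  B - (2^-1 * \sum_a \sum_b invmx (metric k x) a b * B a b) *: metric k x.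

(* T0 = omega(T_ab): point splitting of the regular part, the multiple of
   V_1 g_ab that makes the result divergence free, and the ambiguity, with
   the constants lam (in the parametrix), alpha and beta. *)
Definition renormalized_stress (I : (M -> R) -> R) (lam alpha beta : R)
    (W2 : (M -> R[i]) -> (M -> R[i]) -> R[i])
    (T0 : chart R M -> M -> 'M[R]_4) :=
  forall k x, atlas M k -> dom k x ->
    exists D sg T U V w, [/\ D x, hadamard_data k D sg T U V,
      regular_part I lam W2 k D sg T U V 3 w &
      T0 k x =
        point_split k (fun y y' => complex.Re (w y y')) x
        + ((4 * pi ^+ 2)^-1 * V 1%N x x) *: metric k x
        + alpha *: (\matrix_(i, j) curv1 k i j (crd k x))
        + beta *: (\matrix_(i, j) curv2 k i j (crd k x))].

Definition einstein_equation (T0 : chart R M -> M -> 'M[R]_4) :=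
  forall k x, atlas M k -> dom k x -> einstein k x = (8 * pi) *: T0 k x.

(* tau = omega'(T_ab) - omega(T_ab). *)
Definition stress_difference (I : (M -> R) -> R) (A : algType R[i])
    (phi : (M -> R[i]) -> A) (omega omega' : A -> R[i])
    (tau : chart R M -> M -> 'M[R]_4) :=
  exists F : M -> M -> R,
    [/\ smooth2 F,
        forall h h', testC h -> testC h' ->
          two_point phi omega' h h' - two_point phi omega h h' =
          kernel_pair I (fun x y => (F x y)%:C) h h' &
        forall k x, atlas M k -> dom k x -> tau k x = point_split k F x].

(* R_ss of the perturbed metric on C_0, at retarded distance s: that of the
   background plus 8 pi tau_ss, assumed independent of the direction. *)
Definition perturbed_Rss k (smax : R -> \bar R)
    (tau : chart R M -> M -> 'M[R]_4) (Rss : R -> R) :=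
  forall s n, unit_sphere n -> 0 < s -> (s%:E < smax 0%R)%E ->
    Rss s = contract_ss (ricci k (retpoint k 0 s n)) n
            + 8 * pi * contract_ss (tau k (retpoint k 0 s n)) n.

(* The criterion: the expansion vanishes on a sphere of constant s, which
   lies in [K]. *)
Definition contains_trapped_sphere k (theta : R -> R) (S : \bar R)
    (K : set M) :=
  exists s, [/\ 0 < s, (s%:E < S)%E, theta s = 0 & cone_sphere k s `<=` K].

End Geometry.

Arguments is_spacetime {R} M.
Arguments globally_hyperbolic {R} M.

(* The expansion along a light cone with s in ]0, smax[, on the maximal
   interval ]0, S[: it ends at smax or at a caustic, where theta -> -oo. *)
Record expansion (R : realType) (smax : \bar R) (Rss theta : R -> R)
    (S : \bar R) : Prop := {
  exp_interval : (0 < S <= smax)%E;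
  exp_raychaudhuri : forall s : R, 0 < s -> (s%:E < S)%E ->
    is_derive s 1 theta (- (theta s) ^+ 2 / 2 - Rss s);
  exp_tip : (s * theta s) @[s --> 0^'+] --> (2 : R);
  exp_maximal : S = smax \/
    exists S', S = S'%:E /\ theta s @[s --> S'^'-] --> -oo }.

(* Main.v *)
(* Put w = omega_2(f,f) > 0 and psi = Delta(f) on the cone.

   By Wick's theorem the two-point function of the prepared state differs from
   omega_2 by a kernel F such that, for every real test function h,
   <h, F h> >= <h, Delta f>^2 / (2 w).  Applied to differences of bump functions,
   this gives (psi')^2 / (2 w) <= T_ss for the difference of the stress tensors,
   as g_ss = 0; hence R_ss >= (4 pi / w) (psi')^2.

   The retarded part of Delta(f) vanishes on the cone away from its tip, so
   psi is supported in s < s2, and the Cauchy-Schwarz inequality bounds both norms in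
   the hypothesis on omega_2: w <= 2 C s2^3 ||psi'||^2.

   If theta did not vanish it would stay positive, so theta <= 2 / s, and
   theta(s2) <= 2 / s1 - ||psi'||^2 / (2 w) <= 2 / s1 - 1 / (4 C s2^3) < 0,
   a contradiction. *)
Require Import Defs.
From HB Require Import structures.
From mathcomp Require Import all_boot all_order all_fingroup all_algebra.
From mathcomp Require Import all_classical all_reals all_analysis.
From mathcomp Require Import measurable_realfun complex ring lra.
Import Order.TTheory GRing.Theory Num.Theory numFieldNormedType.Exports.
Local Open Scope classical_set_scope.
Local Open Scope ring_scope.
Local Open Scope complex_scope.
Set Implicit Arguments.
Unset Strict Implicit.
Unset Printing Implicit Defensive.

(** Two obstacles shape the proof. The kernel [F] is known only through its smeared values, so a
    lower bound on its mixed derivative at a point has to be extracted from test functions: this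
    requires the smoothness of x |-> int F(x, y) h(y), without which the outer integral could not be
    split, and a second-difference argument. The other obstacle is the axis. The retarded chart
    omits [gamma], and continuity of u there is not among the assumptions, whereas a causal curve
    from the cone may cross the axis. Off the axis u does not decrease along causal curves, because
    ds is null, future directed and dual to - du; at a crossing one has to know that u approaches
    the parameter of the axis point. This is derived from the absence of causal loops along [gamma]
    and from the local connectedness of the complement of a timelike curve. The factor 1/(2 w) comes
    from the commutator alone, which fixes the imaginary part of omega_2(f, h). The focusing
    argument follows a single ray, since the concentration hypothesis holds for every direction. *)

Lemma open_near (T : topologicalType) (U : set T) (P : T -> Prop) x :
  open U -> U x -> (forall y, U y -> P y) -> \forall y \near x, P y.
Proof.
move=> oU Ux UP; apply: (@filterS _ _ _ U) => //.
by apply: open_nbhs_nbhs.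
Qed.

(** * Differential calculus on open sets of R^n *)

Section PartialDerivatives.
Context {R : realType} {n : nat}.
Implicit Types (U : set 'rV[R]_n.+1) (f g : 'rV[R]_n.+1 -> R) (z : 'rV[R]_n.+1).

Lemma iter_pd_rcons (s : seq 'I_n.+1) i f :
  iter_pd (rcons s i) f = iter_pd s (pd i f).
Proof. by rewrite /iter_pd foldr_rcons. Qed.

Lemma eq_pd_on U i f g : open U -> (forall z, U z -> f z = g z) ->
  forall z, U z -> pd i f z = pd i g z.
Proof.
move=> oU fg z Uz; apply: near_eq_derive.
exact: open_near oU Uz fg.
Qed.

Lemma eq_iter_pd_on U s f g : open U -> (forall z, U z -> f z = g z) ->
  forall z, U z -> iter_pd s f z = iter_pd s g z.
Proof. by move=> oU fg; elim: s => [//|i s IH]; apply: eq_pd_on. Qed.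

Lemma eq_derivable_on U f g z v : open U -> (forall z, U z -> f z = g z) ->
  U z -> derivable f z v -> derivable g z v.
Proof.
move=> oU fg Uz; apply: near_eq_derivable.
exact: open_near oU Uz fg.
Qed.

Lemma eq_continuous_on U f g z : open U -> (forall z, U z -> f z = g z) ->
  U z -> {for z, continuous f} -> {for z, continuous g}.
Proof.
move=> oU fg Uz cf; rewrite /prop_for /continuous_at -(fg z Uz).
have fgz : {near z, f =1 g} := open_near oU Uz fg.
exact: cvg_trans (near_eq_cvg fgz) cf.
Qed.

Lemma eq_Ck_on k U f g : open U -> (forall z, U z -> f z = g z) ->
  Ck_on k U f -> Ck_on k U g.
Proof.
move=> oU fg Cf s z sk Uz; have [cf df] := Cf s z sk Uz.
have e := eq_iter_pd_on s oU fg.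
split; first exact: (eq_continuous_on oU e Uz cf).
by move=> sk' i; apply: (eq_derivable_on oU e Uz (df sk' i)).
Qed.

Lemma Ck_on0 U f : Ck_on 0 U f <-> (forall z, U z -> {for z, continuous f}).
Proof.
split=> [Cf z Uz|Cf [|//] z _ Uz]; first by have [] := Cf [::] z isT Uz.
by split=> //=; exact: Cf.
Qed.

(** [iter_pd] folds from the right, so the last index of a list is the innermost derivative and is
    peeled off with [rcons]. The resulting recursion on the order drives the closure properties
    below. *)
Lemma Ck_onS k U f : Ck_on k.+1 U f <->
  (forall z, U z -> {for z, continuous f} /\
     forall i, derivable f z (delta_mx 0 i)) /\ forall i, Ck_on k U (pd i f).
Proof.
split=> [Cf|[Cf Cd] s z].
  split=> [z Uz|i s z sk Uz].
    by have [cf df] := Cf [::] z isT Uz; split => //; apply: df.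
  have sk2 : (size (rcons s i) <= k.+1)%N by rewrite size_rcons.
  rewrite -iter_pd_rcons; have [cf df] := Cf (rcons s i) z sk2 Uz.
  by split=> // sk'; apply: df; rewrite size_rcons.
case: (lastP s) => [_ Uz|s' i]; first by have [? ?] := Cf z Uz; split.
by rewrite size_rcons iter_pd_rcons ltnS => sk Uz; apply: Cd.
Qed.

Lemma Ck_onW j k U f : (j <= k)%N -> Ck_on k U f -> Ck_on j U f.
Proof.
move=> jk Cf s z sj Uz; have [cf df] := Cf s z (leq_trans sj jk) Uz.
by split=> // sj'; apply: df; apply: leq_trans jk.
Qed.

Lemma smooth_on_pd U f i : smooth_on U f -> smooth_on U (pd i f).
Proof. by move=> Cf k; have /Ck_onS[_] := Cf k.+1; apply. Qed.

Lemma smooth_on_continuous U f z : smooth_on U f -> U z ->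
  {for z, continuous f}.
Proof. by move=> /(_ 0) /Ck_on0; apply. Qed.

Lemma Ck_on_cst k U (a : R) : Ck_on k U (fun=> a).
Proof.
elim: k a => [|k IH] a; first by apply/Ck_on0 => z _; exact: cst_continuous.
apply/Ck_onS; split=> [z _|i].
  by split=> [|i]; [exact: cst_continuous|exact: derivable_cst].
by rewrite (_ : pd i _ = fun=> 0) //; apply/funext => z; exact: derive_cst.
Qed.

Lemma Ck_on_add k U f g : open U -> Ck_on k U f -> Ck_on k U g ->
  Ck_on k U (fun z => f z + g z).
Proof.
move=> oU; elim: k f g => [|k IH] f g.
  move=> /Ck_on0 cf /Ck_on0 cg; apply/Ck_on0 => z Uz.
  exact: (cvgD (cf z Uz) (cg z Uz)).
move=> /Ck_onS[Cf Df] /Ck_onS[Cg Dg]; apply/Ck_onS; split=> [z Uz|i].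
  have [cf df] := Cf z Uz; have [cg dg] := Cg z Uz.
  by split=> [|i]; [exact: (cvgD cf cg)|exact: derivableD].
apply: eq_Ck_on oU _ (IH _ _ (Df i) (Dg i)) => z Uz.
by rewrite /pd (@deriveD _ _ _ f g) //; [apply: (Cf z Uz).2|apply: (Cg z Uz).2].
Qed.

Lemma Ck_on_mul k U f g : open U -> Ck_on k U f -> Ck_on k U g ->
  Ck_on k U (fun z => f z * g z).
Proof.
move=> oU; elim: k f g => [|k IH] f g.
  move=> /Ck_on0 cf /Ck_on0 cg; apply/Ck_on0 => z Uz.
  exact: (cvgM (cf z Uz) (cg z Uz)).
move=> Cf' Cg'; move: (Cf') (Cg') => /Ck_onS[Cf Df] /Ck_onS[Cg Dg].
apply/Ck_onS; split=> [z Uz|i].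
  have [cf df] := Cf z Uz; have [cg dg] := Cg z Uz.
  by split=> [|i]; [exact: (cvgM cf cg)|exact: derivableM].
have := Ck_on_add oU (IH _ _ (Ck_onW (leqnSn k) Cf') (Dg i))
                     (IH _ _ (Ck_onW (leqnSn k) Cg') (Df i)).
apply: eq_Ck_on oU _ => z Uz.
by rewrite /pd (@deriveM _ _ f g) //; [apply: (Cf z Uz).2|apply: (Cg z Uz).2].
Qed.

Lemma Ck_on_sum (I : Type) (r : seq I) k U (F : I -> 'rV[R]_n.+1 -> R) :
  open U -> (forall i, Ck_on k U (F i)) -> Ck_on k U (fun z => \sum_(i <- r) F i z).
Proof.
move=> oU CF; elim: r => [|i r IH].
  by refine (eq_Ck_on oU _ (Ck_on_cst 0)) => z _; rewrite big_nil.
by refine (eq_Ck_on oU _ (Ck_on_add oU (CF i) IH)) => z _; rewrite big_cons.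
Qed.

Lemma Ck_on_prod (I : Type) (r : seq I) k U (F : I -> 'rV[R]_n.+1 -> R) :
  open U -> (forall i, Ck_on k U (F i)) -> Ck_on k U (fun z => \prod_(i <- r) F i z).
Proof.
move=> oU CF; elim: r => [|i r IH].
  by refine (eq_Ck_on oU _ (Ck_on_cst 1)) => z _; rewrite big_nil.
by refine (eq_Ck_on oU _ (Ck_on_mul oU (CF i) IH)) => z _; rewrite big_cons.
Qed.

Lemma derive_line f z v : 'D_v f z = derive1 (fun h => f (h *: v + z)) 0.
Proof.
rewrite derive1E /derive.
suff -> : (fun h : R => h^-1 *: (((fun h => f (h *: v + z)) \o shift 0) (h *: 1)
              - f (0 *: v + z))) =
          (fun h => h^-1 *: ((f \o shift z) (h *: v) - f z)) by [].
by apply/funext => h /=; rewrite scale0r add0r addr0 [h *: 1]mulr1.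
Qed.

(** Only a derivative along [v] is assumed, so [f] is restricted to the line through [z], where the
    one-variable chain rule applies. *)
Lemma is_derive_comp1 (b : R -> R) f z v : derivable f z v ->
  derivable b (f z) 1 -> is_derive z v (fun z => b (f z)) (derive1 b (f z) * 'D_v f z).
Proof.
move=> df db.
pose g h := f (h *: v + z).
have g0 : g 0 = f z by rewrite /g scale0r add0r.
have dg : derivable g 0 1 by have /derivable1P := df.
have dbg : derivable (b \o g) 0 1.
  apply/derivable1_diffP; apply: differentiable_comp.
    exact/derivable1_diffP.
  by rewrite g0; have /derivable1_diffP := db.
apply: DeriveDef; first by apply/derivable1P.
rewrite (derive_line (fun z => b (f z))) (derive_line f) -g0.
have db0 : derivable b (g 0) 1 by rewrite g0.
exact: (derive1_comp dg db0).
Qed.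

(** Induction on the order with [b] generalized: the derivative of b(f) is b'(f) times that of f,
    and b' satisfies the same hypothesis. *)
Lemma Ck_on_comp1 k U (b : R -> R) f : open U ->
  (forall j t, derivable (derive1n j b) t 1) -> Ck_on k U f ->
  Ck_on k U (fun z => b (f z)).
Proof.
move=> oU; elim: k b f => [|k IH] b f db.
  have cb t : {for t, continuous b}.
    by apply: differentiable_continuous; apply/derivable1_diffP; exact: (db 0).
  move=> /Ck_on0 cf; apply/Ck_on0 => z Uz.
  by apply: (@continuous_comp _ _ _ f b); [exact: cf|exact: cb].
have cb t : {for t, continuous b}.
  by apply: differentiable_continuous; apply/derivable1_diffP; exact: (db 0).
move=> Cf'; move: (Cf') => /Ck_onS[Cf Df]; apply/Ck_onS; split=> [z Uz|i].
  have [cf df] := Cf z Uz; split=> [|i].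
    by apply: (@continuous_comp _ _ _ f b).
  by have [] := is_derive_comp1 (df i) (db 0 (f z)).
have db' j t : derivable (derive1n j (derive1 b)) t 1.
  by rewrite -derive1Sn; exact: db.
have := Ck_on_mul oU (IH _ _ db' (Ck_onW (leqnSn k) Cf')) (Df i).
apply: eq_Ck_on oU _ => z Uz.
by have [_ e] := is_derive_comp1 ((Cf z Uz).2 i) (db 0 (f z)); rewrite /pd e.
Qed.

End PartialDerivatives.

Section ContinuousAt.
Context {R : realType} {T : topologicalType}.
Implicit Types (x : T) (f g : T -> R).

Lemma continuous_at_sum x (I : Type) (r : seq I) (P : pred I) (f : I -> T -> R) :
  (forall i, P i -> {for x, continuous (f i)}) ->
  {for x, continuous (fun x => \sum_(i <- r | P i) f i x)}.
Proof. by move=> fa; apply: cvg_big => //; exact: add_continuous. Qed.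

Lemma continuous_at_prod x (I : Type) (r : seq I) (P : pred I) (f : I -> T -> R) :
  (forall i, P i -> {for x, continuous (f i)}) ->
  {for x, continuous (fun x => \prod_(i <- r | P i) f i x)}.
Proof. by move=> fa; apply: cvg_big => //; exact: mul_continuous. Qed.

Lemma continuous_at_add x f g : {for x, continuous f} -> {for x, continuous g} ->
  {for x, continuous (fun x => f x + g x)}.
Proof. by move=> cf cg; apply: (cvgD cf cg). Qed.

Lemma continuous_at_opp x f : {for x, continuous f} ->
  {for x, continuous (fun x => - f x)}.
Proof. by move=> cf; apply: (cvgN cf). Qed.

Lemma continuous_at_sub x f g : {for x, continuous f} -> {for x, continuous g} ->
  {for x, continuous (fun x => f x - g x)}.
Proof. by move=> cf cg; apply: (cvgB cf cg). Qed.

Lemma continuous_at_mul x f g : {for x, continuous f} -> {for x, continuous g} ->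
  {for x, continuous (fun x => f x * g x)}.
Proof. by move=> cf cg; apply: (cvgM cf cg). Qed.

Lemma continuous_at_cst x (a : R) : {for x, continuous (fun=> a : R)}.
Proof. exact: cst_continuous. Qed.

Lemma continuous_at_mx x m n (M : T -> 'M[R]_(m, n)) :
  (forall i j, {for x, continuous (fun x => M x i j)}) -> {for x, continuous M}.
Proof.
move=> cM; apply/cvgrPdist_le => /= e e0.
have /filterS : \forall y \near x, forall ij : 'I_m * 'I_n,
    `|M x ij.1 ij.2 - M y ij.1 ij.2| <= e.
  apply: (@filter_forall _ _ (fun ij y => `|M x ij.1 ij.2 - M y ij.1 ij.2| <= e) (nbhs x)) => -[i j].
  by have /cvgrPdist_le/(_ e e0) := cM i j.
apply=> y Me; rewrite [leLHS]mx_normrE; apply: bigmax_le; first exact: ltW.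
by move=> ij _; rewrite !mxE; exact: Me.
Qed.

Lemma continuous_at_entry x m n (M : T -> 'M[R]_(m, n)) i j :
  {for x, continuous M} -> {for x, continuous (fun x => M x i j)}.
Proof.
move=> cM; apply: (@continuous_comp _ _ _ M (fun A : 'M[R]_(m, n) => A i j)) => //.
exact: coord_continuous.
Qed.

End ContinuousAt.

Section RowNorm.
Context {R : realType}.

Lemma le_mx_entry m n (M : 'M[R]_(m, n)) i j : `|M i j| <= `|M|.
Proof. by rewrite [leRHS]mx_normrE; exact: (le_bigmax _ _ (i, j)). Qed.

Lemma mx_norm_le m n (M : 'M[R]_(m, n)) e : 0 <= e ->
  (forall i j, `|M i j| <= e) -> `|M| <= e.
Proof. by move=> e0 Me; rewrite [leLHS]mx_normrE; apply: bigmax_le. Qed.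

Lemma mx_norm_lt m n (M : 'M[R]_(m, n)) e : 0 < e ->
  (forall i j, `|M i j| < e) -> `|M| < e.
Proof. by move=> e0 Me; rewrite [ltLHS]mx_normrE; apply/bigmax_ltP; split. Qed.

Lemma norm_delta n (i : 'I_n) : `|delta_mx 0 i : 'rV[R]_n| = 1.
Proof.
apply/eqP; rewrite eq_le; apply/andP; split.
  by apply: mx_norm_le => // j l; rewrite mxE; case: (_ && _); rewrite ?normr1 ?normr0.
by have := le_mx_entry (delta_mx 0 i : 'rV[R]_n) 0 i; rewrite mxE !eqxx normr1.
Qed.

End RowNorm.

Section Lines.
Context {R : realType} {V : normedModType R}.
Implicit Types (f : V -> R) (z v : V) (t : R).

Lemma line_growth f z v t :
  (fun h : R => h^-1 *: (((fun t => f (z + t *: v)) \o shift t) (h *: 1)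
              - f (z + t *: v))) =
  (fun h => h^-1 *: ((f \o shift (z + t *: v)) (h *: v) - f (z + t *: v))).
Proof.
by apply/funext => h /=; rewrite [h *: 1]mulr1 scalerDl addrCA.
Qed.

Lemma is_derive_line f z v t : derivable f (z + t *: v) v ->
  is_derive t 1 (fun t => f (z + t *: v)) ('D_v f (z + t *: v)).
Proof.
move=> df; apply: DeriveDef; first by rewrite /derivable line_growth.
by rewrite /derive line_growth.
Qed.

End Lines.

(** The mean value theorem replaces the increment by a derivative at one intermediate point. As [h]
    may be negative, two cases arise, which differ by the order of the endpoints. *)
Lemma mean_value_le {R : realType} (g : R -> R) (c e h : R) :
  (forall t, `|t| <= `|h| -> derivable g t 1 /\ `|'D_1 g t - c| <= e) ->
  `|g h - g 0 - c * h| <= e * `|h|.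
Proof.
move=> gP.
have dg (t : R) : `|t| <= `|h| -> is_derive t 1 g ('D_1 g t).
  by move=> /gP[? _]; apply: DeriveDef.
have cg (t : R) : `|t| <= `|h| -> {for t, continuous g}.
  by move=> /gP[/derivable1_diffP/differentiable_continuous].
have [h0|h0] := leP 0 h.
  have th (t : R) : t \in `[0, h] -> `|t| <= `|h|.
    by rewrite in_itv /= => /andP[t0 th]; rewrite !ger0_norm.
  have [||t tI ->] := @MVT_segment R g ('D_1 g) 0 h h0.
  - by move=> t tI; apply: dg; apply: th; apply: subset_itv_oo_cc.
  - by apply: continuous_in_subspaceT => t /[1!inE] tI; apply/cg/th.
  - rewrite subr0 -mulrBl normrM; apply: ler_wpM2r => //.
    by apply: (gP t _).2; exact: th.
have th (t : R) : t \in `[h, 0] -> `|t| <= `|h|.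
  by rewrite in_itv /= => /andP[t0 th]; rewrite (ltr0_norm h0) ler0_norm // lerN2.
have [||t tI] := @MVT_segment R g ('D_1 g) h 0 (ltW h0).
- by move=> t tI; apply: dg; apply: th; apply: subset_itv_oo_cc.
- by apply: continuous_in_subspaceT => t /[1!inE] tI; apply/cg/th.
- rewrite sub0r => E.
  rewrite -(opprB (g 0)) E mulrN opprK -mulrBl normrM; apply: ler_wpM2r => //.
  by apply: (gP t _).2; exact: th.
Qed.

Section C1.
Context {R : realType} {n : nat}.
Implicit Types (U : set 'rV[R]_n.+1) (f : 'rV[R]_n.+1 -> R) (z : 'rV[R]_n.+1).

Definition grad f z : 'cV[R]_n.+1 := \col_i pd i f z.

Let trunc (h : 'rV[R]_n.+1) (j : nat) : 'rV[R]_n.+1 :=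
  \row_i (if (i < j)%N then h 0 i else 0).

Let trunc_norm h j (t : R) : `|t| <= `|h| ->
  forall i : 'I_n.+1, (j <= i)%N -> `|trunc h j + t *: delta_mx 0 i| <= `|h|.
Proof.
move=> th i ji; apply: mx_norm_le => // a l; rewrite ord1 !mxE eqxx /=.
case: ifPn => lj.
  have /negbTE -> : l != i.
    by apply: contraTneq lj => ->; rewrite -leqNgt.
  by rewrite mulr0 addr0 le_mx_entry.
by rewrite add0r; case: eqP; rewrite ?mulr1 // mulr0 normr0.
Qed.

(** The increment [h] is switched on one coordinate at a time: [trunc h j] keeps its first j
    coordinates, and each switch is a mean value estimate along a coordinate line, costing e / (n +
    1) times the norm of [h]. The intermediate points stay in the ball of radius |h|, which is a
    cube for the sup norm. *)
Lemma C1_diff_bound U f z : open U -> Ck_on 1 U f -> U z ->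
  forall e, 0 < e -> \forall h \near (0 : 'rV[R]_n.+1),
   `|f (h + z) - f z - (h *m grad f z) 0 0| <= e * `|h|.
Proof.
move=> oU /Ck_onS[Cf Df] Uz e e0.
have n0 : 0 < n.+1%:R :> R by rewrite ltr0n.
pose e' := e / n.+1%:R.
have e'0 : 0 < e' by rewrite divr_gt0.
have : \forall y \near z, U y /\ forall i, `|pd i f y - pd i f z| <= e'.
  apply: filterI; first by apply: open_nbhs_nbhs.
  apply: (@filter_forall _ _ (fun i y => `|pd i f y - pd i f z| <= e') (nbhs z)) => i.
  have /Ck_on0 /(_ z Uz) := Df i.
  move=> /cvgr_distC_le /(_ e' e'0); exact.
move=> /nbhs_ballP[r /= r0 rP]; apply/nbhs_normP; exists r => // h.
rewrite /ball_ /= sub0r normrN => hr.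
have bP y : `|y| <= `|h| -> U (y + z) /\ forall i, `|pd i f (y + z) - pd i f z| <= e'.
  move=> yh; apply: rP; rewrite -ball_normE /ball_ /= opprD addrCA subrr addr0 normrN.
  exact: le_lt_trans hr.
have step (i : 'I_n.+1) : `|f (trunc h i.+1 + z) - f (trunc h i + z) - pd i f z * h 0 i|
     <= e' * `|h|.
  pose g t := f (trunc h i + z + t *: delta_mx 0 i).
  have -> : f (trunc h i.+1 + z) = g (h 0 i).
    rewrite /g addrAC; congr (f (_ + z)); apply/rowP => l; rewrite !mxE eqxx /=.
    rewrite ltnS leq_eqVlt; have [->|li] := eqVneq l i.
      by rewrite eqxx ltnn add0r mulr1.
    by rewrite (negbTE (_ : (l : nat) != i)) //= mulr0 addr0.
  have -> : f (trunc h i + z) = g 0 by rewrite /g scale0r addr0.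
  apply: le_trans (_ : e' * `|h 0 i| <= _); last first.
    by rewrite ler_pM2l // le_mx_entry.
  apply: mean_value_le => t th.
  have := bP (trunc h i + t *: delta_mx 0 i) (trunc_norm (le_trans th (le_mx_entry _ _ _)) (leqnn i)).
  rewrite addrAC => -[Uy ye].
  have dy := (Cf _ Uy).2 i.
  have /= [d1 d2] := is_derive_line dy.
  by split=> //; rewrite d2; exact: ye.
have -> : f (h + z) - f z - (h *m grad f z) 0 0 =
   \sum_(i < n.+1) (f (trunc h i.+1 + z) - f (trunc h i + z) - pd i f z * h 0 i).
  rewrite sumrB -(big_mkord xpredT (fun i => f (trunc h i.+1 + z) - f (trunc h i + z))) telescope_sumr //.
  have -> : trunc h n.+1 = h.
    by apply/rowP => l; rewrite mxE ltn_ord.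
  have -> : trunc h 0 = 0 by apply/rowP => l; rewrite !mxE.
  rewrite add0r; congr (_ - _); rewrite mxE; apply: eq_bigr => i _.
  by rewrite mxE mulrC.
apply: le_trans (ler_norm_sum _ _ _) _.
apply: le_trans (ler_sum _ (fun i _ => step i)) _.
rewrite sumr_const card_ord -mulrnAl /e' -mulr_natr divfK //.
Qed.

(** Partial derivatives alone do not give a chain rule along curves; the Frechet derivative does,
    and velocities in two charts are compared through it. *)
Lemma C1_differentiable U f z : open U -> Ck_on 1 U f -> U z ->
  differentiable f z /\ forall v, 'D_v f z = (v *m grad f z) 0 0.
Proof.
move=> oU Cf Uz.
pose L (v : 'rV[R]_n.+1) : R := (v *m grad f z) 0 0.
have L_lin : linear L by move=> a u v; rewrite /L mulmxDl -scalemxAl !mxE.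
pose Lm := GRing.isLinear.Build _ _ _ _ _ L_lin.
pose Ll : {linear 'rV[R]_n.+1 -> R} := HB.pack L Lm.
have cL : continuous Ll.
  move=> v; suff : {for v, continuous (fun v : 'rV[R]_n.+1 => \sum_i v 0 i * grad f z i 0)}.
    rewrite (_ : (fun v : 'rV[R]_n.+1 => _) = L) //.
    by apply/funext => w; rewrite /L mxE.
  apply: continuous_at_sum => i _; apply: continuous_at_mul.
    exact: coord_continuous.
  exact: continuous_at_cst.
have fL : f \o shift z = cst (f z) + Ll +o_ (0 : 'rV[R]_n.+1) id.
  apply/eqaddoP => e e0.
  have := C1_diff_bound oU Cf Uz e0.
  by apply: filterS => h /=; rewrite opprD addrA.
have dE := diff_unique cL fL.
have df : differentiable f z.
  apply/diff_locallyP; rewrite dE; split=> //.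
by split=> // v; rewrite deriveE // dE.
Qed.

Lemma is_derive_curve U f (x : R -> 'rV[R]_n.+1) (t : R) :
  open U -> Ck_on 1 U f -> U (x t) ->
  (forall i, derivable (fun t => x t 0 i) t 1) ->
  is_derive t 1 (fun t => f (x t))
    (\sum_i derive1 (fun t => x t 0 i) t * pd i f (x t)).
Proof.
move=> oU Cf Ux dx.
have [df Df] := C1_differentiable oU Cf Ux.
have dx' : derivable x t 1 by apply/derivable_mxP => i j; rewrite ord1.
have dx'' : differentiable x t by apply/derivable1_diffP.
have dfx : differentiable (f \o x) t by exact: differentiable_comp.
apply: DeriveDef; first exact: diff_derivable.
rewrite (deriveE (1 : R) dfx) diff_comp //= -(deriveE (1 : R) dx'') -(deriveE _ df) Df.
rewrite mxE; apply: eq_bigr => i _; rewrite mxE; congr (_ * _).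
by rewrite derive_mx // mxE derive1E.
Qed.

End C1.

(** * Smooth cutoff functions *)

Section FlatFunctions.
Context {R : realType}.
Implicit Types (p : {poly R}) (x : R).

(* The functions p(1/x) e^{-1/x}, extended by 0, are closed under derivation. *)
Definition flat p x : R := if 0 < x then p.[x^-1] * expR (- x^-1) else 0.

(** With y = 1/x >= 1, the polynomial is at most a constant times y^N, and e^y is at least
    y^(N+1)/(N+1)!. The spare power of y gives the factor |x|, which yields differentiability at
    0. *)
Lemma flat_bound p : exists2 C, 0 <= C & forall x, `|x| <= 1 -> `|flat p x| <= C * `|x|.
Proof.
pose N := size p.
pose C := (\sum_(i < N) `|p`_i|) * N.+1`!%:R.
have S0 : 0 <= \sum_(i < N) `|p`_i| by apply: sumr_ge0.
have C0 : 0 <= C by rewrite mulr_ge0.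
exists C => // x x1; rewrite /flat; case: ifPn => x0; last first.
  by rewrite normr0 mulr_ge0.
move: x1; rewrite gtr0_norm // => x1.
set y := x^-1.
have y1 : 1 <= y by rewrite invf_ge1.
have y0 : 0 < y by rewrite invr_gt0.
rewrite normrM [`|expR _|]gtr0_norm ?expR_gt0 // expRN.
rewrite ler_pdivrMr ?expR_gt0 //.
have py : `|p.[y]| <= (\sum_(i < N) `|p`_i|) * y ^+ N.
  rewrite horner_coef; apply: le_trans (ler_norm_sum _ _ _) _.
  rewrite mulr_suml; apply: ler_sum => i _.
  rewrite normrM ler_wpM2l // normrX gtr0_norm //.
  by apply: ler_weXn2l => //; exact: ltnW.
apply: le_trans py _.
have := expR_ge1Dxn N (ltW y0).
move=> /(le_trans (_ : y ^+ N.+1 / N.+1`!%:R <= _)) e.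
have {}e : y ^+ N.+1 / N.+1`!%:R <= expR y by apply: e; rewrite lerDr.
rewrite /C -!mulrA ler_wpM2l //.
have -> : y ^+ N = N.+1`!%:R * (x * (y ^+ N.+1 / N.+1`!%:R)).
  have F0 : N.+1`!%:R != 0 :> R by rewrite pnatr_eq0 -lt0n fact_gt0.
  rewrite mulrCA [_%:R * _]mulrC divfK // exprS mulrA mulfV ?mul1r //.
  by rewrite gt_eqF.
rewrite ler_wpM2l // ler_wpM2l // ltW //.
Qed.

Lemma flat_deriv p x : is_derive x 1 (flat p) (flat ('X^2 * (p - p^`())) x).
Proof.
have [x0|x0|->] := ltgtP x 0.
- have E : \near x, (fun=> 0) x = flat p x.
    have : \forall y \near x, y < 0 by exact: lt_nbhsl.
    by apply: filterS => y y0; rewrite /flat lt_gtF.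
  apply: near_eq_is_derive E _; rewrite /flat lt_gtF //; exact: is_derive_cst.
- have E : \near x, (fun x => p.[x^-1] * expR (- x^-1)) x = flat p x.
    have : \forall y \near x, 0 < y by exact: lt_nbhsr.
    by apply: filterS => y y0; rewrite /flat y0.
  apply: near_eq_is_derive E _; rewrite /flat x0.
  have xn0 : x != 0 by rewrite gt_eqF.
  have dV : is_derive x 1 (fun x : R => x^-1) (- (x ^- 2)).
    have := @is_deriveV R id x 1 1 xn0 (is_derive_id x (1 : R)).
    by move=> h; apply: (is_derive_eq h); rewrite [_ *: _]mulr1.
  have dp : is_derive x 1 (fun x => p.[x^-1]) (- x ^- 2 * p^`().[x^-1]).
    have hp : is_derive x^-1 1 (horner p) p^`().[x^-1].
      apply: DeriveDef; first exact: derivable_horner.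
      by rewrite derivE derive1E.
    by have h := is_derive1_comp hp dV; apply: (is_derive_eq h); rewrite mulrC.
  have de : is_derive x 1 (fun x => expR (- x^-1)) (x ^- 2 * expR (- x^-1)).
    have dN : is_derive x 1 (fun x => - x^-1) (x ^- 2).
      by have h := is_deriveN dV; apply: (is_derive_eq h); rewrite opprK.
    have h := @is_derive1_comp R expR (fun x => - x^-1) x _ _ (is_derive_expR (- x^-1)) dN.
    by apply: (is_derive_eq h); rewrite mulrC.
  have := is_deriveM dp de.
  move=> h; apply: (is_derive_eq h).
  rewrite hornerM hornerXn hornerD hornerN -exprVn /GRing.scale /=; ring.
have d0 : flat ('X^2 * (p - p^`())) 0 = 0 by rewrite /flat ltxx.
(* Dividing [flat p] by h multiplies the polynomial by X, so the difference quotient at 0 is again a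
   flat function, which tends to 0. *)
rewrite d0; have [C C0 CP] := flat_bound ('X * p).
have lim0 : h^-1 *: ((flat p \o shift 0) (h *: 1) - flat p 0) @[h --> 0^'] --> (0 : R).
  have -> : (fun h : R => h^-1 *: ((flat p \o shift 0) (h *: 1) - flat p 0)) = flat ('X * p).
    apply/funext => h; rewrite /= addr0 [h *: 1]mulr1 /flat ltxx subr0.
    by case: ifPn => h0; rewrite ?scaler0 // hornerE hornerX -mulrA.
  apply/cvgr0Pnorm_le => e e0.
  have : \forall h \near (0 : R)^', `|h| <= Num.min 1 (e / (C + 1)).
    apply: dnbhs0_le; rewrite lt_min ltr01 divr_gt0 //; lra.
  apply: filterS => h; rewrite le_min => /andP[h1 he].
  apply: le_trans (CP _ h1) _.
  apply: le_trans (_ : (C + 1) * `|h| <= _); first by rewrite ler_wpM2r // lerDl.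
  rewrite mulrC -ler_pdivlMr //; lra.
apply: DeriveDef; last exact: cvg_lim.
by apply/cvg_ex; exists 0.
Qed.

Lemma derivable_flat j p x : derivable (derive1n j (flat p)) x 1.
Proof.
elim: j p => [|j IH] p; first by have [] := flat_deriv p x.
rewrite derive1Sn (_ : derive1 (flat p) = flat ('X^2 * (p - p^`()))) //.
by apply/funext => y; rewrite derive1E; have [] := flat_deriv p y.
Qed.

Definition cutoff : R -> R := flat 1.

Lemma cutoff_gt0 x : 0 < x -> 0 < cutoff x.
Proof. by move=> x0; rewrite /cutoff /flat x0 hornerE mul1r expR_gt0. Qed.

Lemma cutoff_le0 x : x <= 0 -> cutoff x = 0.
Proof. by move=> x0; rewrite /cutoff /flat ltNge x0. Qed.

Lemma cutoff_ge0 x : 0 <= cutoff x.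
Proof. by have [/cutoff_le0 ->|/cutoff_gt0/ltW] := leP x 0. Qed.

End FlatFunctions.

(** * Iterated integrals *)

Lemma continuous_at_pair (X Y Z : topologicalType) (f : X -> Y) (g : X -> Z) x :
  {for x, continuous f} -> {for x, continuous g} ->
  {for x, continuous (fun x => (f x, g x))}.
Proof. by move=> cf cg; exact: (cvg_pair cf cg). Qed.

Lemma continuous_at_fst (X Y Z : topologicalType) (f : X -> Y * Z) x :
  {for x, continuous f} -> {for x, continuous (fun x => (f x).1)}.
Proof. by move=> cf; apply: continuous_comp cf _; exact: cvg_fst. Qed.

Lemma continuous_at_snd (X Y Z : topologicalType) (f : X -> Y * Z) x :
  {for x, continuous f} -> {for x, continuous (fun x => (f x).2)}.
Proof. by move=> cf; apply: continuous_comp cf _; exact: cvg_snd. Qed.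

Section IteratedIntegral.
Context {R : realType}.
Local Notation leb := (@lebesgue_measure R).

Lemma integrable_seg (a b : R) (g : R -> R) : (forall t, {for t, continuous g}) ->
  leb.-integrable `[a, b] (EFin \o g).
Proof.
move=> cg; apply: continuous_compact_integrable; first exact: segment_compact.
by apply: continuous_subspaceT => t; exact: cg.
Qed.

Lemma Rintegral_supp (L : R) (g : R -> R) : (forall t, L < `|t| -> g t = 0) ->
  \int[leb]_(t in setT) g t = \int[leb]_(t in `[- L, L]) g t.
Proof.
move=> g0; rewrite [RHS]Rintegral_mkcond; congr (\int[leb]_(t in setT) _).
apply/funext => t; rewrite patchE; case: ifPn => //.
by rewrite notin_setE /= in_itv /= -ler_norml => /negP; rewrite -ltNge => /g0.
Qed.

Lemma Rintegral_seg_bound (a b : R) (g : R -> R) (e : R) : a <= b ->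
  (forall t, {for t, continuous g}) -> (forall t, a <= t <= b -> `|g t| <= e) ->
  `|\int[leb]_(t in `[a, b]) g t| <= e * (b - a).
Proof.
move=> ab cg ge.
have ig : leb.-integrable `[a, b] (EFin \o g) by exact: integrable_seg.
have h1 : `|\int[leb]_(t in `[a, b]) g t| <= \int[leb]_(t in `[a, b]) `|g t|.
  exact: le_normr_Rintegral.
apply: (le_trans h1).
have -> : e * (b - a) = \int[leb]_(t in `[a, b]) e.
  by rewrite Rintegral_cst //= lebesgue_measure_itv /= lte_fin; case: ltgtP ab => // ->;
    rewrite subrr.
apply: le_Rintegral => //.
- by apply: integrable_seg => t; apply: continuous_comp; [exact: cg|exact: norm_continuous].
- by apply: integrable_seg => t; exact: cst_continuous.
Qed.

(** Compactness of [-L, L] upgrades joint continuity to a bound uniform in t. The parameter space is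
    an arbitrary topological space, so that the induction on iterated integrals can move coordinates
    into it. *)
Lemma Rintegral_param_continuous (T : topologicalType) (U : set T) (L : R)
    (G : T -> R -> R) (x : T) : 0 <= L -> open U -> U x ->
  (forall y t, U y -> {for (y, t), continuous (fun p : T * R => G p.1 p.2)}) ->
  (forall y t, U y -> L < `|t| -> G y t = 0) ->
  {for x, continuous (fun y => \int[leb]_(t in setT) G y t)}.
Proof.
move=> L0 oU Ux cG G0.
have cGt y t : U y -> {for t, continuous (G y)}.
  move=> Uy; apply: (@continuous_comp _ _ _ (fun t => (y, t)) (fun p : T * R => G p.1 p.2)).
    by apply: continuous_at_pair; [exact: cst_continuous|exact: cvg_id].
  exact: cG.
apply/cvgrPdist_le => /= e e0.
(* The length of the segment is 2 L; the added 1 keeps [e'] positive when L = 0. *)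
pose e' := e / (L - - L + 1).
have e'0 : 0 < e' by rewrite divr_gt0 //; lra.
have cpt := segment_compact (a := - L) (b := L).
have /compact_near_coveringP/(_ T (nbhs x) (fun y t => `|G x t - G y t| <= e')) := cpt.
move=> /(_ _ _)/wrap[].
  move=> t _.
  have H1 : \forall p \near (x, t), `|G x t - G p.1 p.2| <= e' / 2.
    have /cvgrPdist_le/(_ (e' / 2)) := cG x t Ux; apply; lra.
  have H2 : \forall s \near t, `|G x t - G x s| <= e' / 2.
    have /cvgrPdist_le/(_ (e' / 2)) := cGt x t Ux; apply; lra.
  case: H1 => -[/= A B] [Ax Bt] AB.
  exists (B `&` (fun s => `|G x t - G x s| <= e' / 2), A).
    by split=> //; apply: filterI.
  move=> [s y] /= [[Bs Hs] Ay].
  have /= := AB (y, s) (conj Ay Bs) => Hy.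
  rewrite -(subrKA (G x t)); apply: le_trans (ler_normD _ _) _.
  by rewrite distrC; lra.
move=> near_e.
have : \forall y \near x, U y /\ forall t, `[- L, L]%classic t -> `|G x t - G y t| <= e'.
  by apply: filterI => //; exact: open_nbhs_nbhs.
apply: filterS => y [Uy Hy].
rewrite (Rintegral_supp (L := L)); last by move=> t; exact: G0.
rewrite (Rintegral_supp (L := L)); last by move=> t; exact: G0.
rewrite -RintegralB //; last 2 first.
- by apply: integrable_seg => t; exact: cGt.
- by apply: integrable_seg => t; exact: cGt.
apply: le_trans (Rintegral_seg_bound (e := e') _ _ _) _.
- lra.
- by move=> t; apply: continuous_at_sub; exact: cGt.
- by move=> t tL; apply: Hy; rewrite /= in_itv.
rewrite /e' -mulrA ler_piMr //; first exact: ltW.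
rewrite mulrC ler_pdivrMr; lra.
Qed.


Definition box_supp n (L : R) (h : 'rV[R]_n -> R) :=
  forall (v : 'rV[R]_n) i, L < `|v 0 i| -> h v = 0.

Lemma row_mx0E n (t : R) (v : 'rV[R]_n) :
  (row_mx (t%:M : 'rV[R]_1) v : 'rV[R]_n.+1) 0 ord0 = t.
Proof.
have -> : (ord0 : 'I_n.+1) = lshift n (ord0 : 'I_1) by apply/val_inj.
by apply: etrans (row_mxEl (t%:M : 'rV[R]_1) v 0 ord0) _; rewrite mxE eqxx mulr1n.
Qed.

Lemma row_mxSE n (t : R) (v : 'rV[R]_n) (i : 'I_n) :
  (row_mx (t%:M : 'rV[R]_1) v : 'rV[R]_n.+1) 0 (lift ord0 i) = v 0 i.
Proof.
have -> : lift ord0 i = rshift 1 i by apply/val_inj.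
by apply: etrans (row_mxEr (t%:M : 'rV[R]_1) v 0 i) _.
Qed.

Lemma box_supp_row n L (h : 'rV[R]_n.+1 -> R) (t : R) : box_supp L h ->
  box_supp L (fun v : 'rV[R]_n => h (row_mx (t%:M : 'rV[R]_1) v)).
Proof. by move=> h0 v i vi; apply: (h0 _ (lift ord0 i)); rewrite row_mxSE. Qed.

Lemma integral_rV_box0 n L (h : 'rV[R]_n.+1 -> R) (t : R) : box_supp L h ->
  L < `|t| -> integral_rV (fun v : 'rV[R]_n => h (row_mx (t%:M : 'rV[R]_1) v)) = 0.
Proof.
move=> h0 tL.
have -> : (fun v : 'rV[R]_n => h (row_mx (t%:M : 'rV[R]_1) v)) = fun=> 0.
  by apply/funext => v; apply: (h0 _ ord0); rewrite row_mx0E.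
elim: n {h h0} => [//|n IH] /=.
by under eq_Rintegral do rewrite IH; rewrite Rintegral_cst //= mul0r.
Qed.

Lemma continuous_row_mx (T : topologicalType) (x : T) n (t : T -> R)
    (v : T -> 'rV[R]_n) : {for x, continuous t} -> {for x, continuous v} ->
  {for x, continuous (fun y => row_mx ((t y)%:M : 'rV[R]_1) (v y) : 'rV[R]_n.+1)}.
Proof.
move=> ct cv; apply: continuous_at_mx => a j; rewrite ord1.
case: (unliftP ord0 j) => [i ->|->].
  rewrite (_ : (fun _ => _) = fun y => v y 0 i); first exact: continuous_at_entry.
  by apply/funext => y; rewrite row_mxSE.
rewrite (_ : (fun _ => _) = t) //.
by apply/funext => y; rewrite row_mx0E.
Qed.

(** The slice integrals must be jointly continuous in the parameter and in the slicing coordinate,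
    so the induction passes from the parameter space [T] to [T * R]. *)
Lemma integral_rV_continuous n (T : topologicalType) (U : set T) (L : R)
    (H : T -> 'rV[R]_n -> R) (x : T) : 0 <= L -> open U -> U x ->
  (forall y v, U y ->
     {for (y, v), continuous (fun p : T * 'rV[R]_n => H p.1 p.2)}) ->
  (forall y, U y -> box_supp L (H y)) ->
  {for x, continuous (fun y => integral_rV (H y))}.
Proof.
move=> L0; elim: n T U H x => [|n IH] T U H x oU Ux cH H0 /=.
  apply: (@continuous_comp _ _ _ (fun t : T => (t, 0 : 'rV[R]_0)) (fun p : T * 'rV[R]_0 => H p.1 p.2)).
    by apply: continuous_at_pair; [exact: cvg_id|exact: cst_continuous].
  exact: cH.
apply: (@Rintegral_param_continuous T U L
  (fun y t => integral_rV (fun v : 'rV[R]_n => H y (row_mx (t%:M : 'rV[R]_1) v)))) => //.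
  move=> y t Uy.
  have := IH (T * R)%type (fst @^-1` U)
    (fun p v => H p.1 (row_mx (p.2%:M : 'rV[R]_1) v)) (y, t).
  apply => //=.
  - by apply: open_comp => // p _; exact: cvg_fst.
  - move=> [z s] v /= Uz.
    apply: (@continuous_comp _ _ _
      (fun q : T * R * 'rV[R]_n => (q.1.1, row_mx (q.1.2%:M : 'rV[R]_1) q.2 : 'rV[R]_n.+1))
      (fun p : T * 'rV[R]_n.+1 => H p.1 p.2)); last exact: cH.
    have c1 : {for (z, s, v), continuous (fun q : T * R * 'rV[R]_n => q.1)} by exact: cvg_fst.
    apply: continuous_at_pair.
      exact: continuous_at_fst.
    apply: continuous_row_mx; last exact: cvg_snd.
    exact: continuous_at_snd.
  - by move=> [z s] Uz; apply: box_supp_row; exact: H0.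
by move=> y t Uy tL; apply: integral_rV_box0 tL; exact: H0.
Qed.

Definition compactly_continuous n (L : R) (h : 'rV[R]_n -> R) :=
  continuous h /\ box_supp L h.

Lemma compactly_continuous_row n L (h : 'rV[R]_n.+1 -> R) (t : R) :
  compactly_continuous L h ->
  compactly_continuous L (fun v : 'rV[R]_n => h (row_mx (t%:M : 'rV[R]_1) v)).
Proof.
move=> [ch h0]; split; last exact: box_supp_row.
move=> v; apply: (@continuous_comp _ _ _
   (fun v : 'rV[R]_n => row_mx (t%:M : 'rV[R]_1) v : 'rV[R]_n.+1) h); last exact: ch.
by apply: continuous_row_mx; [exact: cst_continuous|exact: cvg_id].
Qed.

Lemma slice_continuous n L (h : 'rV[R]_n.+1 -> R) : 0 <= L ->
  compactly_continuous L h -> forall t : R, {for t, continuous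
  (fun t => integral_rV (fun v : 'rV[R]_n => h (row_mx (t%:M : 'rV[R]_1) v)))}.
Proof.
move=> L0 [ch h0] t.
apply: (@integral_rV_continuous n R setT L
  (fun t v => h (row_mx (t%:M : 'rV[R]_1) v))) => //; first exact: openT.
  move=> y v _; apply: (@continuous_comp _ _ _
   (fun p : R * 'rV[R]_n => row_mx (p.1%:M : 'rV[R]_1) p.2 : 'rV[R]_n.+1) h); last exact: ch.
  by apply: continuous_row_mx; [exact: cvg_fst|exact: cvg_snd].
by move=> y _; exact: box_supp_row.
Qed.

Lemma integral_rV_lin n L (a : R) (h g : 'rV[R]_n -> R) : 0 <= L ->
  compactly_continuous L h -> compactly_continuous L g ->
  integral_rV (fun v => a * h v + g v) = a * integral_rV h + integral_rV g.
Proof.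
move=> L0; elim: n h g => [//|n IH] h g Ch Cg /=.
under eq_Rintegral => t _.
  rewrite (IH (fun v : 'rV[R]_n => h (row_mx (t%:M : 'rV[R]_1) v))
    (fun v : 'rV[R]_n => g (row_mx (t%:M : 'rV[R]_1) v))); last 2 first.
    exact: compactly_continuous_row.
    exact: compactly_continuous_row.
  over.
have sh (f : 'rV[R]_n.+1 -> R) : compactly_continuous L f ->
    forall t : R, L < `|t| -> integral_rV (fun v : 'rV[R]_n => f (row_mx (t%:M : 'rV[R]_1) v)) = 0.
  by move=> [_ f0] t; exact: integral_rV_box0.
rewrite (Rintegral_supp (L := L)); last first.
  by move=> t tL; rewrite !sh // mulr0 addr0.
rewrite (Rintegral_supp (sh h Ch)) (Rintegral_supp (sh g Cg)).
have cah (t : R) : {for t, continuous (fun t => a * integral_rV (fun v : 'rV[R]_n => h (row_mx (t%:M : 'rV[R]_1) v)))}.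
  apply: continuous_at_mul; first exact: continuous_at_cst.
  exact: (slice_continuous L0 Ch).
rewrite RintegralD //.
- by rewrite RintegralZl //; apply: integrable_seg => t; exact: (slice_continuous L0 Ch).
- exact: integrable_seg.
- by apply: integrable_seg => t; exact: (slice_continuous L0 Cg).
Qed.

Lemma integral_rV_bound n L (h : 'rV[R]_n -> R) e : 0 <= L ->
  compactly_continuous L h -> (forall v, `|h v| <= e) ->
  `|integral_rV h| <= e * (L - - L) ^+ n.
Proof.
move=> L0; elim: n h => [|n IH] h Ch he /=; first by rewrite expr0 mulr1.
rewrite (Rintegral_supp (L := L)); last first.
  by move=> t; apply: integral_rV_box0; case: Ch.
rewrite exprSr mulrA; apply: Rintegral_seg_bound; first lra.
  exact: (slice_continuous L0 Ch).
by move=> t _; apply: IH => //; exact: compactly_continuous_row.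
Qed.

Lemma integral_rV_ge0 n (h : 'rV[R]_n -> R) :
  (forall v, 0 <= h v) -> 0 <= integral_rV h.
Proof.
elim: n h => [|n IH] h h0 /=; first exact: h0.
by apply: Rintegral_ge0 => t _; apply: IH => v; exact: h0.
Qed.

(** By induction the slice through the first coordinate of [v] has a positive integral; continuity
    keeps the slice integrals above half that value on a whole interval. *)
Lemma integral_rV_gt0 n L (h : 'rV[R]_n -> R) v : 0 <= L ->
  compactly_continuous L h -> (forall v, 0 <= h v) -> 0 < h v -> 0 < integral_rV h.
Proof.
move=> L0; elim: n h v => [|n IH] h v Ch h0 hv /=.
  by rewrite (_ : 0 = v) //; apply/rowP => -[].
pose g t := integral_rV (fun v : 'rV[R]_n => h (row_mx (t%:M : 'rV[R]_1) v)).
have cg := slice_continuous L0 Ch.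
pose t0 := v 0 0; pose w : 'rV[R]_n := \row_i v 0 (lift ord0 i).
have vE : v = row_mx (t0%:M : 'rV[R]_1) w.
  apply/rowP => j; case: (unliftP ord0 j) => [i ->|->].
    by rewrite row_mxSE mxE.
  by rewrite row_mx0E.
have g0 t : 0 <= g t.
  by apply: integral_rV_ge0 => v'; exact: h0.
have gt0 : 0 < g t0.
  apply: (IH _ w) => //; last by rewrite -vE.
  exact: compactly_continuous_row.
have : \forall t \near t0, g t0 / 2 <= g t.
  have /cvgrPdist_le/(_ (g t0 / 2)) := cg t0.
  move=> /(_ (divr_gt0 gt0 (ltr0n _ 2))); apply: filterS => t.
  rewrite -/(g t) -/(g t0) ler_distl; lra.
move=> /nbhs_ballP[d /= d0 dP].
have dP' t : t0 - d / 2 <= t <= t0 + d / 2 -> g t0 / 2 <= g t.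
  move=> /andP[t1 t2]; apply: dP; rewrite /ball /= ltr_distlC; apply/andP; split; lra.
have gs t : L < `|t| -> g t = 0 by apply: integral_rV_box0; case: Ch.
(* The support bound is enlarged so that [-K, K] contains the interval around [t0]. *)
pose K := L + `|t0| + d.
have KL t : K < `|t| -> g t = 0.
  move=> tK; apply: gs; apply: le_lt_trans tK; rewrite /K -addrA lerDl.
  by rewrite addr_ge0 // ltW.
rewrite -/g (Rintegral_supp KL).
pose a := t0 - d / 2; pose b := t0 + d / 2; pose c := g t0 / 2.
have -> : \int[leb]_(t in `[- K, K]) g t = fine (\int[leb]_(t in `[- K, K]) (g t)%:E) by [].
apply: fine_gt0; apply/andP; split; last first.
  rewrite ltey_eq; apply/orP; left.
  by apply: integrable_fin_num => //; exact: integrable_seg.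
apply: (@lt_le_trans _ _ (\int[leb]_(t in `[a, b]) c%:E)%E).
  rewrite integral_cst //= lebesgue_measure_itv /= lte_fin ifT; last by rewrite /a /b; lra.
  by rewrite -EFinD -EFinM lte_fin mulr_gt0 // /a /b /c; lra.
apply: (@le_trans _ _ (\int[leb]_(t in `[a, b]) (g t)%:E)%E).
  apply: ge0_le_integral => //=.
  - by move=> t _; rewrite lee_fin /c; lra.
  - apply/measurable_EFinP; apply: measurable_funTS.
    exact: continuous_measurable_fun.
apply: ge0_subset_integral => //=.
- apply/measurable_EFinP; apply: measurable_funTS.
  exact: continuous_measurable_fun.
- by move=> t _; rewrite lee_fin.
- move=> t /=; rewrite !in_itv /= /K /a /b => /andP[t1 t2].
  have := ler_norm t0; have := ler_norm (- t0); rewrite normrN => h1 h2.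
  apply/andP; split; lra.
Qed.

End IteratedIntegral.

Arguments integral_rV {R} {n} _ : simpl never.

(** * Differentiation under the iterated integral *)

Section DerivativeUnderIntegral.
Context {R : realType}.

Lemma continuous_at_affine (T : topologicalType) (V : normedModType R) x
    (f : T -> V) (t : T -> R) (e : V) :
  {for x, continuous f} -> {for x, continuous t} ->
  {for x, continuous (fun y => f y + t y *: e)}.
Proof. by move=> cf ct; apply: (cvgD cf); exact: (cvgZr_tmp ct). Qed.

Lemma compact_box n (L : R) : compact [set v : 'rV[R]_n.+1 | forall i, `|v 0 i| <= L].
Proof.
have -> : [set v : 'rV[R]_n.+1 | forall i, `|v 0 i| <= L] =
          [set v | forall i, `[- L, L]%classic (v ord0 i)].
  by apply/seteqP; split=> v /= vL i; have := vL i; rewrite in_itv /= ler_norml.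
by apply: (@rV_compact R n.+1 (fun=> `[- L, L]%classic)) => i; exact: segment_compact.
Qed.

Lemma compactly_continuous_add n L (h g : 'rV[R]_n -> R) :
  compactly_continuous L h -> compactly_continuous L g ->
  compactly_continuous L (fun v => h v + g v).
Proof.
move=> [ch h0] [cg g0]; split=> [v|v i vL]; first exact: (continuous_at_add (ch v) (cg v)).
by rewrite (h0 v i) // (g0 v i) // addr0.
Qed.

Lemma compactly_continuous_scale n L (a : R) (h : 'rV[R]_n -> R) :
  compactly_continuous L h -> compactly_continuous L (fun v => a * h v).
Proof.
move=> [ch h0]; split=> [v|v i vL]; last by rewrite (h0 v i) // mulr0.
exact: (continuous_at_mul (@continuous_at_cst _ _ v a) (ch v)).
Qed.

Lemma integral_rV_scale n L (a : R) (h : 'rV[R]_n -> R) : 0 <= L ->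
  compactly_continuous L h -> integral_rV (fun v => a * h v) = a * integral_rV h.
Proof.
move=> L0 Ch.
have C0 : compactly_continuous L (fun v : 'rV[R]_n => 0 * h v).
  exact: compactly_continuous_scale.
have z0 : integral_rV (fun v : 'rV[R]_n => 0 * h v) = 0.
  have := @integral_rV_lin R n L 1 _ _ L0 C0 C0.
  under eq_fun do rewrite mul1r mul0r addr0.
  under [X in _ = _ * integral_rV X + _]eq_fun do rewrite mul0r.
  under [X in _ = _ + integral_rV X]eq_fun do rewrite mul0r.
  under [X in _ -> integral_rV X = _]eq_fun do rewrite mul0r.
  move: (integral_rV _) => x; lra.
have := integral_rV_lin a L0 Ch C0; rewrite z0 addr0 => <-.
by congr integral_rV; apply/funext => v; rewrite mul0r addr0.
Qed.

(** The difference quotient minus the expected integrand is small by the mean value inequality,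
    uniformly over the support box by compactness, and the box has finite volume. *)
Lemma is_derive_integral_rV n L (H H' : R -> 'rV[R]_n.+1 -> R) (r0 d : R) :
  0 <= L -> 0 < d ->
  (forall r v, `|r - r0| < d -> is_derive r 1 (H^~ v) (H' r v)) ->
  (forall r, `|r - r0| < d -> compactly_continuous L (H r)) ->
  compactly_continuous L (H' r0) ->
  (forall v, {for (r0, v), continuous (fun p : R * 'rV[R]_n.+1 => H' p.1 p.2)}) ->
  is_derive r0 1 (fun r => integral_rV (H r)) (integral_rV (H' r0)).
Proof.
move=> L0 d0 dH CH CH' cH'.
suff lim : h^-1 *: (((fun r => integral_rV (H r)) \o shift r0) (h *: 1) -
     integral_rV (H r0)) @[h --> 0^'] --> integral_rV (H' r0).
  apply: DeriveDef; last exact: cvg_lim.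
  by apply/cvg_ex; exists (integral_rV (H' r0)).
apply/cvgrPdist_le => /= e e0.
pose K := (L - - L) ^+ n.+1.
have K0 : 0 <= K by rewrite exprn_ge0 //; lra.
pose e' := e / (K + 1).
have e'0 : 0 < e' by rewrite divr_gt0 //; lra.
have /compact_near_coveringP/(_ R (nbhs (0 : R))
  (fun s v => `|H' (s + r0) v - H' r0 v| <= e')) := @compact_box n L.
move=> /(_ _ _)/wrap[].
  move=> v _.
  have cs : {for (v, 0), continuous (fun p : 'rV[R]_n.+1 * R => H' (p.2 + r0) p.1)}.
    apply: (@continuous_comp _ _ _ (fun p : 'rV[R]_n.+1 * R => (p.2 + r0, p.1))
             (fun p : R * 'rV[R]_n.+1 => H' p.1 p.2)).
      apply: continuous_at_pair; last exact: cvg_fst.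
      apply: continuous_at_add; last exact: cst_continuous.
      exact: cvg_snd.
    by rewrite /= add0r; exact: cH'.
  have c0 : {for (v, 0), continuous (fun p : 'rV[R]_n.+1 * R => H' r0 p.1)}.
    apply: (@continuous_comp _ _ _ (fun p : 'rV[R]_n.+1 * R => p.1) (H' r0)).
      exact: cvg_fst.
    by case: CH' => + _; exact.
  have := continuous_at_sub cs c0.
  move=> /cvgrPdist_le/(_ e' e'0); rewrite /= add0r subrr.
  by under eq_near do rewrite sub0r normrN.
move=> [r /= r0' rP].
have A : \forall h \near (0 : R)^', `|h| <= Num.min (r / 2) (d / 2).
  by apply: dnbhs0_le; rewrite lt_min; apply/andP; split; lra.
have B : \forall h \near (0 : R)^', h != 0 by exact: nbhs_dnbhs_neq.
apply: filterS2 A B => h; rewrite le_min => /andP[hr hd] h0.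
rewrite [h *: 1]mulr1 /=.
have Cr0 : compactly_continuous L (H r0) by apply: CH; rewrite subrr normr0.
have Chr : compactly_continuous L (H (h + r0)) by apply: CH; rewrite addrK; lra.
(* The error of the difference quotient, written as a linear combination so that [integral_rV_lin]
   splits its integral. *)
pose q v := h^-1 * H (h + r0) v + ((- h^-1) * H r0 v + (-1) * H' r0 v).
have Cq : compactly_continuous L q.
  by do 2?[apply: compactly_continuous_add]; exact: compactly_continuous_scale.
have -> : integral_rV (H' r0) - h^-1 *: (integral_rV (H (h + r0)) - integral_rV (H r0)) =
          - integral_rV q.
  have C1 := compactly_continuous_scale (-1) CH'.
  have C2 := compactly_continuous_add (compactly_continuous_scale (- h^-1) Cr0) C1.
  rewrite (integral_rV_lin _ L0 Chr C2) (integral_rV_lin _ L0 Cr0 C1).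
  rewrite (integral_rV_scale _ L0 CH') /GRing.scale /=; ring.
rewrite normrN; apply: le_trans (integral_rV_bound (e := e') L0 Cq _) _; last first.
  by rewrite -/K /e' -mulrA ler_piMr ?(ltW e0) // mulrC ler_pdivrMr; lra.
move=> v; have [vL|] := pselect (forall i, `|v 0 i| <= L); last first.
  move=> /existsNP[i /negP]; rewrite -ltNge => vi.
  have [_ z1] := Chr; have [_ z2] := Cr0; have [_ z3] := CH'.
  by rewrite /q (z1 v i) // (z2 v i) // (z3 v i) // !mulr0 !addr0 normr0 ltW.
have -> : q v = h^-1 * (H (h + r0) v - H (0 + r0) v - H' r0 v * h).
  by rewrite /q add0r; field.
rewrite normrM normfV ler_pdivrMl ?normr_gt0 // [leRHS]mulrC.
apply: (@mean_value_le R (fun s => H (s + r0) v)) => t th.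
have tr : `|t| < r by apply: le_lt_trans th _; lra.
have td : `|t + r0 - r0| < d by rewrite addrK; apply: le_lt_trans th _; lra.
have ds : is_derive t 1 (fun s : R => s + r0) 1.
  have -> : (fun s : R => s + r0) = (id + cst r0) by [].
  by apply: is_derive_eq; rewrite addr0.
have := @is_derive1_comp R (H^~ v) (fun s => s + r0) t _ _ (dH _ v td) ds.
move=> [dc Dc]; split=> //; rewrite [X in `|X - _|]Dc mulr1.
by apply: rP => //=; rewrite /ball_ /= sub0r normrN.
Qed.

(** Differentiability is asked in the parameter only: the integrands to come are a smooth kernel
    times a local density, of which only continuity is established. *)
Definition param_smooth m n (U : set 'rV[R]_m.+1) (L : R)
    (H : 'rV[R]_m.+1 -> 'rV[R]_n -> R) :=
  (forall z, U z -> box_supp L (H z)) /\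
  forall (s : seq 'I_m.+1) z v, U z ->
    {for (z, v), continuous (fun p : 'rV[R]_m.+1 * 'rV[R]_n => iter_pd s (H^~ p.2) p.1)} /\
    forall i, derivable (iter_pd s (H^~ v)) z (delta_mx 0 i).

(** Partial derivatives pass under the integral one at a time, along coordinate lines, because the
    derived integrands keep the same support box. *)
Lemma smooth_on_integral m n (U : set 'rV[R]_m.+1) (L : R)
    (H : 'rV[R]_m.+1 -> 'rV[R]_n.+1 -> R) : 0 <= L -> open U -> param_smooth U L H ->
  smooth_on U (fun z => integral_rV (H z)).
Proof.
move=> L0 oU [Hs Hc].
pose K s z v := iter_pd s (H^~ v) z.
have Ks s z : U z -> box_supp L (K s z).
  move=> Uz v i vL; rewrite /K (@eq_iter_pd_on _ _ U s _ (fun=> 0)) //.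
    elim: s {Uz} z => [//|j s IH] z /=; rewrite /pd (_ : iter_pd _ _ = fun=> 0).
      exact: derive_cst.
    by apply/funext.
  by move=> y Uy; exact: (Hs y Uy v i).
have KC s z : U z -> compactly_continuous L (K s z).
  move=> Uz; split; last exact: Ks.
  move=> v; apply: (@continuous_comp _ _ _ (fun v => (z, v))
    (fun p : 'rV[R]_m.+1 * 'rV[R]_n.+1 => iter_pd s (H^~ p.2) p.1)).
    by apply: continuous_at_pair; [exact: cst_continuous|exact: cvg_id].
  exact: (Hc s z v Uz).1.
have dK s z i : U z -> is_derive z (delta_mx 0 i) (fun z => integral_rV (K s z))
    (integral_rV (K (i :: s) z)).
  move=> Uz.
  pose e : 'rV[R]_m.+1 := delta_mx 0 i.
  have : \forall y \near z, U y by apply: open_nbhs_nbhs.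
  move=> /nbhs_normP[d /= d0 dU].
  have dU' t : `|t - 0| < d -> U (z + t *: e).
    rewrite subr0 => td; apply: dU => /=.
    by rewrite opprD addrA subrr sub0r normrN normrZ norm_delta mulr1.
  have := @is_derive_integral_rV n L (fun t v => K s (z + t *: e) v)
    (fun t v => K (i :: s) (z + t *: e) v) 0 d L0 d0.
  move=> /(_ _ _ _ _)/wrap[].
  - move=> t v td.
    have := @is_derive_line R _ (iter_pd s (H^~ v)) z e t; apply.
    by apply: (Hc s _ v (dU' _ td)).2.
  - by move=> t td; apply: KC; exact: dU'.
  - by rewrite scale0r addr0; exact: KC.
  - move=> v; apply: (@continuous_comp _ _ _
       (fun p : R * 'rV[R]_n.+1 => (z + p.1 *: e, p.2))
       (fun p : 'rV[R]_m.+1 * 'rV[R]_n.+1 => iter_pd (i :: s) (H^~ p.2) p.1)).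
      apply: continuous_at_pair; last exact: cvg_snd.
      by apply: continuous_at_affine; [exact: cst_continuous|exact: cvg_fst].
    by rewrite /= scale0r addr0; exact: (Hc (i :: s) z v Uz).1.
  rewrite scale0r addr0 => -[dl Dl].
  have eqf : (fun h : R => integral_rV (K s (h *: e + z))) = (fun t => integral_rV (K s (z + t *: e))).
    by apply/funext => t; rewrite addrC.
  apply: DeriveDef; first by apply/derivable1P; rewrite eqf.
  by rewrite derive_line eqf derive1E.
have E s z : U z -> iter_pd s (fun z => integral_rV (H z)) z = integral_rV (K s z).
  elim: s z => [//|i s IH] z Uz /=.
  rewrite (@eq_pd_on _ _ U i _ (fun z => integral_rV (K s z))) //.
  by have [_ D] := dK s z i Uz; rewrite /pd D.
move=> k s z _ Uz; split.
  apply: (@eq_continuous_on _ _ U (fun z => integral_rV (K s z))) => //.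
    by move=> y Uy; rewrite E.
  apply: (@integral_rV_continuous R n.+1 _ U L (K s)) => //.
    by move=> y v Uy; exact: (Hc s y v Uy).1.
  by move=> y Uy; exact: Ks.
move=> _ i; apply: (@eq_derivable_on _ _ U (fun z => integral_rV (K s z))) => //.
  by move=> y Uy; rewrite E.
by have [] := dK s z i Uz.
Qed.

End DerivativeUnderIntegral.

(** * Charts, bump functions and the volume integral *)

Section Charts.
Context {R : realType} {M : spacetime R} (HM : is_spacetime M).
Implicit Types (k l : chart R M) (x y : M) (f g : M -> R).
Local Notation dom := Defs.dom.

Lemma img_par k z : atlas M k -> img k z -> dom k (par k z).
Proof. by move=> ak [x dx <-]; rewrite (chart_crdK (st_chart HM ak)). Qed.

Lemma img_crd k x : dom k x -> img k (crd k x).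
Proof. by exists x. Qed.

Lemma crdK k x : atlas M k -> dom k x -> par k (crd k x) = x.
Proof. by move=> ak; exact: (chart_crdK (st_chart HM ak)). Qed.

Lemma parK k z : atlas M k -> img k z -> crd k (par k z) = z.
Proof. by move=> ak [x dx <-]; rewrite crdK. Qed.

Lemma open_img k : atlas M k -> open (img k).
Proof. by move=> ak; exact: (chart_img (st_chart HM ak)). Qed.

Lemma open_dom k : atlas M k -> open (dom k).
Proof. by move=> ak; exact: (chart_dom (st_chart HM ak)). Qed.

Lemma cts_par k z : atlas M k -> img k z -> {for z, continuous (par k)}.
Proof. by move=> ak; exact: (chart_par (st_chart HM ak)). Qed.

Lemma cts_crd k x : atlas M k -> dom k x -> {for x, continuous (crd k)}.
Proof. by move=> ak; exact: (chart_crd (st_chart HM ak)). Qed.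

Lemma open_nbhs_at (T : topologicalType) (U : set T) (x : T) : open U -> U x -> nbhs x U.
Proof. by move=> oU Ux; apply: open_nbhs_nbhs. Qed.

Lemma open_setP (T : topologicalType) (U : set T) :
  (forall x : T, U x -> nbhs x U) -> open U.
Proof. by move=> H; rewrite openE => x /H. Qed.

Lemma open_par_preimage k (W : set M) : atlas M k -> open W ->
  open (img k `&` par k @^-1` W).
Proof.
move=> ak oW; apply: open_setP => z [iz Wz].
apply: filterI; first exact: (open_nbhs_at (open_img ak)).
by apply: (cts_par ak iz); exact: open_nbhs_at.
Qed.

Lemma crd_imageE k (W : set M) : atlas M k -> W `<=` dom k ->
  crd k @` W = img k `&` par k @^-1` W.
Proof.
move=> ak Wk; apply/seteqP; split=> [z [x Wx <-]|z [iz Wz]].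
  by split; [apply: img_crd; exact: Wk|rewrite /= crdK //; exact: Wk].
by exists (par k z) => //; rewrite parK.
Qed.

Lemma open_crd_image k (W : set M) : atlas M k -> open W -> W `<=` dom k ->
  open (crd k @` W).
Proof. by move=> ak oW Wk; rewrite crd_imageE //; exact: open_par_preimage. Qed.

Lemma compact_crd_image k (A : set M) : atlas M k -> compact A -> A `<=` dom k ->
  compact (crd k @` A).
Proof.
move=> ak cA Ak; apply: continuous_compact => //.
apply: continuous_in_subspaceT => x; rewrite inE => /Ak dx; exact: cts_crd.
Qed.

Lemma compact_par_image k (A : set 'rV[R]_4) : atlas M k -> compact A -> A `<=` img k ->
  compact (par k @` A).
Proof.
move=> ak cA Ak; apply: continuous_compact => //.
apply: continuous_in_subspaceT => x; rewrite inE => /Ak dx; exact: cts_par.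
Qed.

Lemma Ck_on_local n m (U : set 'rV[R]_n.+1) (h : 'rV[R]_n.+1 -> R) :
  (forall z, U z -> exists V, [/\ V z & Ck_on m V h]) -> Ck_on m U h.
Proof. by move=> H s z sm Uz; have [V [Vz]] := H z Uz; apply. Qed.

Lemma smooth_continuous f x : smooth f -> {for x, continuous f}.
Proof.
move=> sf; have [k ak dx] := st_cover HM x.
have cf := smooth_on_continuous (sf k ak) (img_crd dx).
have : {for x, continuous (rep k f \o crd k)}.
  by apply: continuous_comp; [exact: cts_crd|exact: cf].
have E : {near x, rep k f \o crd k =1 f}.
  by apply: (open_near (open_dom ak) dx) => y dy; rewrite /= /rep crdK.
rewrite /prop_for /continuous_at /= /rep crdK // => c.
exact: cvg_trans (near_eq_cvg E) c.
Qed.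

Lemma smooth_cst (a : R) : smooth (fun _ : M => a).
Proof. by move=> k ak m; exact: Ck_on_cst. Qed.

Lemma smooth_add f g : smooth f -> smooth g -> smooth (fun x => f x + g x).
Proof. by move=> sf sg k ak m; apply: Ck_on_add (sf k ak m) (sg k ak m); exact: open_img. Qed.

Lemma smooth_mul f g : smooth f -> smooth g -> smooth (fun x => f x * g x).
Proof. by move=> sf sg k ak m; apply: Ck_on_mul (sf k ak m) (sg k ak m); exact: open_img. Qed.

Lemma supp_sub f (A : set M) : closed A -> (forall x, ~ A x -> f x = 0) -> supp f `<=` A.
Proof.
move=> cA fA; rewrite ((closure_id A).1 cA); apply: closure_subset => x /= fx.
by apply: contrapT => /fA f0; rewrite f0 eqxx in fx.
Qed.

Lemma notin_supp f x : ~ supp f x -> f x = 0.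
Proof.
move=> H; apply/eqP; apply: contrapT => /negP fx; apply: H.
exact: subset_closure.
Qed.

Lemma test_supp f (A : set M) : smooth f -> compact A ->
  (forall x, ~ A x -> f x = 0) -> test f.
Proof.
move=> sf cA fA; split=> //.
have clA := compact_closed (st_hausdorff HM) cA.
apply: subclosed_compact cA _; first exact: closed_closure.
exact: supp_sub.
Qed.

Lemma test_lin a f g : test f -> test g -> test (fun x => a * f x + g x).
Proof.
move=> [sf cf] [sg cg]; apply: (@test_supp _ (supp f `|` supp g)).
- exact: (smooth_add (smooth_mul (smooth_cst a) sf) sg).
- exact: compactU.
move=> x /not_orP[fx gx].
by rewrite (notin_supp fx) (notin_supp gx) mulr0 addr0.
Qed.

Lemma test_mul f g : test f -> smooth g -> test (fun x => f x * g x).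
Proof.
move=> [sf cf] sg; apply: (test_supp (smooth_mul sf sg) cf).
by move=> x /notin_supp ->; rewrite mul0r.
Qed.

Lemma test0 : test (fun _ : M => 0 : R).
Proof. by apply: (@test_supp _ set0); [exact: smooth_cst|exact: compact0|]. Qed.

Lemma test_scale a f : test f -> test (fun x => a * f x).
Proof.
move=> tf; have := test_lin a tf test0.
by under eq_fun do rewrite addr0.
Qed.

Lemma supp_lin a f g (A : set M) : closed A -> supp f `<=` A -> supp g `<=` A ->
  supp (fun x => a * f x + g x) `<=` A.
Proof.
move=> cA fA gA; apply: supp_sub => // x Ax.
rewrite (@notin_supp f x) ?(@notin_supp g x) ?mulr0 ?addr0 //.
  by move=> /gA.
by move=> /fA.
Qed.

End Charts.

Section BumpsAndVolume.
Context {R : realType} {M : spacetime R} (HM : is_spacetime M).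
Implicit Types (k l : chart R M) (x y : M) (f g : M -> R).
Local Notation dom := Defs.dom.

Definition cbox n (z0 : 'rV[R]_n.+1) (r : R) :=
  [set z : 'rV[R]_n.+1 | forall i, `|z 0 i - z0 0 i| <= r].

Lemma compact_cbox n (z0 : 'rV[R]_n.+1) (r : R) :
  compact (cbox z0 r).
Proof.
have -> : cbox z0 r =
          [set v | forall i, `[z0 0 i - r, z0 0 i + r]%classic (v ord0 i)].
  apply/seteqP; split=> v /= vL i; have := vL i; rewrite in_itv /=.
    by rewrite ler_distl.
  by rewrite ler_distl.
by apply: (@rV_compact R n.+1 (fun i => `[z0 0 i - r, z0 0 i + r]%classic)) => i;
  exact: segment_compact.
Qed.

Lemma nbhs_cbox n (z0 : 'rV[R]_n.+1) (U : set 'rV[R]_n.+1) : nbhs z0 U ->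
  exists2 r, 0 < r & cbox z0 r `<=` U.
Proof.
move=> /nbhs_normP[r /= r0 rU]; exists (r / 2); first by rewrite divr_gt0.
move=> z /= zr; apply: rU => /=; apply: le_lt_trans (_ : r / 2 < r); last lra.
apply: mx_norm_le; first lra.
by move=> i j; rewrite ord1 !mxE distrC.
Qed.

(** [cutoff (r + t) * cutoff (r - t)] is positive exactly for |t| < r, so the product is a bump on
    an open cube of the chart. *)
Definition bump k (z0 : 'rV[R]_4) (r : R) x : R :=
  if `[< dom k x >] then
    \prod_i (cutoff (r + (crd k x 0 i - z0 0 i)) * cutoff (r - (crd k x 0 i - z0 0 i)))
  else 0.

Lemma bump_ge0 k z0 r x : 0 <= bump k z0 r x.
Proof.
rewrite /bump; case: ifP => // _.
by apply: prodr_ge0 => i _; rewrite mulr_ge0 // cutoff_ge0.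
Qed.

Lemma bump_center k z0 r : atlas M k -> img k z0 -> 0 < r -> 0 < bump k z0 r (par k z0).
Proof.
move=> ak iz r0; rewrite /bump asboolT ?parK //; last exact: img_par.
by apply: prodr_gt0 => i _; rewrite subrr subr0 addr0 mulr_gt0 // cutoff_gt0.
Qed.

Lemma bump_out k z0 r x : atlas M k ->
  ~ (par k @` cbox z0 r) x ->
  bump k z0 r x = 0.
Proof.
move=> ak nx; rewrite /bump; case: asboolP => // dx.
have [i Hi] : exists i, ~ `|crd k x 0 i - z0 0 i| <= r.
  apply/existsNP => H; apply: nx; exists (crd k x) => //; exact: crdK.
rewrite (bigD1 i) //=; move: Hi => /negP; rewrite -ltNge lter_normr => /orP[h|h].
  by rewrite [X in _ * X * _]cutoff_le0 ?mulr0 ?mul0r //; lra.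
by rewrite [X in X * _ * _]cutoff_le0 ?mulr0 ?mul0r //; lra.
Qed.

(** Smoothness has to be checked in every chart [l]. On the overlap with [dom k] it follows from the
    transition map; a point outside [dom k] has a neighbourhood missing the image of the closed
    cube, which is compact and hence closed, [M] being Hausdorff. *)
Lemma smooth_bump k z0 r : atlas M k ->
  cbox z0 r `<=` img k ->
  smooth (bump k z0 r).
Proof.
move=> ak boxk l al m; apply: Ck_on_local => z iz.
set A := par k @` cbox z0 r.
have [dz|dz] := pselect (dom k (par l z)).
  pose V := crd l @` (dom l `&` id @^-1` dom k).
  have oV : open V.
    apply: (open_crd_image HM al); last by move=> ? [].
    by apply: openI; [exact: open_dom|exact: open_dom].
  have VE w : V w -> img l w /\ dom k (par l w).
    by move=> [x [dx /= dkx] <-]; rewrite crdK //; split=> //; exact: img_crd.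
  exists V; split.
    exists (par l z); last exact: parK.
    by split=> //; exact: img_par.
  have sc i : Ck_on m V (fun w => crd k (par l w) 0 i).
    exact: ((st_transition HM).2 l k i al ak m).
  have dc j t : derivable (derive1n j (@cutoff R)) t 1 by exact: derivable_flat.
  apply: (@eq_Ck_on _ _ _ _ (fun w => \prod_i (cutoff (r + (crd k (par l w) 0 i - z0 0 i))
      * cutoff (r - (crd k (par l w) 0 i - z0 0 i))))) => //.
    by move=> w /VE[iw dw]; rewrite /rep /bump asboolT.
  apply: Ck_on_prod => // i; apply: Ck_on_mul => //; apply: Ck_on_comp1 => //.
    apply: Ck_on_add => //; first exact: Ck_on_cst.
    by apply: Ck_on_add => //; exact: Ck_on_cst.
  have -> : (fun z1 => r - (crd k (par l z1) 0 i - z0 0 i)) =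
            (fun z1 => (r + z0 0 i) + (-1) * crd k (par l z1) 0 i).
    by apply/funext => w; ring.
  apply: Ck_on_add => //; first exact: Ck_on_cst.
  by apply: Ck_on_mul => //; exact: Ck_on_cst.
have cA : closed A.
  apply: (compact_closed (st_hausdorff HM)); apply: compact_par_image => //.
  exact: compact_cbox.
have oV := open_par_preimage HM al (closed_openC cA).
exists (img l `&` par l @^-1` (~` A)); split.
  split=> // -[w wbox wE]; apply: dz; rewrite -wE.
  by apply: img_par => //; exact: boxk.
apply: (@eq_Ck_on _ _ _ _ (fun=> 0)) => //; last exact: Ck_on_cst.
by move=> w [_ Aw]; rewrite /rep bump_out.
Qed.

Lemma exists_bump k x (W : set M) : atlas M k -> dom k x -> nbhs x W ->
  exists b, [/\ test b, supp b `<=` dom k `&` W, forall y, 0 <= b y & 0 < b x].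
Proof.
move=> ak dx Wx.
have := nbhs_interior Wx.
set W' := W^°; move=> W'x.
have oW' : open W' by exact: open_interior.
have : nbhs (crd k x) (img k `&` par k @^-1` W').
  apply: open_nbhs_at; first exact: open_par_preimage.
  by split; [exact: img_crd|rewrite /= crdK //; exact: nbhs_singleton].
move=> /nbhs_cbox[r r0 rW].
exists (bump k (crd k x) r).
have cA : compact (par k @` cbox (crd k x) r).
  apply: compact_par_image => //; first exact: compact_cbox.
  by move=> z /rW[].
split.
- apply: (test_supp HM) cA _; last by move=> y; exact: bump_out.
  by apply: smooth_bump => // z /rW[].
- apply: subset_trans (_ : par k @` cbox (crd k x) r `<=` _).
    apply: supp_sub; first exact: (compact_closed (st_hausdorff HM)).
    by move=> y; exact: bump_out.
  move=> y [z /rW[iz Wz] <-]; split; first exact: img_par.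
  exact: interior_subset Wz.
- by move=> y; exact: bump_ge0.
- rewrite -{2}(crdK HM ak dx); apply: bump_center => //; exact: img_crd.
Qed.

End BumpsAndVolume.

Section VolumeIntegral.
Context {R : realType} {M : spacetime R} (HM : is_spacetime M).
Context (I : (M -> R) -> R) (HI : volume_integral I).
Implicit Types (k l : chart R M) (x y : M) (f g : M -> R).
Local Notation dom := Defs.dom.

Lemma vol_lin a f g : test f -> test g -> I (fun x => a * f x + g x) = a * I f + I g.
Proof. exact: vol_linear. Qed.

Lemma vol0 : I (fun=> 0) = 0.
Proof.
have := vol_lin 1 (test0 HM) (test0 HM).
under eq_fun do rewrite mulr0 addr0.
move: (I _) => a; lra.
Qed.

Lemma vol_scale a f : test f -> I (fun x => a * f x) = a * I f.
Proof.
move=> tf; have := vol_lin a tf (test0 HM); rewrite vol0 addr0 => <-.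
by congr I; apply/funext => x; rewrite addr0.
Qed.

Definition density k z : R := Num.sqrt `|\det (metric k (par k z))|.

(** The signature condition writes the metric as P eta P^T with P invertible, and its determinant is
    - (det P)^2. *)
Lemma density_gt0 k z : atlas M k -> img k z -> 0 < density k z.
Proof.
move=> ak iz; rewrite sqrtr_gt0 normr_gt0.
have [P uP ->] := st_signature HM ak (img_par HM ak iz).
rewrite !det_mulmx det_tr; move: uP; rewrite unitmxE unitfE => dP.
have d0 : \det (Defs.minkowski : 'M[R]_4) != 0.
  rewrite /Defs.minkowski det_diag; apply/prodf_neq0 => i _; rewrite mxE.
  by case: ifP => _; rewrite ?oppr_eq0 oner_eq0.
by rewrite !mulf_neq0.
Qed.

Lemma continuous_density k z : atlas M k -> img k z -> {for z, continuous (density k)}.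
Proof.
move=> ak iz.
have cd : {for z, continuous (fun z => \det (metric k (par k z)))}.
  rewrite /determinant; apply: continuous_at_sum => s _.
  apply: continuous_at_mul; first exact: continuous_at_cst.
  apply: continuous_at_prod => i _.
  exact: smooth_on_continuous (st_metric_smooth HM i (s i) ak) iz.
have cn : {for z, continuous (fun z => `|\det (metric k (par k z))|)}.
  by apply: continuous_comp cd _; exact: norm_continuous.
by apply: continuous_comp cn _; exact: sqrt_continuous.
Qed.

Definition local_density k f (z : 'rV[R]_4) : R :=
  if `[< img k z >] then f (par k z) * density k z else 0.

Lemma vol_local k f : atlas M k -> test f -> supp f `<=` dom k ->
  I f = integral_rV (local_density k f).
Proof. exact: vol_chart. Qed.

Lemma local_density_out k f z : atlas M k -> supp f `<=` dom k ->
  ~ (crd k @` supp f) z -> local_density k f z = 0.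
Proof.
move=> ak fk nz; rewrite /local_density; case: asboolP => // iz.
rewrite (@notin_supp _ _ f) ?mul0r // => sf; apply: nz.
by exists (par k z) => //; exact: parK.
Qed.

(** The extension by zero is continuous because the coordinate image of the support is compact, so
    that its complement is an open set on which the function vanishes. *)
Lemma continuous_local_density k f : atlas M k -> test f -> supp f `<=` dom k ->
  continuous (local_density k f).
Proof.
move=> ak tf fk z; have [sf cf] := tf.
have oi := open_img HM ak.
have [iz|niz] := pselect (img k z).
  apply: (@eq_continuous_on _ _ (img k) (fun z => rep k f z * density k z)) => //.
    by move=> w iw; rewrite /local_density asboolT.
  apply: continuous_at_mul; last exact: continuous_density.
  exact: smooth_on_continuous (sf k ak) iz.
have cA : closed (crd k @` supp f).
  apply: (compact_closed (@norm_hausdorff _ _)).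
  exact: (compact_crd_image HM).
apply: (@eq_continuous_on _ _ (~` (crd k @` supp f)) (fun=> 0)).
- exact: closed_openC.
- by move=> w nw; rewrite local_density_out.
- by move=> [x /fk dx xz]; apply: niz; rewrite -xz; exact: img_crd.
- exact: cst_continuous.
Qed.

Lemma local_density_cc k f : atlas M k -> test f -> supp f `<=` dom k ->
  exists2 L, 0 <= L & compactly_continuous L (local_density k f).
Proof.
move=> ak tf fk; have [_ cf] := tf.
have /compact_bounded[B [_ HB]] : compact (crd k @` supp f) by exact: (compact_crd_image HM).
exists (`|B| + 1); first by rewrite addr_ge0.
split; first exact: continuous_local_density.
move=> z i zi; apply: local_density_out => //.
move=> /(HB (`|B| + 1)) h.
have : `|z| <= `|B| + 1.
  by apply: h; apply: le_lt_trans (ler_norm B) _; rewrite ltrDl.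
by rewrite leNgt => /negP; apply; apply: lt_le_trans zi (le_mx_entry _ _ _).
Qed.

(** [volume_integral] postulates linearity and a coordinate formula; positivity is read off from the
    latter for functions supported in one chart, such as bump functions. *)
Lemma vol_ge0 k f : atlas M k -> test f -> supp f `<=` dom k ->
  (forall x, 0 <= f x) -> 0 <= I f.
Proof.
move=> ak tf fk f0; rewrite (vol_local ak) //; apply: integral_rV_ge0 => z.
by rewrite /local_density; case: ifP => // _; rewrite mulr_ge0 // sqrtr_ge0.
Qed.

Lemma vol_gt0 k f x : atlas M k -> test f -> supp f `<=` dom k ->
  (forall x, 0 <= f x) -> 0 < f x -> 0 < I f.
Proof.
move=> ak tf fk f0 fx; rewrite (vol_local ak) //.
have [L L0 Lc] := local_density_cc ak tf fk.
have dx : dom k x.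
  apply: fk; apply: contrapT => /notin_supp fx0.
  by rewrite fx0 ltxx in fx.
have ix := img_crd dx.
apply: (integral_rV_gt0 (v := crd k x) L0 Lc).
  move=> z; rewrite /local_density; case: ifP => // _.
  by rewrite mulr_ge0 // sqrtr_ge0.
rewrite /local_density asboolT // mulr_gt0 //; last exact: density_gt0.
by rewrite (crdK HM).
Qed.

Lemma vol_le k f g : atlas M k -> test f -> test g -> supp f `<=` dom k ->
  supp g `<=` dom k -> (forall x, f x <= g x) -> I f <= I g.
Proof.
move=> ak tf tg fk gk fg; rewrite -subr_ge0.
have -> : I g - I f = I (fun x => (-1) * f x + g x) by rewrite vol_lin //; ring.
have [sf cf] := tf; have [sg cg] := tg.
apply: (vol_ge0 ak (test_lin HM (-1) tf tg)).
  apply: subset_trans (_ : supp f `|` supp g `<=` _); last by move=> x [/fk|/gk].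
  have cU := @closedU _ _ _ (@closed_closure _ [set x | f x != 0]) (@closed_closure _ [set x | g x != 0]).
  by apply: supp_lin; [exact: cU|move=> x; left|move=> x; right].
by move=> x; have := fg x; lra.
Qed.

(** Divided by its mass, a bump replaces a Dirac measure: it averages values that all lie within [e]
    of [c]. *)
Lemma vol_average k b g c e : atlas M k -> test b -> supp b `<=` dom k ->
  (forall x, 0 <= b x) -> 0 < I b -> smooth g ->
  (forall x, supp b x -> `|g x - c| <= e) -> `|I (fun x => b x * g x) / I b - c| <= e.
Proof.
move=> ak tb bk b0 Ib sg gc.
have tbg := test_mul HM tb sg.
have bgk : supp (fun x => b x * g x) `<=` dom k.
  apply: subset_trans bk; apply: supp_sub; first exact: closed_closure.
  by move=> x /notin_supp ->; rewrite mul0r.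
have sk a : supp (fun x => a * b x) `<=` dom k.
  apply: subset_trans bk; apply: supp_sub; first exact: closed_closure.
  by move=> x /notin_supp ->; rewrite mulr0.
have bP x : (c - e) * b x <= b x * g x /\ b x * g x <= (c + e) * b x.
  have [/gc|/notin_supp ->] := pselect (supp b x); last by rewrite !mulr0 mul0r.
  rewrite ler_distl => /andP[h1 h2]; split.
    by rewrite mulrC ler_wpM2l.
  by rewrite [leRHS]mulrC ler_wpM2l.
have h1 : (c - e) * I b <= I (fun x => b x * g x).
  rewrite -(vol_scale _ tb).
  apply: (vol_le ak (test_scale HM (c - e) tb) tbg (sk _) bgk).
  by move=> x; have [] := bP x.
have h2 : I (fun x => b x * g x) <= (c + e) * I b.
  rewrite -(vol_scale _ tb).
  apply: (vol_le ak tbg (test_scale HM (c + e) tb) bgk (sk _)).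
  by move=> x; have [] := bP x.
by rewrite ler_distl ler_pdivlMr // ler_pdivrMr // h1 h2.
Qed.

End VolumeIntegral.

(** * Positivity of a kernel and point splitting *)

Lemma eq_continuous_open (R : realType) (T : topologicalType) (U : set T) (f g : T -> R) x :
  open U -> (forall y, U y -> f y = g y) ->
  U x -> {for x, continuous f} -> {for x, continuous g}.
Proof.
move=> oU fg Ux cf; rewrite /prop_for /continuous_at -(fg x Ux).
have fgx : {near x, f =1 g} := open_near oU Ux fg.
exact: cvg_trans (near_eq_cvg fgx) cf.
Qed.

(** * Functions on a product of two charts *)

Section Slices.
Context {R : realType}.
Implicit Types (G : 'rV[R]_8 -> R) (z w : 'rV[R]_4).

(** Concatenation with its type fixed to ['rV_8], the domain of [rep2], rather than
    ['rV_(4 + 4)]. *)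
Definition pair8 z w : 'rV[R]_8 := row_mx z w.

Definition lsh (i : 'I_4) : 'I_8 := @lshift 4 4 i.
Definition rsh (i : 'I_4) : 'I_8 := @rshift 4 4 i.

Lemma lsub_pair8 z w : @lsubmx R 1 4 4 (pair8 z w) = z.
Proof. exact: row_mxKl. Qed.

Lemma rsub_pair8 z w : @rsubmx R 1 4 4 (pair8 z w) = w.
Proof. exact: row_mxKr. Qed.

Lemma pair8_lsh z w i : pair8 z w 0 (lsh i) = z 0 i.
Proof. exact: (@row_mxEl R 1 4 4). Qed.

Lemma pair8_rsh z w i : pair8 z w 0 (rsh i) = w 0 i.
Proof. exact: (@row_mxEr R 1 4 4). Qed.

Lemma pair8P (x y : 'rV[R]_8) : (forall i, x 0 (lsh i) = y 0 (lsh i)) ->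
  (forall i, x 0 (rsh i) = y 0 (rsh i)) -> x = y.
Proof.
move=> xl xr; apply/rowP => j; case: (@splitP 4 4 j) => a ja.
  by have -> : j = lsh a by apply/val_inj.
by have -> : j = rsh a by apply/val_inj.
Qed.

Lemma pair8_addl z w (v : 'rV[R]_4) (h : R) :
  h *: pair8 v 0 + pair8 z w = pair8 (h *: v + z) w.
Proof.
apply: pair8P => i.
  by rewrite pair8_lsh mxE [X in X + _]mxE !pair8_lsh !mxE ?mulr0 ?add0r.
by rewrite pair8_rsh mxE [X in X + _]mxE !pair8_rsh !mxE ?mulr0 ?add0r.
Qed.

Lemma pair8_addr z w (v : 'rV[R]_4) (h : R) :
  h *: pair8 0 v + pair8 z w = pair8 z (h *: v + w).
Proof.
apply: pair8P => i.
  by rewrite pair8_lsh mxE [X in X + _]mxE !pair8_lsh !mxE ?mulr0 ?add0r.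
by rewrite pair8_rsh mxE [X in X + _]mxE !pair8_rsh !mxE ?mulr0 ?add0r.
Qed.

Lemma eq_lsh i j : (lsh i == lsh j) = (i == j).
Proof. exact: (inj_eq (@lshift_inj 4 4)). Qed.

Lemma eq_rsh i j : (rsh i == rsh j) = (i == j).
Proof. exact: (inj_eq (@rshift_inj 4 4)). Qed.

Lemma eq_lrsh i j : (lsh i == rsh j) = false.
Proof. exact: (@eq_lrshift 4 4). Qed.

Lemma delta_lsh i : delta_mx 0 (lsh i) = pair8 (delta_mx 0 i) 0.
Proof.
apply: pair8P => j; rewrite ?(pair8_lsh, pair8_rsh) !mxE.
  by rewrite eq_lsh.
by rewrite [rsh _ == _]eq_sym eq_lrsh andbF.
Qed.

Lemma delta_rsh i : delta_mx 0 (rsh i) = pair8 0 (delta_mx 0 i).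
Proof.
apply: pair8P => j; rewrite ?(pair8_lsh, pair8_rsh) !mxE.
  by rewrite eq_lrsh andbF.
by rewrite eq_rsh.
Qed.

Lemma line_pair8l G z w i :
  (fun h : R => G (h *: delta_mx 0 (lsh i) + pair8 z w)) =
  (fun h : R => G (pair8 (h *: delta_mx 0 i + z) w)).
Proof. by apply/funext => h; rewrite delta_lsh pair8_addl. Qed.

Lemma line_pair8r G z w i :
  (fun h : R => G (h *: delta_mx 0 (rsh i) + pair8 z w)) =
  (fun h : R => G (pair8 z (h *: delta_mx 0 i + w))).
Proof. by apply/funext => h; rewrite delta_rsh pair8_addr. Qed.

Lemma pd_lsh G z w i : pd (lsh i) G (pair8 z w) = pd i (fun z => G (pair8 z w)) z.
Proof.
by rewrite /pd (derive_line G) line_pair8l (derive_line (fun z => G (pair8 z w))).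
Qed.

Lemma pd_rsh G z w i : pd (rsh i) G (pair8 z w) = pd i (fun w => G (pair8 z w)) w.
Proof.
by rewrite /pd (derive_line G) line_pair8r (derive_line (fun w => G (pair8 z w))).
Qed.

Lemma derivable_lsh G z w i : derivable G (pair8 z w) (delta_mx 0 (lsh i)) <->
  derivable (fun z => G (pair8 z w)) z (delta_mx 0 i).
Proof.
by split=> /derivable1P; rewrite ?line_pair8l => d; apply/derivable1P; rewrite ?line_pair8l.
Qed.

Lemma derivable_rsh G z w i : derivable G (pair8 z w) (delta_mx 0 (rsh i)) <->
  derivable (fun w => G (pair8 z w)) w (delta_mx 0 i).
Proof.
by split=> /derivable1P; rewrite ?line_pair8r => d; apply/derivable1P; rewrite ?line_pair8r.
Qed.

Lemma iter_pd_rsh G s z w :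
  iter_pd s (fun w => G (pair8 z w)) w = iter_pd (map rsh s) G (pair8 z w).
Proof.
elim: s w => [//|i s IH] w /=; rewrite pd_rsh /pd; congr (derive _ w _).
by apply/funext => y; exact: IH.
Qed.

Lemma continuous_pair8 (T : topologicalType) (x : T) (f g : T -> 'rV[R]_4) :
  {for x, continuous f} -> {for x, continuous g} ->
  {for x, continuous (fun x => pair8 (f x) (g x))}.
Proof.
move=> cf cg; apply: continuous_at_mx => a j; rewrite ord1.
case: (@splitP 4 4 j) => b jb.
  have -> : j = lsh b by apply/val_inj.
  rewrite (_ : (fun _ => _) = fun y => f y 0 b); first exact: continuous_at_entry.
  by apply/funext => y; exact: pair8_lsh.
have -> : j = rsh b by apply/val_inj.
rewrite (_ : (fun _ => _) = fun y => g y 0 b); first exact: continuous_at_entry.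
by apply/funext => y; exact: pair8_rsh.
Qed.

Definition prod8 (U V : set 'rV[R]_4) : set 'rV[R]_8 :=
  [set z : 'rV[R]_8 | U (@lsubmx R 1 4 4 z) /\ V (@rsubmx R 1 4 4 z)].

Lemma prod8_pair U V z w : U z -> V w -> prod8 U V (pair8 z w).
Proof. by move=> Uz Vw; rewrite /prod8 /= lsub_pair8 rsub_pair8. Qed.

Lemma continuous_lsub (x : 'rV[R]_8) :
  {for x, continuous (fun x : 'rV[R]_8 => @lsubmx R 1 4 4 x)}.
Proof.
apply: continuous_at_mx => a j; rewrite (_ : (fun _ => _) = fun y : 'rV[R]_8 => y a (lsh j)).
  exact: coord_continuous.
by apply/funext => y; rewrite mxE.
Qed.

Lemma continuous_rsub (x : 'rV[R]_8) :
  {for x, continuous (fun x : 'rV[R]_8 => @rsubmx R 1 4 4 x)}.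
Proof.
apply: continuous_at_mx => a j; rewrite (_ : (fun _ => _) = fun y : 'rV[R]_8 => y a (rsh j)).
  exact: coord_continuous.
by apply/funext => y; rewrite mxE.
Qed.

Lemma open_prod8 U V : open U -> open V -> open (prod8 U V).
Proof.
move=> oU oV; apply: openI; apply: open_comp => // x _.
  exact: continuous_lsub.
exact: continuous_rsub.
Qed.

Lemma Ck_on_rslice m U V G z : Ck_on m (prod8 U V) G -> U z ->
  Ck_on m V (fun w => G (pair8 z w)).
Proof.
move=> CG Uz s w sm Vw.
have [||cG dG] := CG (map rsh s) (pair8 z w); first by rewrite size_map.
  exact: prod8_pair.
have E : iter_pd s (fun w => G (pair8 z w)) = fun w => iter_pd (map rsh s) G (pair8 z w).
  by apply/funext => y; exact: iter_pd_rsh.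
rewrite E; split.
  apply: (@continuous_comp _ _ _ (fun w => pair8 z w) (iter_pd (map rsh s) G)) => //.
  by apply: continuous_pair8; [exact: cst_continuous|exact: cvg_id].
by move=> sm' i; apply/derivable_rsh; apply: dG; rewrite size_map.
Qed.

End Slices.

Section KernelIntegral.
Context {R : realType} {M : spacetime R} (HM : is_spacetime M).
Context (I : (M -> R) -> R) (HI : volume_integral I).
Context (F : M -> M -> R) (HF : smooth2 F).
Implicit Types (k l : chart R M) (x y : M) (f g : M -> R).
Local Notation dom := Defs.dom.

Lemma rep2_pair8 k l z w : rep2 k l F (pair8 z w) = F (par k z) (par l w).
Proof. by rewrite /rep2 lsub_pair8 rsub_pair8. Qed.

Lemma smooth_kernel_slice x : smooth (F x).
Proof.
move=> k ak m; have [l al dx] := st_cover HM x.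
have := @Ck_on_rslice R m (img l) (img k) (rep2 l k F) (crd l x) (@HF l k m al ak) (img_crd dx).
congr Ck_on; apply/funext => w; rewrite rep2_pair8 /rep (crdK HM) //.
Qed.

(** [I] is known to be linear only on test functions, so the inner integral must be smooth before
    the outer one can be split. In coordinates a smooth kernel is integrated against a continuous
    compactly supported density, and the derivatives in [z] fall on the kernel alone. *)
Lemma smooth_kernel_integral k h : atlas M k -> test h -> supp h `<=` dom k ->
  smooth (fun x => I (fun y => F x y * h y)).
Proof.
move=> ak th hk l al.
pose c := local_density k h.
pose G := rep2 l k F.
have [L L0 [cc c0]] := local_density_cc HM ak th hk.
have oi := open_img HM al; have ok := open_img HM ak.
have CG m : Ck_on m (prod8 (img l) (img k)) G by exact: HF.
have E z : img l z -> rep l (fun x => I (fun y => F x y * h y)) z =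
    integral_rV (fun w => G (pair8 z w) * c w).
  move=> iz; rewrite /rep.
  have tFh : test (fun y => h y * F (par l z) y).
    exact: (test_mul HM th (smooth_kernel_slice _)).
  have -> : (fun y => F (par l z) y * h y) = (fun y => h y * F (par l z) y).
    by apply/funext => y; rewrite mulrC.
  have sFh : supp (fun y => h y * F (par l z) y) `<=` dom k.
    apply: subset_trans hk; apply: supp_sub; first exact: closed_closure.
    by move=> x /notin_supp ->; rewrite mul0r.
  rewrite (vol_local HI ak tFh sFh).
  congr integral_rV; apply/funext => w; rewrite /G rep2_pair8 /c /local_density.
  by case: ifP => // _; rewrite ?mulr0 // mulrCA mulrA.
move=> m; apply: (@eq_Ck_on _ _ _ _ (fun z => integral_rV (fun w => G (pair8 z w) * c w))) => //.
  by move=> z iz; rewrite E.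
apply: (@smooth_on_integral R 3 3 (img l) L (fun z w => G (pair8 z w) * c w)) => //.
split=> [z iz w i wL|s z w iz]; first by rewrite /c (c0 w i wL) mulr0.
have zero w' : c w' = 0 -> (fun z => G (pair8 z w') * c w') = fun=> 0.
  by move=> ->; apply/funext => y; rewrite mulr0.
have iter0 (s' : seq 'I_4) : iter_pd s' (fun=> 0 : R) = fun=> 0.
  elim: s' => [//|i s' IH]; rewrite /= IH; apply/funext => y; exact: derive_cst.
have Kc w' z' : img k w' -> img l z' -> iter_pd s (fun z => G (pair8 z w') * c w') z' =
    iter_pd (map lsh s) G (pair8 z' w') * c w'.
  move=> iw' iz'; elim: s z' iz' => [//|i s IH] z' iz' /=.
  rewrite (@eq_pd_on _ _ (img l) i _ (fun z => iter_pd (map lsh s) G (pair8 z w') * c w')) //.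
  have dG : derivable (fun z => iter_pd (map lsh s) G (pair8 z w')) z' (delta_mx 0 i).
    by apply/derivable_lsh; apply: (CG (size s).+1 _ _ _ (prod8_pair iz' iw')).2; rewrite size_map.
  by rewrite pd_lsh /pd mulrC; exact: (deriveMr (c w') dG).
have [iw|niw] := pselect (img k w).
  split.
    apply: (@eq_continuous_open _ _ (fst @^-1` img l `&` snd @^-1` img k)
       (fun p : 'rV[R]_4 * 'rV[R]_4 => iter_pd (map lsh s) G (pair8 p.1 p.2) * c p.2)) => //.
    - apply: openI; apply: open_comp => // p _; [exact: cvg_fst|exact: cvg_snd].
    - by move=> [z' w'] /= [iz' iw']; rewrite Kc.
    - apply: continuous_at_mul; last first.
        apply: (@continuous_comp _ _ _ snd c); [exact: cvg_snd|exact: cc].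
      apply: (@continuous_comp _ _ _ (fun p : 'rV[R]_4 * 'rV[R]_4 => pair8 p.1 p.2) (iter_pd (map lsh s) G)).
        by apply: continuous_pair8; [exact: cvg_fst|exact: cvg_snd].
      by apply: (CG (size s) _ _ _ (prod8_pair iz iw)).1; rewrite size_map.
  move=> i; apply: (@eq_derivable_on _ _ (img l) (fun z => iter_pd (map lsh s) G (pair8 z w) * c w)) => //.
    by move=> z' iz'; rewrite Kc.
  apply: derivableM; last exact: derivable_cst.
  by apply/derivable_lsh; apply: (CG (size s).+1 _ _ _ (prod8_pair iz iw)).2; rewrite size_map.
(* Nothing is known about [par k] outside [img k], but the density vanishes in a neighbourhood of
   such a point, because the image of [supp h] is closed. *)
have cw : c w = 0 by rewrite /c /local_density asboolF.
split; last by move=> i; rewrite zero // iter0; exact: derivable_cst.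
have cA : closed (crd k @` supp h).
  apply: (compact_closed (@norm_hausdorff _ _)).
  by apply: (compact_crd_image HM) => //; case: th.
apply: (@eq_continuous_open _ _ (snd @^-1` (~` (crd k @` supp h))) (fun=> 0)).
- apply: open_comp; last exact: closed_openC.
  by move=> p _; exact: cvg_snd.
- move=> [z' w'] /= nw; rewrite zero ?iter0 //.
  exact: (local_density_out HM).
- by move=> [x /hk dx xw]; apply: niw; rewrite -[w]xw; exact: img_crd.
- exact: cst_continuous.
Qed.

End KernelIntegral.

Section PointwisePositivity.
Context {R : realType} {M : spacetime R} (HM : is_spacetime M).
Context (I : (M -> R) -> R) (HI : volume_integral I).
Context (F : M -> M -> R) (HF : smooth2 F).
Context (Psi : M -> R) (HPsi : smooth Psi).
Implicit Types (k l : chart R M) (x y : M) (f g h : M -> R).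
Local Notation dom := Defs.dom.

Lemma continuous_kernel k x y : atlas M k -> dom k x -> dom k y ->
  {for (x, y), continuous (fun p : M * M => F p.1 p.2)}.
Proof.
move=> ak dx dy.
apply: (@eq_continuous_open _ _ (fst @^-1` dom k `&` snd @^-1` dom k)
  (fun p : M * M => rep2 k k F (pair8 (crd k p.1) (crd k p.2)))) => //.
- by apply: openI; apply: (open_comp _ (open_dom HM ak)) => p _;
    [exact: cvg_fst|exact: cvg_snd].
- by move=> [x' y'] /= [dx' dy']; rewrite rep2_pair8 !(crdK HM ak).
apply: (@continuous_comp _ _ _ (fun p : M * M => pair8 (crd k p.1) (crd k p.2)) (rep2 k k F)).
  apply: continuous_pair8.
    apply: (@continuous_comp _ _ _ fst (crd k)); first exact: cvg_fst.
    exact: (cts_crd HM ak dx).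
  apply: (@continuous_comp _ _ _ snd (crd k)); first exact: cvg_snd.
  exact: (cts_crd HM ak dy).
have C0 := @HF k k 0%N ak ak.
exact: ((Ck_on0 _ _).1 C0 _ (prod8_pair (img_crd dx) (img_crd dy))).
Qed.

Lemma near_kernel k x y e : atlas M k -> dom k x -> dom k y -> 0 < e ->
  exists A B, [/\ nbhs x A, nbhs y B & forall x' y', A x' -> B y' ->
    `|F x' y' - F x y| <= e].
Proof.
move=> ak dx dy e0.
have /cvgr_distC_le/(_ e e0) := continuous_kernel ak dx dy.
case=> -[A B] /= [Ax By] AB; exists A, B; split=> // x' y' Ax' By'.
exact: (AB (x', y')).
Qed.

(* Tested on the difference of two bump functions of unit mass, concentrated at x1
   and x2. *)
Lemma smeared_bound k (c : R) : atlas M k -> 0 <= c ->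
  (forall h, test h -> supp h `<=` dom k ->
    c * (I (fun x => h x * Psi x)) ^+ 2 <=
    I (fun x => h x * I (fun y => F x y * h y))) ->
  forall x1 x2, dom k x1 -> dom k x2 ->
  c * (Psi x1 - Psi x2) ^+ 2 <= F x1 x1 - F x1 x2 - F x2 x1 + F x2 x2.
Proof.
move=> ak c0 H x1 x2 d1 d2.
set D := _ + F x2 x2; set P := Psi x1 - Psi x2.
(* The error budget: the smeared values of [F] contribute 4 e, and (P + d)^2 >= P^2 - 4 e |P|
   whenever |d| <= 2 e. *)
suff S e : 0 < e -> c * P ^+ 2 <= D + e * (4 + 4 * c * `|P|).
  apply/ler_addgt0Pr => e e0.
  have K0 : 0 < 4 + 4 * c * `|P|.
    have : 0 <= 4 * c * `|P| by rewrite !mulr_ge0.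
    move: (4 * c * _) => q; lra.
  have := S (e / (4 + 4 * c * `|P|)) (divr_gt0 e0 K0).
  by rewrite divfK // gt_eqF.
move=> e0.
have [A11 [B11 [nA11 nB11 F11]]] := near_kernel ak d1 d1 e0.
have [A12 [B12 [nA12 nB12 F12]]] := near_kernel ak d1 d2 e0.
have [A21 [B21 [nA21 nB21 F21]]] := near_kernel ak d2 d1 e0.
have [A22 [B22 [nA22 nB22 F22]]] := near_kernel ak d2 d2 e0.
have P1 : \forall x \near x1, `|Psi x - Psi x1| <= e.
  by have /cvgr_distC_le/(_ e e0) := smooth_continuous HM (x := x1) HPsi.
have P2 : \forall x \near x2, `|Psi x - Psi x2| <= e.
  by have /cvgr_distC_le/(_ e e0) := smooth_continuous HM (x := x2) HPsi.
(* The [A] sets constrain the first argument of [F] and the [B] sets the second; [W1] collects those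
   around [x1], and [W2] those around [x2]. *)
pose W1 := (A11 `&` B11) `&` (A12 `&` B21) `&` [set x | `|Psi x - Psi x1| <= e].
pose W2 := (A22 `&` B22) `&` (A21 `&` B12) `&` [set x | `|Psi x - Psi x2| <= e].
have nW1 : nbhs x1 W1 by do !apply: filterI.
have nW2 : nbhs x2 W2 by do !apply: filterI.
have [b1 [t1 s1 p1 c1]] := exists_bump HM ak d1 nW1.
have [b2 [t2 s2 p2 c2]] := exists_bump HM ak d2 nW2.
have s1k : supp b1 `<=` dom k by move=> x /s1[].
have s2k : supp b2 `<=` dom k by move=> x /s2[].
have m1 := vol_gt0 HM HI ak t1 s1k p1 c1.
have m2 := vol_gt0 HM HI ak t2 s2k p2 c2.
pose h x := (I b1)^-1 * b1 x + (- (I b2)^-1 * b2 x).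
have t2' := test_scale HM (- (I b2)^-1) t2.
have th : test h by exact: (test_lin HM).
have smul a g : supp (fun x => a * g x) `<=` supp g.
  apply: supp_sub; first exact: closed_closure.
  by move=> x /notin_supp ->; rewrite mulr0.
have sh : supp h `<=` dom k.
  apply: subset_trans (_ : supp b1 `|` supp b2 `<=` _); last by move=> x [/s1k|/s2k].
  apply: supp_lin.
  - by apply: closedU; exact: closed_closure.
  - by move=> x; left.
  - by move=> x /smul; right.
have Ih g : smooth g -> I (fun x => h x * g x) =
    I (fun x => b1 x * g x) / I b1 - I (fun x => b2 x * g x) / I b2.
  move=> sg.
  have T1 := test_mul HM t1 sg; have T2 := test_mul HM t2 sg.
  have -> : (fun x => h x * g x) = (fun x => (I b1)^-1 * (b1 x * g x) +
      (- (I b2)^-1) * (b2 x * g x)).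
    by apply/funext => x; rewrite /h; ring.
  rewrite (vol_lin HI _ T1 (test_scale HM _ T2)) (vol_scale HM HI _ T2); ring.
have av1 g a : smooth g -> (forall x, W1 x -> `|g x - a| <= e) ->
    `|I (fun x => b1 x * g x) / I b1 - a| <= e.
  move=> sg ga; apply: (vol_average HM HI ak) => // x /s1[_ /ga]; exact.
have av2 g a : smooth g -> (forall x, W2 x -> `|g x - a| <= e) ->
    `|I (fun x => b2 x * g x) / I b2 - a| <= e.
  move=> sg ga; apply: (vol_average HM HI ak) => // x /s2[_ /ga]; exact.
pose g x := I (fun y => F x y * h y).
have sg : smooth g by exact: (smooth_kernel_integral HM HI HF ak th sh).
have gE x : g x = I (fun y => b1 y * F x y) / I b1 - I (fun y => b2 y * F x y) / I b2.
  rewrite /g -Ih; last exact: (smooth_kernel_slice HM).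
  by congr I; apply/funext => y; rewrite mulrC.
have sF x := smooth_kernel_slice HM HF x.
have g1 x : W1 x -> `|g x - (F x1 x1 - F x1 x2)| <= e + e.
  move=> [[[a11 _] [a12 _]] _].
  have h1 := av1 (F x) (F x1 x1) (sF x) (fun y w => F11 x y a11 w.1.1.2).
  have h2 := av2 (F x) (F x1 x2) (sF x) (fun y w => F12 x y a12 w.1.2.2).
  move: h1 h2; rewrite gE; set u1 := _ / I b1; set u2 := _ / I b2.
  by rewrite !ler_norml; lra.
have g2 x : W2 x -> `|g x - (F x2 x1 - F x2 x2)| <= e + e.
  move=> [[[a22 _] [a21 _]] _].
  have h1 := av1 (F x) (F x2 x1) (sF x) (fun y w => F21 x y a21 w.1.2.2).
  have h2 := av2 (F x) (F x2 x2) (sF x) (fun y w => F22 x y a22 w.1.1.2).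
  move: h1 h2; rewrite gE; set u1 := _ / I b1; set u2 := _ / I b2.
  by rewrite !ler_norml; lra.
have G1 : `|I (fun x => b1 x * g x) / I b1 - (F x1 x1 - F x1 x2)| <= e + e.
  by apply: (vol_average HM HI ak) => // x /s1[_ /g1]; exact.
have G2 : `|I (fun x => b2 x * g x) / I b2 - (F x2 x1 - F x2 x2)| <= e + e.
  by apply: (vol_average HM HI ak) => // x /s2[_ /g2]; exact.
have Q1 := av1 Psi (Psi x1) HPsi (fun y w => w.2).
have Q2 := av2 Psi (Psi x2) HPsi (fun y w => w.2).
have := H h th sh; rewrite -/g (Ih _ sg) (Ih _ HPsi).
move: G1 G2 Q1 Q2; rewrite -/g.
set u1 := I (fun x => b1 x * g x) / _; set u2 := I (fun x => b2 x * g x) / _.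
set v1 := I _ / I b1; set v2 := I _ / I b2.
move=> G1 G2 Q1 Q2 Hc.
have dP : `|v1 - v2 - P| <= e + e by move: Q1 Q2; rewrite /P !ler_norml; lra.
have dD : u1 - u2 <= D + 4 * e by move: G1 G2; rewrite /D !ler_norml; lra.
have sq : P ^+ 2 - 4 * e * `|P| <= (v1 - v2) ^+ 2.
  have -> : v1 - v2 = P + (v1 - v2 - P) by ring.
  set d := v1 - v2 - P in dP *.
  have h1 : - (`|P| * (e + e)) <= P * d.
    rewrite lerNl; apply: le_trans (ler_norm _) _; rewrite normrN normrM.
    by rewrite ler_wpM2l.
  have h2 : 0 <= d ^+ 2 by exact: sqr_ge0.
  have E : (P + d) ^+ 2 - (P ^+ 2 - 4 * e * `|P|) = 2 * (P * d + `|P| * (e + e)) + d ^+ 2.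
    ring.
  rewrite -subr_ge0 E addr_ge0 // mulr_ge0 //.
  by move: h1; rewrite -subr_ge0 opprK.
have := le_trans (ler_wpM2l c0 sq) Hc.
rewrite mulrBr lerBlDr => K.
have -> : e * (4 + 4 * c * `|P|) = 4 * e + c * (4 * e * `|P|) by ring.
rewrite addrA; apply: (le_trans K); rewrite lerD2r; exact: dD.
Qed.

End PointwisePositivity.

(** * Second differences and mixed derivatives *)

Section MixedDerivative.
Context {R : realType} {n : nat}.
Implicit Types (U : set 'rV[R]_n.+1) (G : 'rV[R]_n.+1 -> R) (w v : 'rV[R]_n.+1).

Lemma derive_sum_pd U G w v : open U -> Ck_on 1 U G -> U w ->
  derivable G w v /\ 'D_v G w = \sum_j v 0 j * pd j G w.
Proof.
move=> oU CG Uw; have [dG DG] := C1_differentiable oU CG Uw.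
split; first exact: diff_derivable.
by rewrite DG mxE; apply: eq_bigr => j _; rewrite mxE.
Qed.

Lemma is_derive_line_pd U G w v t : open U -> Ck_on 1 U G -> U (w + t *: v) ->
  is_derive t 1 (fun t => G (w + t *: v)) (\sum_j v 0 j * pd j G (w + t *: v)).
Proof.
move=> oU CG Uw; have [dG <-] := derive_sum_pd v oU CG Uw.
exact: is_derive_line.
Qed.

Lemma MVT_derivable (f df : R -> R) (t : R) : 0 < t ->
  (forall s : R, 0 <= s <= t -> is_derive s 1 f (df s)) ->
  exists2 s, 0 <= s <= t & f t - f 0 = df s * t.
Proof.
move=> t0 H.
have [||s] := @MVT R f df 0 t t0.
- by move=> s; rewrite in_itv /= => /andP[/ltW s0 /ltW st]; apply: H; rewrite s0 st.
- apply: continuous_in_subspaceT => s; rewrite inE /= in_itv /= => st.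
  by apply: differentiable_continuous; apply/derivable1_diffP; have [] := H s st.
- rewrite in_itv /= subr0 => /andP[/ltW s0 /ltW st] E.
  by exists s; rewrite ?s0.
Qed.

(** By contradiction. Two applications of the mean value theorem turn the second difference into t^2
    times a mixed derivative at a nearby point, and one turns p(t) - p(0) into t p'(s). Division by
    t^2 and continuity at [w] and at 0 contradict the strict reverse inequality. *)
Lemma mixed_derivative_ge U G w v1 v2 (p dp : R -> R) (c d : R) :
  open U -> Ck_on 2 U G -> U w -> 0 < d -> 0 <= c ->
  (forall t : R, `|t| < d -> is_derive t 1 p (dp t)) ->
  {for (0 : R), continuous dp} ->
  (forall t, 0 < t < d -> c * (p t - p 0) ^+ 2 <=
     G (w + t *: v1 + t *: v2) - G (w + t *: v1) - G (w + t *: v2) + G w) ->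
  c * dp 0 ^+ 2 <= \sum_i \sum_j v1 0 i * v2 0 j * pd i (pd j G) w.
Proof.
move=> oU CG Uw d0 c0 Hp cdp Hc.
pose DG y := \sum_j v2 0 j * pd j G y.
have C1pd j : Ck_on 1 U (pd j G) by have /Ck_onS[_] := CG; exact.
have C1DG : Ck_on 1 U DG.
  apply: (Ck_on_sum _ oU) => j; apply: (Ck_on_mul oU) (C1pd j); exact: Ck_on_cst.
have C1G : Ck_on 1 U G by apply: Ck_onW CG.
pose D2 y := \sum_i v1 0 i * pd i DG y.
have D2w : D2 w = \sum_i \sum_j v1 0 i * v2 0 j * pd i (pd j G) w.
  apply: eq_bigr => i _.
  have dj (j : 'I_n.+1) : derivable (fun y => v2 0 j * pd j G y) w (delta_mx 0 i).
    apply: derivableM; first exact: derivable_cst.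
    by have /Ck_onS[/(_ w Uw)[_]] := C1pd j; exact.
  have -> : pd i DG w = \sum_j v2 0 j * pd i (pd j G) w.
    rewrite /pd /DG.
    have -> : (fun y => \sum_j v2 0 j * pd j G y) = \sum_j (fun y => v2 0 j * pd j G y).
      by apply/funext => y; rewrite fct_sumE.
    rewrite derive_sum //; apply: eq_bigr => j _.
    have dpj : derivable (pd j G) w (delta_mx 0 i).
      by have /Ck_onS[/(_ w Uw)[_]] := C1pd j; exact.
    exact: (deriveMl (v2 0 j) dpj).
  by rewrite mulr_sumr; apply: eq_bigr => j _; rewrite mulrA.
have cD2 : {for w, continuous D2}.
  apply: continuous_at_sum => i _; apply: continuous_at_mul; first exact: continuous_at_cst.
  by have /Ck_onS[_ /(_ i)/Ck_on0] := C1DG; exact.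
have lineG y s : U (y + s *: v2) ->
    is_derive s 1 (fun s => G (y + s *: v2)) (DG (y + s *: v2)).
  exact: is_derive_line_pd.
have lineDG y s : U (y + s *: v1) ->
    is_derive s 1 (fun s => DG (y + s *: v1)) (D2 (y + s *: v1)).
  exact: is_derive_line_pd.
rewrite -D2w; clearbody D2 DG; clear D2w; rewrite leNgt; apply/negP => lt.
pose e := (c * dp 0 ^+ 2 - D2 w) / 2.
have e0 : 0 < e by rewrite divr_gt0 // subr_gt0.
have near1 : \forall y \near w, U y /\ D2 y < D2 w + e.
  apply: filterI; first exact: open_nbhs_at.
  have /cvgr_distC_lt/(_ e e0) := cD2; apply: filterS => y.
  by rewrite ltr_norml ltrBlDl => /andP[].
have /nbhs_normP[r /= r0 rU] := near1.
have cdp2 : {for 0, continuous (fun t => c * dp t ^+ 2)}.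
  apply: continuous_at_mul; first exact: continuous_at_cst.
  by have := continuous_at_mul cdp cdp.
have near2 : \forall t \near (0 : R), c * dp 0 ^+ 2 - e < c * dp t ^+ 2.
  have /cvgr_distC_lt/(_ e e0) := cdp2; apply: filterS => y.
  by rewrite ltr_norml ltrBrDl => /andP[].
have /nbhs_normP[r' /= r'0 rp] := near2.
(* The displacement a v1 + b v2 is at most t K for a, b in [0, t]; the 1 makes [K] positive even for
   zero vectors. *)
pose K := `|v1| + `|v2| + 1.
have K0 : 0 < K by rewrite /K; have := normr_ge0 v1; have := normr_ge0 v2; lra.
pose t := Num.min (Num.min (r / K) r') d / 2.
have m0 : 0 < Num.min (Num.min (r / K) r') d.
  by rewrite !lt_min divr_gt0 // r'0 d0.
have t0 : 0 < t by rewrite divr_gt0.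
have tm : t < Num.min (Num.min (r / K) r') d by rewrite /t; lra.
move: tm; rewrite !lt_min => /andP[/andP[tr tr'] td].
have qU a b : 0 <= a <= t -> 0 <= b <= t -> U (w + a *: v1 + b *: v2) /\
    D2 (w + a *: v1 + b *: v2) < D2 w + e.
  move=> /andP[a0 at'] /andP[b0 bt]; apply: rU => /=.
  rewrite -addrA opprD addNKr normrN.
  apply: le_lt_trans (ler_normD _ _) _; rewrite !normrZ !ger0_norm //.
  apply: le_lt_trans (_ : t * K < r); last by rewrite -ltr_pdivlMr.
  rewrite /K !mulrDr mulr1.
  have := ler_wpM2r (normr_ge0 v1) at'; have := ler_wpM2r (normr_ge0 v2) bt; lra.
have t00 : 0 <= (0 : R) <= t by rewrite lexx ltW.
have ttt : 0 <= t <= t by rewrite lexx ltW.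
(* The increment of this function of b over [0, t] is the second difference of [G]. *)
have [|b bt Eb] := @MVT_derivable
  (fun b => G (w + t *: v1 + b *: v2) - G (w + b *: v2))
  (fun b => DG (w + t *: v1 + b *: v2) - DG (w + b *: v2)) t t0.
  move=> s st; apply: is_deriveB.
    by apply: lineG; have [] := qU t s ttt st.
  apply: lineG; have [] := qU 0 s t00 st.
  by rewrite scale0r addr0.
have [|a ta Ea] := @MVT_derivable (fun a => DG (w + b *: v2 + a *: v1))
  (fun a => D2 (w + b *: v2 + a *: v1)) t t0.
  move=> s st; apply: lineDG; have [+ _] := qU s b st bt.
  by rewrite addrAC.
have [|s ts Es] := @MVT_derivable p dp t t0.
  move=> s /andP[s0 st]; apply: Hp; rewrite ger0_norm //; exact: le_lt_trans st td.
have := Hc t _; rewrite t0 td => /(_ isT).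
have -> : G (w + t *: v1 + t *: v2) - G (w + t *: v1) - G (w + t *: v2) + G w =
  D2 (w + b *: v2 + a *: v1) * t * t.
  move: Ea Eb; rewrite !scale0r !addr0 [w + b *: v2 + t *: v1]addrAC => <- <-.
  ring.
rewrite Es => hh.
have sm : c * dp 0 ^+ 2 - e < c * dp s ^+ 2.
  apply: rp => /=; rewrite sub0r normrN; case/andP: ts => s0 st.
  rewrite ger0_norm //; exact: le_lt_trans st tr'.
have [_ Dm] := qU a b ta bt.
have t2 : 0 < t * t by rewrite mulr_gt0.
have : c * dp s ^+ 2 <= D2 (w + b *: v2 + a *: v1).
  rewrite -(ler_pM2r t2); apply: le_trans (_ : c * (dp s * t) ^+ 2 <= _).
    have -> : c * (dp s * t) ^+ 2 = c * dp s ^+ 2 * (t * t) by ring.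
    exact: lexx.
  by rewrite [leRHS]mulrA.
rewrite [w + b *: v2 + _]addrAC => h2.
move: Dm sm h2; rewrite /e; lra.
Qed.

End MixedDerivative.

Section PointSplitting.
Context {R : realType} {M : spacetime R} (HM : is_spacetime M).
Context (I : (M -> R) -> R) (HI : volume_integral I).
Context (F : M -> M -> R) (HF : smooth2 F).
Context (Psi : M -> R) (HPsi : smooth Psi).
Implicit Types (k l : chart R M) (x y : M) (f g h : M -> R).
Local Notation dom := Defs.dom.

(** The bound on second differences is applied with x2 = x and x1 moving away from x along the
    coordinate line of direction [v]. In R^8 the two arguments move in the directions (v, 0) and (0,
    v), so only the derivatives mixing both arguments survive. *)
Lemma point_split_bound k (c : R) x (v : 'rV[R]_4) : atlas M k -> 0 <= c ->
  (forall h, test h -> supp h `<=` dom k ->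
    c * (I (fun x => h x * Psi x)) ^+ 2 <=
    I (fun x => h x * I (fun y => F x y * h y))) ->
  dom k x ->
  c * (\sum_j v 0 j * pd j (rep k Psi) (crd k x)) ^+ 2 <=
  \sum_i \sum_j v 0 i * v 0 j *
    pd (lsh i) (pd (rsh j) (rep2 k k F)) (pair8 (crd k x) (crd k x)).
Proof.
move=> ak c0 H dx.
have Hs := smeared_bound HM HI HF HPsi ak c0 H.
pose z := crd k x; have iz : img k z := img_crd dx.
have oi := open_img HM ak.
pose G := rep2 k k F.
have CG m : Ck_on m (prod8 (img k) (img k)) G by exact: HF.
have : \forall y \near z, img k y by exact: open_nbhs_at.
move=> /nbhs_normP[r /= r0 rU].
pose d := r / (`|v| + 1).
have v0 : 0 < `|v| + 1 by have := normr_ge0 v; lra.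
have d0 : 0 < d by rewrite divr_gt0.
have zU t : `|t| < d -> img k (z + t *: v).
  move=> td; apply: rU => /=; rewrite opprD addNKr normrN normrZ.
  apply: le_lt_trans (_ : `|t| * (`|v| + 1) < r); last by rewrite -ltr_pdivlMr.
  by rewrite ler_wpM2l // lerDl.
have C1P : Ck_on 1 (img k) (rep k Psi) by exact: HPsi.
have := @mixed_derivative_ge R 7 (prod8 (img k) (img k)) G (pair8 z z) (pair8 v 0) (pair8 0 v)
  (fun t => rep k Psi (z + t *: v)) (fun t => \sum_j v 0 j * pd j (rep k Psi) (z + t *: v))
  c d (open_prod8 oi oi) (CG 2) (prod8_pair iz iz) d0 c0.
move=> /(_ _ _ _)/wrap[].
- by move=> t td; apply: (is_derive_line_pd oi C1P); exact: zU.
- apply: continuous_at_sum => j _; apply: continuous_at_mul; first exact: continuous_at_cst.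
  apply: (@continuous_comp _ _ _ (fun t : R => z + t *: v) (pd j (rep k Psi))).
    by apply: continuous_at_affine; [exact: cst_continuous|exact: cvg_id].
  rewrite scale0r addr0; have /Ck_onS[_ /(_ j)/Ck_on0] := C1P; exact.
- move=> t /andP[t0 td].
  have zt : img k (z + t *: v) by apply: zU; rewrite gtr0_norm.
  have := Hs (par k (z + t *: v)) (par k z) (img_par HM ak zt) (img_par HM ak iz).
  have E1 : pair8 z z + t *: pair8 v 0 = pair8 (z + t *: v) z.
    by rewrite addrC pair8_addl addrC.
  have E2 : pair8 z z + t *: pair8 0 v = pair8 z (z + t *: v).
    by rewrite addrC pair8_addr addrC.
  have E3 : pair8 z z + t *: pair8 v 0 + t *: pair8 0 v = pair8 (z + t *: v) (z + t *: v).
    by rewrite E1 addrC pair8_addr addrC.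
  by rewrite E3 E1 E2 /G !rep2_pair8 /rep scale0r addr0.
rewrite scale0r addr0 => hh; apply: (le_trans hh); rewrite le_eqVlt; apply/orP; left.
have split8 (f : 'I_8 -> R) : \sum_i f i = \sum_(i < 4) f (lsh i) + \sum_(i < 4) f (rsh i).
  exact: (@big_split_ord _ _ _ 4 4 xpredT f).
rewrite split8 [X in _ + X]big1 ?addr0; last first.
  by move=> i _; apply: big1 => j _; rewrite pair8_rsh mxE !mul0r.
apply/eqP; apply: eq_bigr => i _; rewrite split8 [X in X + _]big1 ?add0r; last first.
  by move=> j _; rewrite !pair8_lsh mxE mulr0 mul0r.
by apply: eq_bigr => j _; rewrite pair8_lsh pair8_rsh.
Qed.

End PointSplitting.

(** * The prepared state *)

Section Pairings.

Let o0 : 'I_4 := @Ordinal 4 0 isT.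
Let o1 : 'I_4 := @Ordinal 4 1 isT.
Let o2 : 'I_4 := @Ordinal 4 2 isT.
Let o3 : 'I_4 := @Ordinal 4 3 isT.

Let ord4P (i : 'I_4) : [\/ i = o0, i = o1, i = o2 | i = o3].
Proof.
case: i => [[|[|[|[|//]]]] Hi]; [apply: Or41|apply: Or42|apply: Or43|apply: Or44];
  exact/val_inj.
Qed.

Let pairing (p : {perm 'I_4}) := [forall i, (p (p i) == i) && (p i != i)].

(** On four points such an involution is determined by the image of 0: the two remaining points must
    be exchanged. *)
Let pairing4 (p : {perm 'I_4}) : pairing p ->
  [\/ p = (tperm o0 o1 * tperm o2 o3)%g, p = (tperm o0 o2 * tperm o1 o3)%g |
      p = (tperm o0 o3 * tperm o1 o2)%g].
Proof.
move=> /forallP H.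
have E i : p (p i) = i by have /andP[/eqP] := H i.
have N i : p i <> i by have /andP[_ /eqP] := H i.
have inj := @perm_inj _ p.
case: (ord4P (p o0)) => p0; first by case: (N o0).
- have p1 : p o1 = o0 by rewrite -{1}p0 E.
  have p2 : p o2 = o3.
    case: (ord4P (p o2)) => // h; [|by rewrite -p0 in h; move: (inj _ _ h)|by case: (N o2)].
    by rewrite -p1 in h; move: (inj _ _ h).
  have p3 : p o3 = o2 by rewrite -{1}p2 E.
  by apply: Or31; apply/permP => i; rewrite permM !permE /=;
    case: (ord4P i) => ->; rewrite ?(p0, p1, p2, p3) /=.
- have p2 : p o2 = o0 by rewrite -{1}p0 E.
  have p1 : p o1 = o3.
    case: (ord4P (p o1)) => // h; [|by case: (N o1)|by rewrite -p0 in h; move: (inj _ _ h)].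
    by rewrite -p2 in h; move: (inj _ _ h).
  have p3 : p o3 = o1 by rewrite -{1}p1 E.
  by apply: Or32; apply/permP => i; rewrite permM !permE /=;
    case: (ord4P i) => ->; rewrite ?(p0, p1, p2, p3) /=.
- have p3 : p o3 = o0 by rewrite -{1}p0 E.
  have p1 : p o1 = o2.
    case: (ord4P (p o1)) => // h; [|by case: (N o1)|by rewrite -p0 in h; move: (inj _ _ h)].
    by rewrite -p3 in h; move: (inj _ _ h).
  have p2 : p o2 = o1 by rewrite -{1}p1 E.
  by apply: Or33; apply/permP => i; rewrite permM !permE /=;
    case: (ord4P i) => ->; rewrite ?(p0, p1, p2, p3) /=.
Qed.

(** The condition i < p i selects one orientation of each pair, so each of the three pairings
    contributes two factors. *)
Lemma sum_pairings4 (K : comNzRingType) (W : 'I_4 -> 'I_4 -> K) :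
  \sum_(p : {perm 'I_4} | [forall i, (p (p i) == i) && (p i != i)])
    \prod_(i < 4 | (i < p i)%N) W i (p i) =
  W o0 o1 * W o2 o3 + W o0 o2 * W o1 o3 + W o0 o3 * W o1 o2.
Proof.
set p1 := (tperm o0 o1 * tperm o2 o3)%g; set p2 := (tperm o0 o2 * tperm o1 o3)%g.
set p3 := (tperm o0 o3 * tperm o1 o2)%g.
have v1 : [/\ p1 o0 = o1, p1 o1 = o0, p1 o2 = o3 & p1 o3 = o2].
  by rewrite /p1; split; rewrite permM !permE /=.
have v2 : [/\ p2 o0 = o2, p2 o1 = o3, p2 o2 = o0 & p2 o3 = o1].
  by rewrite /p2; split; rewrite permM !permE /=.
have v3 : [/\ p3 o0 = o3, p3 o1 = o2, p3 o2 = o1 & p3 o3 = o0].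
  by rewrite /p3; split; rewrite permM !permE /=.
have P1 : pairing p1.
  by apply/forallP => i; case: v1 => a b c d; case: (ord4P i) => ->; rewrite ?(a, b, c, d) ?(a, b, c, d).
have P2 : pairing p2.
  by apply/forallP => i; case: v2 => a b c d; case: (ord4P i) => ->; rewrite ?(a, b, c, d) ?(a, b, c, d).
have P3 : pairing p3.
  by apply/forallP => i; case: v3 => a b c d; case: (ord4P i) => ->; rewrite ?(a, b, c, d) ?(a, b, c, d).
have n21 : p2 != p1 by apply/eqP => h; case: v1 v2 => e _ _ _ [e' _ _ _]; rewrite h e in e'.
have n31 : p3 != p1 by apply/eqP => h; case: v1 v3 => e _ _ _ [e' _ _ _]; rewrite h e in e'.
have n32 : p3 != p2 by apply/eqP => h; case: v2 v3 => e _ _ _ [e' _ _ _]; rewrite h e in e'.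
have P2' : pairing p2 && (p2 != p1) by rewrite P2.
have P3' : pairing p3 && (p3 != p1) && (p3 != p2) by rewrite P3 n31.
rewrite (bigD1 p1 P1) /= (bigD1 p2 P2') /= (bigD1 p3 P3') /=.
rewrite [X in _ + (_ + (_ + X))]big1 ?addr0; last first.
  move=> p /andP[/andP[/andP[/pairing4 Pp q1] q2] q3].
  by case: Pp => e; rewrite e eqxx in q1 q2 q3.
have E (p : {perm 'I_4}) : \prod_(i < 4 | (i < p i)%N) W i (p i) =
   (if (o0 < p o0)%N then W o0 (p o0) else 1) * (if (o1 < p o1)%N then W o1 (p o1) else 1) *
   (if (o2 < p o2)%N then W o2 (p o2) else 1) * (if (o3 < p o3)%N then W o3 (p o3) else 1).
  rewrite big_mkcond /= !big_ord_recl big_ord0 mulr1 !mulrA.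
  have -> : ord0 = o0 by exact/val_inj.
  have -> : lift o0 (ord0 : 'I_3) = o1 by exact/val_inj.
  have -> : lift o0 (lift ord0 (ord0 : 'I_2)) = o2 by exact/val_inj.
  by have -> : lift o0 (lift ord0 (lift ord0 (ord0 : 'I_1))) = o3 by exact/val_inj.
rewrite !E; case: v1 => -> -> -> ->; case: v2 => -> -> -> ->; case: v3 => -> -> -> -> /=.
by rewrite !mulr1 addrA.
Qed.

End Pairings.

Section PreparedState.
Context {R : realType} {M : spacetime R} (HM : is_spacetime M).
Context (I : (M -> R) -> R) (HI : volume_integral I).
Context (Eret Eadv : (M -> R) -> (M -> R)).
Context (Hret : fundamental_solution (@Jplus R M) Eret).
Context (Hadv : fundamental_solution (@Jminus R M) Eadv).
Context (A : algType R[i]) (star : A -> A) (phi : (M -> R[i]) -> A) (omega : A -> R[i]).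
Context (HA : field_algebra I (propagator Eret Eadv) star phi).
Context (Hw : state star omega) (Hq : quasi_free phi omega).
Local Notation Delta := (propagator Eret Eadv).
Implicit Types (f h : M -> R).

Lemma toC_fIm f : fIm (toC f) = fun=> 0. Proof. by []. Qed.

Lemma toC_fRe f : fRe (toC f) = f. Proof. by []. Qed.

Lemma supp_toC f : supp (toC f) = supp f.
Proof.
rewrite /supp; congr closure; apply/funext => x; apply/propext; rewrite /toC /=.
by rewrite eq_complex /= eqxx andbT.
Qed.

Lemma testC_toC f : test f -> testC (toC f).
Proof.
move=> [sf cf]; split; first exact: sf.
  by rewrite toC_fIm; exact: smooth_cst.
by rewrite supp_toC.
Qed.

Lemma volC_real f : volC I (toC f) = (I f)%:C.
Proof. by rewrite /volC toC_fIm (vol0 HM HI). Qed.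

Lemma fundamental0 (J : set M -> set M) (E : (M -> R) -> (M -> R)) :
  fundamental_solution J E -> forall x, E (fun=> 0) x = 0.
Proof.
move=> HE x; have := fs_linear HE 1 (test0 HM) (test0 HM) x.
rewrite (_ : (fun y => 1 * 0 + 0) = (fun=> 0 : R)); last by apply/funext => y; rewrite mulr0 addr0.
by move: (E _ x) => a; lra.
Qed.

Lemma propagator0 x : Delta (fun=> 0) x = 0.
Proof. by rewrite /propagator (fundamental0 Hret) (fundamental0 Hadv) subrr. Qed.

Lemma smooth_propagator f : test f -> smooth (Delta f).
Proof.
move=> tf; have s1 := fs_smooth Hret tf; have s2 := fs_smooth Hadv tf.
have -> : Delta f = (fun x => Eret f x + (-1) * Eadv f x).
  by apply/funext => x; rewrite /propagator mulN1r.
exact: (smooth_add HM s1 (smooth_mul HM (smooth_cst _) s2)).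
Qed.

Lemma star_phi f : test f -> star (phi (toC f)) = phi (toC f).
Proof.
move=> tf; rewrite (field_star (fa_relations HA) (testC_toC tf)).
by congr phi; apply/funext => x; rewrite /toC /conjc /= oppr0.
Qed.

Lemma omega_sa_ge0 a : star a = a -> 0 <= omega (a * a).
Proof. by move=> sa; rewrite -{1}sa; exact: (state_pos Hw). Qed.

Lemma omega_add a b : omega (a + b) = omega a + omega b.
Proof. by have := state_linear Hw 1 a b; rewrite scale1r mul1r. Qed.

Lemma omega0 : omega 0 = 0.
Proof. by have := omega_add 0 0; rewrite addr0 => /eqP; rewrite -subr_eq0 opprD addNKr oppr_eq0 => /eqP. Qed.

Lemma omega_scale z a : omega (z *: a) = z * omega a.
Proof. by have := state_linear Hw z a 0; rewrite !addr0 omega0 addr0. Qed.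

Lemma omega_opp a : omega (- a) = - omega a.
Proof. by rewrite -scaleN1r omega_scale mulN1r. Qed.

Lemma star_add a b : star (a + b) = star a + star b.
Proof.
have := star_antilinear (fa_star HA) 1 a b; rewrite !scale1r => ->.
by rewrite (_ : conjc 1 = 1) ?scale1r // /conjc /= oppr0.
Qed.

Lemma omega_commutator f h : test f -> test h ->
  omega (phi (toC h) * phi (toC f)) - omega (phi (toC f) * phi (toC h)) =
  'i * (I (fun x => h x * Delta f x))%:C.
Proof.
move=> tf th.
have := field_comm (fa_relations HA) (testC_toC th) (testC_toC tf).
set Y := phi (toC h); set X := phi (toC f) => E.
have -> : omega (Y * X) - omega (X * Y) = omega (Y * X - X * Y).
  by rewrite omega_add omega_opp.
rewrite E omega_scale (state_one Hw) mulr1; congr (_ * _).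
rewrite -volC_real; congr (volC I _); apply/funext => x.
rewrite /extC toC_fIm toC_fRe propagator0 /toC /=.
by apply/eqP; rewrite eq_complex /= !(mulr0, mul0r, subr0, addr0) !eqxx.
Qed.

(** With X and Y the self-adjoint smeared fields, omega is real on X^2, Y^2 and (X + Y)^2, so
    omega(XY) and omega(YX) have opposite imaginary parts; the commutator fixes their difference and
    equates the real parts. *)
Lemma two_point_decomposition f h : test f -> test h ->
  exists a, omega (phi (toC f) * phi (toC h)) = a +i* (- (I (fun x => h x * Delta f x) / 2)) /\
            omega (phi (toC h) * phi (toC f)) = a +i* (I (fun x => h x * Delta f x) / 2).
Proof.
move=> tf th; have := omega_commutator tf th; set c := I _.
set X := phi (toC f); set Y := phi (toC h) => Ec.
have sX := star_phi tf; have sY := star_phi th.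
have pX := omega_sa_ge0 sX; have pY := omega_sa_ge0 sY.
have sXY : star (X + Y) = X + Y by rewrite star_add sX sY.
have := omega_sa_ge0 sXY; rewrite mulrDl !mulrDr !omega_add => p.
move: pX pY p Ec; rewrite -/X -/Y.
case: (omega (X * X)) => x1 x2; case: (omega (Y * Y)) => y1 y2.
case: (omega (X * Y)) => u1 u2; case: (omega (Y * X)) => v1 v2.
rewrite !lecE /= => /andP[/eqP ex _] /andP[/eqP ey _] /andP[/eqP exy _].
move=> /eqP; rewrite eq_complex /= !(mulr0, mul0r, subr0, addr0, add0r, mul1r) => /andP[/eqP e1 /eqP e2].
exists u1; split; apply/eqP; rewrite eq_complex /=; apply/andP; split; apply/eqP => //; lra.
Qed.

Lemma two_point_gt0 f : test f -> two_point phi omega (toC f) (toC f) != 0 ->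
  exists2 w, 0 < w & two_point phi omega (toC f) (toC f) = w%:C.
Proof.
rewrite /two_point => tf n0; have := omega_sa_ge0 (star_phi tf).
move: n0; case: (omega _) => a b; rewrite lecE /= => n0 /andP[/eqP b0 a0].
exists a; last by rewrite b0.
rewrite lt_neqAle a0 andbT; apply: contraNneq n0 => <-.
by rewrite b0 eqxx.
Qed.

(** In the order f, h, h, f two of the three pairings match each f with an h and give the same
    product; the third is the disconnected term. *)
Lemma wick4 f h : test f -> test h ->
  omega (phi (toC f) * (phi (toC h) * phi (toC h)) * phi (toC f)) =
  two_point phi omega (toC f) (toC h) * two_point phi omega (toC h) (toC f) *+ 2 +
  two_point phi omega (toC f) (toC f) * two_point phi omega (toC h) (toC h).
Proof.
move=> tf th.
pose hs (i : 'I_4) : M -> R[i] := if (i == 0%N :> nat) || (i == 3%N :> nat) then toC f else toC h.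
have hsP i : testC (hs i) by rewrite /hs; case: ifP => _; exact: testC_toC.
have := Hq hsP.
rewrite (sum_pairings4 (fun i j => two_point phi omega (hs i) (hs j))).
rewrite !big_ord_recl big_ord0 mulr1 /hs /= !mulrA => ->.
by rewrite mulr2n.
Qed.

Lemma kernel_pair_real (F : M -> M -> R) h :
  kernel_pair I (fun x y => (F x y)%:C) (toC h) (toC h) =
  (I (fun x => h x * I (fun y => F x y * h y)))%:C.
Proof.
rewrite /kernel_pair -volC_real; congr (volC I _); apply/funext => x.
rewrite /toC rmorphM /=; congr (_ * _); rewrite -volC_real; congr (volC I _).
by apply/funext => y; rewrite /toC rmorphM.
Qed.

(** After division by w the disconnected term cancels against omega_2(h, h). What remains is 2
    |omega_2(f, h)|^2 / w, and the imaginary part of omega_2(f, h), which is c/2 up to sign, already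
    contributes c^2 / (2 w). *)
Lemma prepared_kernel_bound f (F : M -> M -> R) w : test f -> 0 < w ->
  two_point phi omega (toC f) (toC f) = w%:C ->
  (forall h h' : M -> R[i], testC h -> testC h' ->
    two_point phi (prepared phi omega f) h h' - two_point phi omega h h' =
    kernel_pair I (fun x y => (F x y)%:C) h h') ->
  forall h, test h -> (2 * w)^-1 * (I (fun x => h x * Delta f x)) ^+ 2 <=
    I (fun x => h x * I (fun y => F x y * h y)).
Proof.
move=> tf w0 Ew HF h th.
have := HF _ _ (testC_toC th) (testC_toC th); rewrite kernel_pair_real.
rewrite {1}/two_point /prepared (wick4 tf th).
have -> : omega (phi (toC f) * phi (toC f)) = w%:C by [].
rewrite Ew; have [a [E1 E2]] := two_point_decomposition tf th.
rewrite /two_point E1 E2; set c := I (fun x => h x * Delta f x); set q := I _.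
have wC : w%:C != 0 by rewrite eq_complex /= eqxx andbT gt_eqF.
rewrite mulrDl mulrAC mulfV // mul1r addrK.
have -> : (a +i* - (c / 2)) * (a +i* (c / 2)) = (a ^+ 2 + c ^+ 2 / 4)%:C.
  by apply/eqP; rewrite eq_complex /=; apply/andP; split; apply/eqP; field.
move=> E.
have -> : q = (a ^+ 2 + c ^+ 2 / 4) *+ 2 / w.
  have := congr1 (fun z => complex.Re z) E.
  by rewrite -rmorphMn -fmorphV -rmorphM /= => ->.
have -> : (a ^+ 2 + c ^+ 2 / 4) *+ 2 / w = (2 * w)^-1 * c ^+ 2 + 2 * a ^+ 2 / w.
  by field; rewrite gt_eqF.
by rewrite lerDl divr_ge0 ?(ltW w0) // mulr_ge0 // sqr_ge0.
Qed.

End PreparedState.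

(** * Causal curves *)

Section Lorentz.
Context {R : realType}.
Implicit Types (a b t : 'rV[R]_4).

Let i1 : 'I_4 := lift ord0 ord0.
Let i2 : 'I_4 := lift ord0 (lift ord0 ord0).
Let i3 : 'I_4 := lift ord0 (lift ord0 (lift ord0 ord0)).

Definition mink a b : R := (a *m Defs.minkowski *m b^T) 0 0.

Let sp a b := a 0 i1 * b 0 i1 + a 0 i2 * b 0 i2 + a 0 i3 * b 0 i3.

Let minkE a b : mink a b = sp a b - a 0 ord0 * b 0 ord0.
Proof.
rewrite /mink mxE /Defs.minkowski mul_mx_diag !big_ord_recl big_ord0 !mxE /= /sp.
by rewrite -/i1 -/i2 -/i3; ring.
Qed.

Let cauchy_schwarz a b : sp a b ^+ 2 <= sp a a * sp b b.
Proof.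
rewrite -subr_ge0.
have -> : sp a a * sp b b - sp a b ^+ 2 = (a 0 i1 * b 0 i2 - a 0 i2 * b 0 i1) ^+ 2 +
   (a 0 i1 * b 0 i3 - a 0 i3 * b 0 i1) ^+ 2 + (a 0 i2 * b 0 i3 - a 0 i3 * b 0 i2) ^+ 2.
  by rewrite /sp; ring.
by rewrite !addr_ge0 // sqr_ge0.
Qed.

Let sp_ge0 a : 0 <= sp a a.
Proof. by rewrite /sp -!expr2 !addr_ge0 // sqr_ge0. Qed.

Let causal_sp a b : mink a a <= 0 -> mink b b <= 0 ->
  sp a b ^+ 2 <= (a 0 ord0 * b 0 ord0) ^+ 2.
Proof.
rewrite !minkE !subr_le0 => ha hb; apply: le_trans (cauchy_schwarz a b) _.
by rewrite exprMn !expr2; apply: ler_pM.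
Qed.

Let causal_sign t a : mink t t < 0 -> mink a a <= 0 -> mink a t < 0 ->
  0 < a 0 ord0 * t 0 ord0.
Proof.
move=> ht ha; have := causal_sp ha (ltW ht); rewrite minkE subr_lt0.
set x := sp a t; set y := _ * _ => h1 h2; rewrite ltNge; apply/negP => y0.
have : y ^+ 2 < x ^+ 2.
  rewrite -(sqrrN x) -(sqrrN y) ltr_sqr ?nnegrE; lra.
by rewrite ltNge h1.
Qed.

(** The timelike vector [t] fixes the sign of both time components, so their product is positive,
    and it dominates the spatial product by the Cauchy-Schwarz inequality. *)
Lemma mink_causal_le0 t a b : mink t t < 0 -> mink a a <= 0 -> mink a t < 0 ->
  mink b b <= 0 -> mink b t < 0 -> mink a b <= 0.
Proof.
move=> ht ha hat hb hbt.
have sa := causal_sign ht ha hat; have sb := causal_sign ht hb hbt.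
have t0 : 0 < t 0 ord0 ^+ 2.
  rewrite exprn_even_gt0 //=; apply: contraTneq sa => ->; by rewrite mulr0 ltxx.
have ab : 0 < a 0 ord0 * b 0 ord0.
  have : 0 < (a 0 ord0 * b 0 ord0) * t 0 ord0 ^+ 2.
    have -> : (a 0 ord0 * b 0 ord0) * t 0 ord0 ^+ 2 =
       (a 0 ord0 * t 0 ord0) * (b 0 ord0 * t 0 ord0) by ring.
    exact: mulr_gt0.
  by rewrite pmulr_lgt0.
rewrite minkE subr_le0; have h := causal_sp ha hb.
rewrite leNgt; apply/negP => lt.
have : (a 0 ord0 * b 0 ord0) ^+ 2 < sp a b ^+ 2.
  by rewrite ltr_sqr ?nnegrE // ltW // (lt_trans ab).
by rewrite ltNge h.
Qed.

(** Orthogonality and the Cauchy-Schwarz inequality force the time component of [a] to vanish; the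
    causality of [a] then kills its spatial part. *)
Lemma mink_orthogonal t a : mink t t < 0 -> mink a a <= 0 -> mink a t = 0 -> a = 0.
Proof.
rewrite !minkE subr_lt0 subr_le0 => ht ha /eqP; rewrite subr_eq0 => /eqP hat.
have cs := cauchy_schwarz a t; rewrite hat exprMn in cs.
have a0 : a 0 ord0 = 0.
  apply/eqP; apply: contraT => an0.
  have p : 0 < a 0 ord0 ^+ 2 by rewrite exprn_even_gt0.
  have : a 0 ord0 ^+ 2 * t 0 ord0 ^+ 2 <= a 0 ord0 ^+ 2 * sp t t.
    apply: le_trans cs _; apply: ler_wpM2r; first exact: sp_ge0.
    by rewrite expr2.
  by rewrite ler_pM2l // leNgt expr2 ht.
rewrite a0 mul0r /sp -!expr2 in ha.
have sq0 (x : R) : x ^+ 2 <= 0 -> x = 0.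
  by move=> h; apply/eqP; rewrite -sqrf_eq0 eq_le h sqr_ge0.
have q1 := sqr_ge0 (a 0 i1); have q2 := sqr_ge0 (a 0 i2); have q3 := sqr_ge0 (a 0 i3).
apply/rowP => j; rewrite [RHS]mxE; case: (unliftP ord0 j) => [j' ->|-> //].
case: (unliftP ord0 j') => [j'' ->|->]; last by apply: sq0; rewrite -/i1; lra.
case: (unliftP ord0 j'') => [j3 ->|->]; last by apply: sq0; rewrite -/i2; lra.
by rewrite ord1; apply: sq0; rewrite -/i3; lra.
Qed.

End Lorentz.

Section CausalVectors.
Context {R : realType} {M : spacetime R} (HM : is_spacetime M).
Implicit Types (k l : chart R M) (x y : M) (v w : 'rV[R]_4) (c : R -> M).
Local Notation dom := Defs.dom.
Local Notation jac := Defs.jacobian.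
Local Notation coord := Defs.coord.

Lemma ip_mink k x : atlas M k -> dom k x -> exists2 P, P \in unitmx &
  forall v w, ip k x v w = mink (v *m P) (w *m P).
Proof.
move=> ak dx; have [P uP E] := st_signature HM ak dx; exists P => // v w.
by rewrite /ip E /mink trmx_mul !mulmxA.
Qed.

Lemma ipE k x v w : ip k x v w = \sum_j (\sum_i v 0 i * metric k x i j) * w 0 j.
Proof. by rewrite /ip mxE; apply: eq_bigr => j _; rewrite !mxE. Qed.

Lemma ip_addl k x u v w : ip k x (u + v) w = ip k x u w + ip k x v w.
Proof. by rewrite /ip !mulmxDl mxE. Qed.

Lemma ip_addr k x u v w : ip k x w (u + v) = ip k x w u + ip k x w v.
Proof. by rewrite /ip linearD mulmxDr mxE. Qed.

Lemma ip_scalel k x (a : R) v w : ip k x (a *: v) w = a * ip k x v w.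
Proof. by rewrite /ip -!scalemxAl mxE. Qed.

Lemma ip_scaler k x (a : R) v w : ip k x v (a *: w) = a * ip k x v w.
Proof. by rewrite /ip linearZ -scalemxAr mxE. Qed.

Lemma ip_sym k x v w : atlas M k -> dom k x -> ip k x v w = ip k x w v.
Proof.
move=> ak dx; have [P _ E] := st_signature HM ak dx.
have sg : (metric k x)^T = metric k x.
  by rewrite E !trmx_mul trmxK /Defs.minkowski tr_diag_mx mulmxA.
rewrite /ip -[RHS]trace_mx11 -mxtrace_tr !trmx_mul trmxK sg -mulmxA.
by rewrite [RHS]trace_mx11.
Qed.

Lemma future_causal_le0 k x v w : atlas M k -> dom k x ->
  future_causal k x v -> future_causal k x w -> ip k x v w <= 0.
Proof.
move=> ak dx [v1 v2] [w1 w2]; have [P uP E] := ip_mink ak dx.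
have := st_tdir_timelike HM ak dx; move: v1 v2 w1 w2; rewrite !E => *.
exact: (@mink_causal_le0 _ (tdir k x *m P)).
Qed.

Lemma causal_orthogonal k x v : atlas M k -> dom k x ->
  ip k x v v <= 0 -> ip k x v (tdir k x) = 0 -> v = 0.
Proof.
move=> ak dx; have [P uP E] := ip_mink ak dx.
have := st_tdir_timelike HM ak dx; rewrite !E => t1 v1 v2.
have := mink_orthogonal t1 v1 v2 => h.
by rewrite -(mulmxK uP v) h mul0mx.
Qed.

Lemma future_causal_scale k x (a : R) v : 0 < a -> future_causal k x v ->
  future_causal k x (a *: v).
Proof.
move=> a0 [v1 v2]; split.
  by rewrite ip_scalel ip_scaler pmulr_rle0 // pmulr_rle0.
by rewrite ip_scalel pmulr_rlt0.
Qed.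

Lemma continuous_metric k i j z : atlas M k -> img k z ->
  {for z, continuous (fun z => metric k (par k z) i j)}.
Proof. by move=> ak iz; exact: smooth_on_continuous (st_metric_smooth HM i j ak) iz. Qed.

Lemma continuous_tdir k i z : atlas M k -> img k z ->
  {for z, continuous (fun z => tdir k (par k z) 0 i)}.
Proof. by move=> ak iz; exact: smooth_on_continuous (st_tdir_smooth HM i ak) iz. Qed.

Lemma continuous_ip (T : topologicalType) (t : T) k (z v w : T -> 'rV[R]_4) :
  atlas M k -> img k (z t) -> {for t, continuous z} -> {for t, continuous v} ->
  {for t, continuous w} ->
  {for t, continuous (fun s => ip k (par k (z s)) (v s) (w s))}.
Proof.
move=> ak iz cz cv cw.
have -> : (fun s => ip k (par k (z s)) (v s) (w s)) = fun s =>
   \sum_j (\sum_i v s 0 i * metric k (par k (z s)) i j) * w s 0 j.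
  by apply/funext => s; rewrite ipE.
apply: continuous_at_sum => j _; apply: continuous_at_mul; last exact: continuous_at_entry.
apply: continuous_at_sum => i _; apply: continuous_at_mul; first exact: continuous_at_entry.
apply: (@continuous_comp _ _ _ z (fun z => metric k (par k z) i j)) => //.
exact: continuous_metric.
Qed.

Lemma continuous_tdir_comp (T : topologicalType) (t : T) k (z : T -> 'rV[R]_4) :
  atlas M k -> img k (z t) -> {for t, continuous z} ->
  {for t, continuous (fun s => tdir k (par k (z s)))}.
Proof.
move=> ak iz cz; apply: continuous_at_mx => a i; rewrite ord1.
apply: (@continuous_comp _ _ _ z (fun z => tdir k (par k z) 0 i)) => //.
exact: continuous_tdir.
Qed.

Lemma ip_change k l x v w : atlas M k -> atlas M l -> dom k x -> dom l x ->
  ip k x v w = ip l x (v *m jac k l id x) (w *m jac k l id x).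
Proof.
by move=> ak al dk dl; rewrite /ip (st_metric_change HM ak al dk dl) trmx_mul !mulmxA.
Qed.

Lemma future_causal_change k l x v : atlas M k -> atlas M l -> dom k x -> dom l x ->
  future_causal k x v -> future_causal l x (v *m jac k l id x).
Proof.
move=> ak al dk dl [v1 v2]; split.
  by rewrite -ip_change.
by rewrite (st_tdir_change HM ak al dk dl) -ip_change.
Qed.

Lemma smooth_transition k l i : atlas M k -> atlas M l ->
  open (crd k @` (dom k `&` dom l)) /\
  smooth_on (crd k @` (dom k `&` dom l)) (fun z => crd l (par k z) 0 i).
Proof.
move=> ak al; split; last exact: ((st_transition HM).2 k l i ak al).
apply: (open_crd_image HM ak); last by move=> ? [].
by apply: openI; [exact: (open_dom HM ak)|exact: (open_dom HM al)].
Qed.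

Lemma coord_change_derive k l c (t : R) : atlas M k -> atlas M l ->
  {for t, continuous c} -> dom k (c t) -> dom l (c t) ->
  (forall i, derivable (coord k c i) t 1) ->
  forall i, is_derive t 1 (coord l c i) ((velocity k c t *m jac k l id (c t)) 0 i).
Proof.
move=> ak al cc dk dl dc i.
have [oV sV] := smooth_transition i ak al.
have := @is_derive_curve R 3 _ (fun z => crd l (par k z) 0 i) (fun t => crd k (c t)) t oV
  (sV 1%N) (_ : _) dc.
move=> /(_ _)/wrap[]; first by exists (c t).
have E : \forall s \near t, (fun s => crd l (par k (crd k (c s))) 0 i) s = coord l c i s.
  have : \forall s \near t, dom k (c s).
    by apply: cc; apply: open_nbhs_at => //; exact: (open_dom HM ak).
  by apply: filterS => s ds; rewrite /coord (crdK HM ak).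
move=> /(near_eq_is_derive E) => h; apply: (is_derive_eq h).
rewrite mxE; apply: eq_bigr => j _; rewrite !mxE; congr (_ * _).
Qed.

Lemma velocity_change k l c (t : R) : atlas M k -> atlas M l ->
  {for t, continuous c} -> dom k (c t) -> dom l (c t) ->
  (forall i, derivable (coord k c i) t 1) ->
  velocity l c t = velocity k c t *m jac k l id (c t).
Proof.
move=> ak al cc dk dl dc; apply/rowP => i; rewrite [LHS]mxE derive1E.
by have [_ ->] := coord_change_derive ak al cc dk dl dc i.
Qed.

Lemma continuous_jacobian k l i j x : atlas M k -> atlas M l -> dom k x -> dom l x ->
  {for x, continuous (fun x => jac k l id x i j)}.
Proof.
move=> ak al dk dl; have [oV sV] := smooth_transition j ak al.
have := smooth_on_continuous (z := crd k x) (smooth_on_pd i sV).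
move=> /(_ _)/wrap[]; first by exists x.
move=> cp.
have -> : (fun x => jac k l id x i j) = (fun x => pd i (fun z => crd l (par k z) 0 j) (crd k x)).
  by apply/funext => y; rewrite mxE.
apply: (@continuous_comp _ _ _ (crd k) (pd i (fun z => crd l (par k z) 0 j))) => //.
exact: (cts_crd HM ak dk).
Qed.

End CausalVectors.

Section CausalCurves.
Context {R : realType} {M : spacetime R} (HM : is_spacetime M).
Implicit Types (k l : chart R M) (x y q : M) (z v w : 'rV[R]_4) (c : R -> M).
Local Notation dom := Defs.dom.
Local Notation jac := Defs.jacobian.
Local Notation coord := Defs.coord.

Lemma causal_le_refl x : causal_le x x.
Proof. exact: Relation_Operators.rt_refl. Qed.

Lemma causal_le_trans x y q : causal_le x y -> causal_le y q -> causal_le x q.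
Proof. exact: Relation_Operators.rt_trans. Qed.

Lemma causal_segment_le x y : causal_segment x y -> causal_le x y.
Proof. exact: Relation_Operators.rt_step. Qed.

Lemma continuous_line z v (t : R) : {for t, continuous (fun t : R => z + t *: v)}.
Proof. by apply: continuous_at_affine; [exact: cst_continuous|exact: cvg_id]. Qed.

Lemma line_velocity k z v (t : R) : atlas M k -> img k (z + t *: v) ->
  (forall i, is_derive t 1 (coord k (fun t => par k (z + t *: v)) i) (v 0 i)).
Proof.
move=> ak it i.
have E : \forall s \near t, (fun s => z 0 i + s * v 0 i) s =
    coord k (fun t => par k (z + t *: v)) i s.
  have : \forall s \near t, img k (z + s *: v).
    apply: (continuous_line (z := z) (v := v)).
    by apply: open_nbhs_at => //; exact: (open_img HM ak).
  by apply: filterS => s is'; rewrite /coord (parK HM ak is') !mxE.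
apply: near_eq_is_derive E _.
have h2 := @is_deriveM R R id (cst (v 0 i)) t 1 1 0 (is_derive_id t (1 : R)) (is_derive_cst _ _ _).
have h := is_deriveD (is_derive_cst (z 0 i) t (1 : R)) h2.
by apply: (is_derive_eq h); rewrite add0r scaler0 add0r [_ *: _]mulr1.
Qed.

(** A causal segment is tested in every chart. In the chart [k] the velocity is constant, and in
    another chart it is [v] times the Jacobian, which is continuous along the line. The margin [e]
    supplies the open interval around [0, 1] that the definition asks for. *)
Lemma line_segment k z v (e : R) : atlas M k -> 0 < e ->
  (forall t, - e < t < 1 + e -> img k (z + t *: v) /\
     future_causal k (par k (z + t *: v)) v) ->
  causal_segment (par k z) (par k (z + v)).
Proof.
move=> ak e0 H; pose c (t : R) := par k (z + t *: v).
exists c, 0, 1, (- e), (1 + e); split.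
  by split; rewrite ?ltr01 /c ?scale0r ?addr0 ?scale1r //; lra.
have cc t : img k (z + t *: v) -> {for t, continuous c}.
  move=> it; apply: (@continuous_comp _ _ _ (fun t : R => z + t *: v) (par k)).
    exact: continuous_line.
  exact: (cts_par HM ak it).
move=> t te; have [it ft] := H t te; split; first exact: cc.
have vel s : img k (z + s *: v) -> velocity k c s = v.
  move=> is'; apply/rowP => i; rewrite mxE derive1E.
  by have [_ ->] := line_velocity ak is' i.
move=> l al dl.
have D s : img k (z + s *: v) -> dom l (c s) ->
    forall i, is_derive s 1 (coord l c i) ((v *m jac k l id (c s)) 0 i).
  move=> is' ds i; have dk : dom k (c s) by exact: (img_par HM ak is').
  have := coord_change_derive HM ak al (cc s is') dk ds _ i.
  rewrite vel //; apply=> j; by have [] := line_velocity ak is' j.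
have dk : dom k (c t) by exact: (img_par HM ak it).
split=> [i|]; last first.
  rewrite (velocity_change HM ak al (cc t it) dk dl) ?vel //.
    exact: (future_causal_change HM).
  by move=> j; have [] := line_velocity ak it j.
split; first by have [] := D t it dl i.
have near_t : \forall s \near t, img k (z + s *: v) /\ dom l (c s).
  apply: filterI.
    apply: (continuous_line (z := z) (v := v)).
    by apply: open_nbhs_at => //; exact: (open_img HM ak).
  by apply: (cc t it); apply: open_nbhs_at => //; exact: (open_dom HM al).
have E : {near t, (fun s => (v *m jac k l id (c s)) 0 i) =1 derive1 (coord l c i)}.
  apply: filterS near_t => s [is' ds]; rewrite derive1E.
  by have [_ ->] := D s is' ds i.
have cj : {for t, continuous (fun s => (v *m jac k l id (c s)) 0 i)}.
  have -> : (fun s => (v *m jac k l id (c s)) 0 i) = (fun s => \sum_j v 0 j * jac k l id (c s) j i).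
    by apply/funext => s; rewrite mxE.
  apply: continuous_at_sum => j _; apply: continuous_at_mul; first exact: continuous_at_cst.
  apply: (@continuous_comp _ _ _ c (fun x => jac k l id x j i)); first exact: cc.
  exact: (continuous_jacobian HM).
have Et := nbhs_singleton E.
rewrite /prop_for /continuous_at -Et.
exact: cvg_trans (near_eq_cvg E) cj.
Qed.

(* Timelike vectors at a point stay causal under small changes of the vector
   and of the point in a chart, so short timelike lines are causal curves. *)
Lemma cone_open k z0 v0 : atlas M k -> img k z0 ->
  ip k (par k z0) v0 v0 < 0 -> ip k (par k z0) v0 (tdir k (par k z0)) < 0 ->
  exists2 r, 0 < r & forall z v, `|z - z0| < r -> `|v - v0| < r ->
    img k z /\ future_causal k (par k z) v.
Proof.
move=> ak iz n1 n2.
pose f1 (p : 'rV[R]_4 * 'rV[R]_4) := ip k (par k p.1) p.2 p.2.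
pose f2 (p : 'rV[R]_4 * 'rV[R]_4) := ip k (par k p.1) p.2 (tdir k (par k p.1)).
have c1 : {for (z0, v0), continuous f1}.
  apply: (@continuous_ip _ _ HM _ (z0, v0) k fst snd snd ak iz); [exact: cvg_fst|exact: cvg_snd|exact: cvg_snd].
have c2 : {for (z0, v0), continuous f2}.
  apply: (@continuous_ip _ _ HM _ (z0, v0) k fst snd
    (fun p => tdir k (par k p.1)) ak iz); [exact: cvg_fst|exact: cvg_snd|].
  apply: (@continuous_tdir_comp _ _ HM _ (z0, v0) k fst ak iz); exact: cvg_fst.
have N1 : \forall p \near (z0, v0), f1 p < 0 by exact: (cvgr_lt _ c1).
have N2 : \forall p \near (z0, v0), f2 p < 0 by exact: (cvgr_lt _ c2).
have N3 : \forall p \near (z0, v0), img k p.1.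
  by apply: (@cvg_fst _ _ (nbhs z0) (nbhs v0)); apply: open_nbhs_at => //; exact: (open_img HM ak).
have := filterI N1 (filterI N2 N3).
move=> [[A B] /= [Az Bv] AB].
have /nbhs_normP[r1 /= r10 rA] := Az; have /nbhs_normP[r2 /= r20 rB] := Bv.
exists (Num.min r1 r2); first by rewrite lt_min r10.
move=> z v; rewrite !lt_min => /andP[zr _] /andP[_ vr].
have /= [|h1 [h2 h3]] := AB (z, v).
  by split; [apply: rA|apply: rB]; rewrite /= distrC.
by split=> //; split; [exact: ltW|].
Qed.

(** Dividing by h lets a short chord be compared with a fixed vector, being future causal is
    invariant under positive scaling. *)
Lemma segment_near k z0 v0 : atlas M k -> img k z0 ->
  ip k (par k z0) v0 v0 < 0 -> ip k (par k z0) v0 (tdir k (par k z0)) < 0 ->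
  exists2 r, 0 < r & forall za zb h, 0 < h -> `|za - z0| < r -> `|zb - z0| < r ->
    `|h^-1 *: (zb - za) - v0| < r -> causal_segment (par k za) (par k zb).
Proof.
move=> ak iz n1 n2; have [r r0 H] := cone_open ak iz n1 n2.
(* The line is followed for t in ]-1/2, 3/2[; with endpoints within r/8 of [z0] it stays within r/8
   + 2 (r/4) < r. *)
exists (r / 8); first by rewrite divr_gt0.
move=> za zb h h0 za_r zb_r v_r.
rewrite -[zb](subrKC za); apply: (@line_segment k za (zb - za) (1/2) ak); first lra.
move=> t ht.
have dz : `|za + t *: (zb - za) - z0| < r.
  have -> : za + t *: (zb - za) - z0 = (za - z0) + t *: ((zb - z0) - (za - z0)).
    by rewrite opprB addrA subrK addrAC.
  apply: le_lt_trans (ler_normD _ _) _; rewrite normrZ.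
  have h1 : `|zb - z0 - (za - z0)| < r / 4.
    by apply: le_lt_trans (ler_normB _ _) _; lra.
  have h2 : `|t| < 2 by rewrite ltr_norml; lra.
  have : `|t| * `|zb - z0 - (za - z0)| <= 2 * (r / 4).
    by apply: ler_pM => //; exact: ltW.
  lra.
have r8 : r / 8 < r by lra.
have [iz' fc] := H (za + t *: (zb - za)) (h^-1 *: (zb - za)) dz (lt_trans v_r r8).
split=> //.
by have := future_causal_scale h0 fc; rewrite (scalerKV (lt0r_neq0 h0)).
Qed.

Context (J : set R) (gamma : R -> M) (HJ : worldline J gamma).

Lemma open_J u : J u -> nbhs u J.
Proof. by move=> Ju; apply: open_nbhs_at => //; exact: (wl_interval HJ).1. Qed.

Lemma gamma_timelike k u : J u -> atlas M k -> dom k (gamma u) ->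
  ip k (gamma u) (velocity k gamma u) (velocity k gamma u) < 0 /\
  ip k (gamma u) (velocity k gamma u) (tdir k (gamma u)) < 0.
Proof.
move=> Ju ak dk; rewrite (wl_proper_time HJ Ju ak dk) ltrN10; split=> //.
by have [] := wl_future HJ Ju ak dk.
Qed.

Lemma gamma_quotient k u e : J u -> atlas M k -> dom k (gamma u) -> 0 < e ->
  \forall h \near (0 : R)^',
    `|h^-1 *: (crd k (gamma (h + u)) - crd k (gamma u)) - velocity k gamma u| < e.
Proof.
move=> Ju ak dk e0.
pose g (t : R) := crd k (gamma t).
have dg : derivable g u 1.
  by apply/derivable_mxP => i j; rewrite ord1; exact: (@wl_smooth _ _ _ _ HJ _ k j 0 Ju ak dk).
have vE : velocity k gamma u = 'D_1 g u.
  by rewrite derive_mx //; apply/rowP => i; rewrite !mxE derive1E.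
have : h^-1 *: ((g \o shift u) (h *: 1) - g u) @[h --> 0^'] --> 'D_1 g u := dg.
move=> /cvgr_distC_lt/(_ e e0); apply: filterS => h.
by rewrite vE /= [h *: 1]mulr1.
Qed.

Lemma continuous_crd_gamma k u : J u -> atlas M k -> dom k (gamma u) ->
  {for u, continuous (fun t => crd k (gamma t))}.
Proof.
move=> Ju ak dk; apply: (@continuous_comp _ _ _ gamma (crd k)).
  exact: (wl_continuous HJ).
exact: (cts_crd HM ak dk).
Qed.

Lemma gamma_near k u (r e : R) : J u -> atlas M k -> dom k (gamma u) -> 0 < r -> 0 < e ->
  exists h, [/\ 0 < h, h < e & forall h', h' = h \/ h' = - h ->
    [/\ J (h' + u), dom k (gamma (h' + u)),
        `|crd k (gamma (h' + u)) - crd k (gamma u)| < r &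
        `|h'^-1 *: (crd k (gamma (h' + u)) - crd k (gamma u)) - velocity k gamma u| < r]].
Proof.
move=> Ju ak dk r0 e0.
have A : \forall t \near u, [/\ J t, dom k (gamma t) & `|crd k (gamma t) - crd k (gamma u)| < r].
  have n3 : \forall t \near u, J t by exact: open_J.
  have n4 : \forall t \near u, dom k (gamma t).
    by apply: (wl_continuous HJ Ju); apply: open_nbhs_at => //; exact: (open_dom HM ak).
  have n5 : \forall t \near u, `|crd k (gamma t) - crd k (gamma u)| < r.
    have /cvgr_distC_lt/(_ r r0) := continuous_crd_gamma Ju ak dk; exact.
  by apply: filterS3 n3 n4 n5.
have /nbhs_normP[d1 /= d10 dA] := A.
have [d2 /= d20 dQ] := gamma_quotient Ju ak dk r0.
pose m := Num.min (Num.min d1 d2) e.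
have m0 : 0 < m by rewrite !lt_min d10 d20.
have h0 : 0 < m / 2 by rewrite divr_gt0.
have : m / 2 < m by lra.
rewrite {2}/m !lt_min => /andP[/andP[hd1 hd2] he].
exists (m / 2); split=> // h' hh'.
have nh' : `|h'| = m / 2 by case: hh' => ->; rewrite ?normrN gtr0_norm.
have /= := dA (h' + u); rewrite opprD addrCA subrr addr0 normrN nh' => /(_ hd1)[Jh dh gh].
split=> //; apply: dQ; first by rewrite /= sub0r normrN nh'.
by rewrite -normr_gt0 nh'.
Qed.

(** The openness of the chronological past, in the form used later. The chord from q to
    [gamma (h + u)], divided by h, is close to the velocity of [gamma] when q is much closer to
    [gamma u] than h. *)
Lemma future_nbhd u (e : R) : J u -> 0 < e ->
  exists u', [/\ J u', u < u', u' < u + e & \forall q \near gamma u, causal_le q (gamma u')].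
Proof.
move=> Ju e0; have [k ak dk] := st_cover HM (gamma u).
have iz := img_crd dk; have [n1 n2] := gamma_timelike Ju ak dk.
rewrite -(crdK HM ak dk) in n1 n2.
have [r r0 H] := segment_near ak iz n1 n2.
have r20 : 0 < r / 2 by rewrite divr_gt0.
have [h [h0 he /(_ h (or_introl erefl))[Jh dh gh Qh]]] := gamma_near Ju ak dk r20 e0.
exists (h + u); split=> //; [lra|lra|].
(* Moving q by less than h r/2 changes the chord divided by h by less than r/2; the other r/2 is
   spent on the difference quotient of [gamma]. *)
pose e' := Num.min r (h * (r / 2)).
have e'0 : 0 < e' by rewrite lt_min r0 mulr_gt0.
have nq : \forall q \near gamma u, dom k q by apply: open_nbhs_at => //; exact: (open_dom HM ak).
have nq2 : \forall q \near gamma u, `|crd k q - crd k (gamma u)| < e'.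
  have /cvgr_distC_lt/(_ e' e'0) := cts_crd HM ak dk; exact.
apply: filterS2 nq nq2 => q dq; rewrite lt_min => /andP[q1 q2].
apply: causal_segment_le; rewrite -(crdK HM ak dq) -(crdK HM ak dh).
apply: (H _ _ h) => //; first lra.
have -> : h^-1 *: (crd k (gamma (h + u)) - crd k q) - velocity k gamma u =
  (h^-1 *: (crd k (gamma (h + u)) - crd k (gamma u)) - velocity k gamma u)
  - h^-1 *: (crd k q - crd k (gamma u)).
  by rewrite addrAC -scalerBr opprB addrA subrK.
apply: le_lt_trans (ler_normB _ _) _; rewrite [X in _ + X]normrZ gtr0_norm ?invr_gt0 //.
have : h^-1 * `|crd k q - crd k (gamma u)| < r / 2 by rewrite ltr_pdivrMl.
lra.
Qed.

(** The time reverse of the preceding argument: the chord now starts at a slightly earlier point of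
    [gamma]. *)
Lemma past_nbhd u (e : R) : J u -> 0 < e ->
  exists u', [/\ J u', u - e < u', u' < u & \forall q \near gamma u, causal_le (gamma u') q].
Proof.
move=> Ju e0; have [k ak dk] := st_cover HM (gamma u).
have iz := img_crd dk; have [n1 n2] := gamma_timelike Ju ak dk.
rewrite -(crdK HM ak dk) in n1 n2.
have [r r0 H] := segment_near ak iz n1 n2.
have r20 : 0 < r / 2 by rewrite divr_gt0.
have [h [h0 he /(_ (- h) (or_intror erefl))[Jh dh gh Qh]]] := gamma_near Ju ak dk r20 e0.
exists (- h + u); split=> //; [lra|lra|].
pose e' := Num.min r (h * (r / 2)).
have e'0 : 0 < e' by rewrite lt_min r0 mulr_gt0.
have nq : \forall q \near gamma u, dom k q by apply: open_nbhs_at => //; exact: (open_dom HM ak).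
have nq2 : \forall q \near gamma u, `|crd k q - crd k (gamma u)| < e'.
  have /cvgr_distC_lt/(_ e' e'0) := cts_crd HM ak dk; exact.
apply: filterS2 nq nq2 => q dq; rewrite lt_min => /andP[q1 q2].
apply: causal_segment_le; rewrite -(crdK HM ak dq) -(crdK HM ak dh).
apply: (H _ _ h) => //; first lra.
have -> : h^-1 *: (crd k q - crd k (gamma (- h + u))) - velocity k gamma u =
  ((- h)^-1 *: (crd k (gamma (- h + u)) - crd k (gamma u)) - velocity k gamma u)
  + h^-1 *: (crd k q - crd k (gamma u)).
  rewrite addrAC invrN scaleNr -scalerN opprB -scalerDr; congr (_ *: _ - _).
  by rewrite [RHS]addrC addrA subrK.
apply: le_lt_trans (ler_normD _ _) _; rewrite [X in _ + X]normrZ gtr0_norm ?invr_gt0 //.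
have : h^-1 * `|crd k q - crd k (gamma u)| < r / 2 by rewrite ltr_pdivrMl.
lra.
Qed.

(** The openness of [J] provides the margins beyond u and u' that a causal segment requires. *)
Lemma gamma_le u u' : J u -> J u' -> u <= u' -> causal_le (gamma u) (gamma u').
Proof.
move=> Ju Ju'; rewrite le_eqVlt => /predU1P[->|uu']; first exact: causal_le_refl.
apply: causal_segment_le.
have /nbhs_normP[d1 /= d10 dJ] := open_J Ju; have /nbhs_normP[d2 /= d20 dJ'] := open_J Ju'.
exists gamma, u, u', (u - d1), (u' + d2); split; first by split=> //; lra.
move=> t /andP[t1 t2].
have Jt : J t.
  have [tu|ut] := ltP t u.
    by apply: dJ => /=; rewrite gtr0_norm; lra.
  have [tu'|u't] := ltP u' t.
    by apply: dJ' => /=; rewrite ltr0_norm; lra.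
  by apply: ((wl_interval HJ).2 _ _ Ju Ju'); rewrite ut.
split; first exact: (wl_continuous HJ).
move=> k ak dk; split; last exact: (wl_future HJ).
move=> i; split; first exact: (@wl_smooth _ _ _ _ HJ _ k i 0 Jt ak dk).
apply: differentiable_continuous; apply/derivable1_diffP.
exact: (@wl_smooth _ _ _ _ HJ _ k i 1 Jt ak dk).
Qed.

(** Antisymmetry of the causal order would make [gamma] constant between u and u', against the
    proper-time normalization of its velocity. *)
Lemma gamma_not_ge u u' : globally_hyperbolic M -> J u -> J u' -> u < u' ->
  ~ causal_le (gamma u') (gamma u).
Proof.
move=> GH Ju Ju' uu' H.
have cst t : u <= t <= u' -> gamma t = gamma u.
  move=> /andP[t1 t2].
  have Jt : J t by apply: ((wl_interval HJ).2 _ _ Ju Ju'); rewrite t1.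
  apply: (gh_causal GH); last exact: gamma_le.
  by apply: causal_le_trans H; exact: gamma_le.
pose t := (u + u') / 2.
have Jt : J t by apply: ((wl_interval HJ).2 _ _ Ju Ju'); rewrite /t; apply/andP; split; lra.
have [k ak dk] := st_cover HM (gamma t).
have := wl_proper_time HJ Jt ak dk.
have -> : velocity k gamma t = 0.
  apply/rowP => i; rewrite !mxE derive1E.
  have E : \forall s \near t, (fun=> coord k gamma i t) s = coord k gamma i s.
    have : \forall s \near t, u < s < u'.
      have : \forall s \near t, u < s by apply: lt_nbhsr; rewrite /t; lra.
      have : \forall s \near t, s < u' by apply: lt_nbhsl; rewrite /t; lra.
      by apply: filterS2 => s -> ->.
    apply: filterS => s /andP[s1 s2]; rewrite /coord !cst //; first by rewrite !ltW.
    by rewrite /t; apply/andP; split; lra.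
  by have [_ ->] := near_eq_is_derive E (is_derive_cst (coord k gamma i t) t (1 : R)).
by rewrite /ip mul0mx mul0mx mxE => /eqP; rewrite eq_sym oppr_eq0 oner_eq0.
Qed.

End CausalCurves.

(** * Retarded coordinates *)

Section EuclideanNorm.
Context {R : realType}.
Implicit Types (n p : 'rV[R]_3) (u s : R).

Lemma dot_enorm m (p : 'rV[R]_m) : dot p p = enorm p ^+ 2.
Proof.
rewrite /enorm sqr_sqrtr /dot; last by apply: sumr_ge0 => i _; exact: sqr_ge0.
by apply: eq_bigr => i _; rewrite expr2.
Qed.

Lemma enorm_scale m s (p : 'rV[R]_m) : 0 <= s -> enorm (s *: p) = s * enorm p.
Proof.
move=> s0; rewrite /enorm.
have -> : \sum_i (s *: p) 0 i ^+ 2 = s ^+ 2 * \sum_i p 0 i ^+ 2.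
  by rewrite mulr_sumr; apply: eq_bigr => i _; rewrite mxE exprMn.
by rewrite sqrtrM ?sqr_ge0 // sqrtr_sqr ger0_norm.
Qed.

Lemma enorm_unit s n : 0 <= s -> unit_sphere n -> enorm (s *: n) = s.
Proof. by move=> s0 n1; rewrite enorm_scale // n1 mulr1. Qed.

Lemma enorm_gt0 m (p : 'rV[R]_m) : p <> 0 -> 0 < enorm p.
Proof.
move=> /eqP p0; rewrite sqrtr_gt0 lt_neqAle sumr_ge0 ?andbT; last first.
  by move=> i _; exact: sqr_ge0.
apply: contraNneq p0 => /esym/eqP; rewrite psumr_eq0 => [/allP H|i _]; last exact: sqr_ge0.
apply/eqP/rowP => i; rewrite mxE; apply/eqP; rewrite -sqrf_eq0.
by apply: H; rewrite mem_index_enum.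
Qed.

Lemma unit_direction (t p : R) : unit_sphere (direction t p).
Proof.
rewrite /unit_sphere /= /enorm /direction !big_ord_recl big_ord0 !mxE /= addr0.
rewrite !exprMn addrA -mulrDr cos2Dsin2 mulr1 addrC cos2Dsin2 sqrtr1 //.
Qed.

Lemma unit_neq0 n : unit_sphere n -> n <> 0.
Proof.
move=> n1 n0; have : dot n n = 1 by rewrite dot_enorm n1 expr1n.
rewrite n0 /dot big1 => [|i _]; last by rewrite mxE mul0r.
by move=> /eqP; rewrite eq_sym oner_eq0.
Qed.

Lemma continuous_enorm m : continuous (@enorm R m).
Proof.
move=> p; have c : {for p, continuous (fun p : 'rV[R]_m => \sum_i p 0 i ^+ 2)}.
  apply: continuous_at_sum => i _.
  have ci : {for p, continuous (fun p : 'rV[R]_m => p 0 i)} by exact: coord_continuous.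
  exact: (continuous_at_mul ci ci).
by apply: (continuous_comp c); exact: sqrt_continuous.
Qed.

Lemma enorm_coord m (p : 'rV[R]_m) i : `|p 0 i| <= enorm p.
Proof.
rewrite -sqrtr_sqr ler_sqrt; last by apply: sumr_ge0 => j _; exact: sqr_ge0.
by rewrite (bigD1 i) //= lerDl sumr_ge0 // => j _; exact: sqr_ge0.
Qed.

Lemma compact_shell (a b : R) : compact [set p : 'rV[R]_3 | a <= enorm p <= b].
Proof.
have -> : [set p : 'rV[R]_3 | a <= enorm p <= b] =
    @enorm R 3 @^-1` [set t | a <= t] `&` @enorm R 3 @^-1` [set t | t <= b].
  by apply/seteqP; split=> p /= => [/andP[]//|[-> ->]].
apply: (@subclosed_compact _ _ [set v : 'rV[R]_3 | forall i, `|v 0 i| <= b]).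
- by apply: closedI; apply: closed_comp => [p _|]; [exact: continuous_enorm|exact: closed_ge|
    exact: continuous_enorm|exact: closed_le].
- exact: compact_box.
- by move=> p [_ /= pb] i; apply: le_trans (enorm_coord p i) pb.
Qed.

Lemma compact_unit_sphere : compact (@unit_sphere R).
Proof.
have -> : @unit_sphere R = [set p : 'rV[R]_3 | 1 <= enorm p <= 1].
  by apply/seteqP; split=> p /=; [move=> ->; rewrite lexx|rewrite -eq_le => /eqP].
exact: compact_shell.
Qed.

Definition upoint u p : 'rV[R]_4 := row_mx (u%:M : 'rV[R]_1) p.

Lemma upoint0 u p : upoint u p 0 ord0 = u.
Proof. exact: row_mx0E. Qed.

Lemma upointS u p i : upoint u p 0 (lift ord0 i) = p 0 i.
Proof. exact: row_mxSE. Qed.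

Lemma rV4P (x y : 'rV[R]_4) : x 0 ord0 = y 0 ord0 ->
  (forall i, x 0 (lift ord0 i) = y 0 (lift ord0 i)) -> x = y.
Proof. by move=> h0 h; apply/rowP => j; case: (unliftP ord0 j) => [i ->|->]. Qed.

Lemma ucoordE (z : 'rV[R]_4) : ucoord z = z 0 ord0.
Proof. by rewrite /ucoord mxE; congr (z 0 _); exact/val_inj. Qed.

Lemma pcoordE (z : 'rV[R]_4) i : pcoord z 0 i = z 0 (lift ord0 i).
Proof. by rewrite /pcoord mxE; congr (z 0 _); exact/val_inj. Qed.

Lemma ucoord_upoint u p : ucoord (upoint u p) = u.
Proof. by rewrite ucoordE upoint0. Qed.

Lemma pcoord_upoint u p : pcoord (upoint u p) = p.
Proof. by apply/rowP => i; rewrite pcoordE upointS. Qed.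

Lemma upointE (z : 'rV[R]_4) : z = upoint (ucoord z) (pcoord z).
Proof. by apply: rV4P => [|i]; rewrite ?upoint0 ?ucoordE // upointS pcoordE. Qed.

Lemma upoint_line u p v (t : R) : upoint u p + t *: upoint 0 v = upoint u (p + t *: v).
Proof.
apply: rV4P => [|i]; first by rewrite mxE [X in _ + X]mxE !upoint0 mulr0 addr0.
by rewrite mxE [X in _ + X]mxE !upointS !mxE.
Qed.

Lemma upointD u u' p p' : upoint u p + upoint u' p' = upoint (u + u') (p + p').
Proof. by apply: rV4P => [|i]; rewrite mxE ?(upoint0, upointS) ?mxE. Qed.

Lemma ds_vecE n : ds_vec n = upoint 0 n.
Proof. by rewrite /ds_vec /upoint -scalemx1 scale0r. Qed.

Lemma continuous_upoint (T : topologicalType) (x : T) (u : T -> R) (p : T -> 'rV[R]_3) :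
  {for x, continuous u} -> {for x, continuous p} ->
  {for x, continuous (fun y => upoint (u y) (p y))}.
Proof. exact: continuous_row_mx. Qed.

Lemma continuous_ucoord : continuous (@ucoord R).
Proof.
have -> : @ucoord R = fun z => z 0 ord0 by apply/funext => z; exact: ucoordE.
by move=> z; exact: coord_continuous.
Qed.

Lemma continuous_pcoord : continuous (@pcoord R).
Proof.
move=> z; apply: continuous_at_mx => a i; rewrite ord1.
have -> : (fun z => pcoord z 0 i) = fun z : 'rV[R]_4 => z 0 (lift ord0 i).
  by apply/funext => w; exact: pcoordE.
exact: coord_continuous.
Qed.

Lemma ereal_room (x : R) (S : \bar R) : (x%:E < S)%E -> exists2 y, x < y & (y%:E < S)%E.
Proof.
case: S => [r| |] //=; last by exists (x + 1); rewrite ?ltrDl // ltry.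
rewrite lte_fin => xr; exists ((x + r) / 2); rewrite ?lte_fin; lra.
Qed.

End EuclideanNorm.

Section Rays.
Context {R : realType} {M : spacetime R} (HM : is_spacetime M).
Context (J : set R) (gamma : R -> M) (HJ : worldline J gamma).
Context (rot : 'M[R]_3 -> M -> M) (k : chart R M) (A r : R -> R -> R) (smax : R -> \bar R).
Context (HR : retarded_coordinates J gamma rot k A r smax).
Implicit Types (x y q : M) (n p : 'rV[R]_3) (u s : R).
Local Notation dom := Defs.dom.
Local Notation jac := Defs.jacobian.
Local Notation coord := Defs.coord.

Let ak : atlas M k := ret_atlas HR.

Lemma ret_upoint u s n : retpoint k u s n = par k (upoint u (s *: n)).
Proof. by []. Qed.

Lemma img_upoint u p : img k (upoint u p) <-> J u /\ p <> 0 /\ ((enorm p)%:E < smax u)%E.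
Proof. by have := ret_img HR (upoint u p); rewrite ucoord_upoint pcoord_upoint. Qed.

Lemma scale_unit_neq0 s n : 0 < s -> unit_sphere n -> s *: n <> 0.
Proof.
move=> s0 n1 /eqP; rewrite scaler_eq0 gt_eqF //= => /eqP; exact: unit_neq0.
Qed.

Lemma ret_imgP u s n : J u -> unit_sphere n -> 0 < s -> (s%:E < smax u)%E ->
  img k (upoint u (s *: n)).
Proof.
move=> Ju n1 s0 sm; apply/img_upoint; split=> //; split; first exact: scale_unit_neq0.
by rewrite enorm_unit // ltW.
Qed.

Lemma ret_dom u s n : J u -> unit_sphere n -> 0 < s -> (s%:E < smax u)%E ->
  dom k (retpoint k u s n).
Proof. by move=> *; apply: (img_par HM ak); exact: ret_imgP. Qed.

Lemma ret_crd u s n : J u -> unit_sphere n -> 0 < s -> (s%:E < smax u)%E ->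
  crd k (retpoint k u s n) = upoint u (s *: n).
Proof. by move=> *; rewrite ret_upoint (parK HM ak) //; exact: ret_imgP. Qed.

Lemma domP x : dom k x -> let u := ucoord (crd k x) in let s := enorm (pcoord (crd k x)) in
  exists n, [/\ J u, unit_sphere n, 0 < s, (s%:E < smax u)%E & x = retpoint k u s n].
Proof.
move=> dx u s; have ix := img_crd dx.
have [Ju [p0 sm]] := (ret_img HR _).1 ix.
have s0 : 0 < s by exact: enorm_gt0.
exists (s^-1 *: pcoord (crd k x)); split=> //.
  by rewrite /unit_sphere /= enorm_scale ?invr_ge0 ?(ltW s0) // mulVf // gt_eqF.
rewrite ret_upoint scalerA mulfV ?gt_eqF // scale1r -upointE.
by rewrite (crdK HM ak).
Qed.

(* The retarded metric makes ds_vec dual to - du. *)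
Lemma ip_ds u s n v : J u -> unit_sphere n -> 0 < s -> (s%:E < smax u)%E ->
  ip k (retpoint k u s n) (ds_vec n) v = - v 0 ord0.
Proof.
move=> Ju n1 s0 sm; have dx := ret_dom Ju n1 s0 sm.
have nn : dot n n = 1 by rewrite dot_enorm n1 expr1n.
rewrite ds_vecE [v]upointE.
set a := ucoord v; set w := pcoord v; rewrite upoint0.
(* Only the quadratic form of the metric is given, so the product of [ds_vec n] and [v] is recovered
   by polarization, from the value at their sum. *)
have E b p : ip k (retpoint k u s n) (upoint b p) (upoint b p) = - A u s * b ^+ 2 - 2 * dot n p * b
      + (r u s / s) ^+ 2 * (dot p p - dot n p ^+ 2) by exact: (ret_metric HR b p Ju n1 s0 sm).
have sum : upoint 0 n + upoint a w = upoint a (n + w).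
  by rewrite upointD add0r.
have := E a (n + w); rewrite -sum !ip_addl !ip_addr.
have e1 : ip k (retpoint k u s n) (upoint 0 n) (upoint 0 n) = 0.
  by rewrite E nn; ring.
have e2 := E a w.
rewrite e1 (ip_sym HM (upoint a w) (upoint 0 n) ak dx) e2.
have dn : dot n (n + w) = 1 + dot n w.
  by rewrite -nn /dot -big_split /=; apply: eq_bigr => i _; rewrite mxE mulrDr.
have dnw : dot (n + w) (n + w) = 1 + 2 * dot n w + dot w w.
  transitivity (dot n n + 2 * dot n w + dot w w); last by rewrite nn.
  rewrite /dot mulr_sumr -!big_split /=; apply: eq_bigr => i _; rewrite mxE; ring.
rewrite dn dnw; lra.
Qed.

Lemma ds_null u s n : J u -> unit_sphere n -> 0 < s -> (s%:E < smax u)%E ->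
  ip k (retpoint k u s n) (ds_vec n) (ds_vec n) = 0.
Proof. by move=> *; rewrite ip_ds // ds_vecE upoint0 oppr0. Qed.

Lemma smax_ge u : J u -> exists2 b, 0 < b & (b%:E <= smax u)%E.
Proof.
move=> Ju; have := ret_smax HR Ju; case: (smax u) => [b| |] //=.
  by rewrite lte_fin => b0; exists b.
by move=> _; exists 1; rewrite ?leey.
Qed.

Lemma continuous_ret_ray u n s : J u -> unit_sphere n -> 0 < s -> (s%:E < smax u)%E ->
  {for s, continuous (fun s => upoint u (s *: n))}.
Proof.
move=> *; apply: continuous_upoint; first exact: cst_continuous.
have -> : (fun s => s *: n) = (fun s => 0 + s *: n) by apply/funext => t; rewrite add0r.
by apply: continuous_at_affine; [exact: cst_continuous|exact: cvg_id].
Qed.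

(** The chart does not reach the axis, so the approach of a ray to its tip is taken from the
    continuous geodesic through [gamma u] that extends it. *)
Lemma ray_tip u n (W : set M) : J u -> unit_sphere n -> nbhs (gamma u) W ->
  exists2 d, 0 < d & forall s, 0 < s -> s < d -> (s%:E < smax u)%E -> W (retpoint k u s n).
Proof.
move=> Ju n1 nW; have [c [a [a0 c0 cE geo _]]] := ret_ray HR Ju n1.
have [b b0 bs] := smax_ge Ju.
have [cc _] := geo b b0 bs 0 (introT andP (conj a0 b0)).
rewrite -c0 in nW; have /nbhs_normP[d /= d0 dW] := cc _ nW.
exists d => // s s0 sd sm; rewrite -cE //; apply: dW => /=.
by rewrite sub0r normrN gtr0_norm.
Qed.

(** The retarded chart does not contain the tip. The sign is obtained in a chart around [gamma u],
    where the geodesic starts with a future-directed velocity that varies continuously, and is then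
    carried over to the chart [k]. *)
Lemma ray_future_near u n : J u -> unit_sphere n -> exists2 d, 0 < d &
  forall s, 0 < s -> s < d -> (s%:E < smax u)%E ->
    ip k (retpoint k u s n) (ds_vec n) (tdir k (retpoint k u s n)) < 0.
Proof.
move=> Ju n1; have [c [a [a0 c0 cE geo init]]] := ret_ray HR Ju n1.
have [b b0 bs] := smax_ge Ju.
have [cc gl] := geo b b0 bs 0 (introT andP (conj a0 b0)).
have [l al dl] := st_cover HM (gamma u).
have [[_ fut] _ _] := init l al dl.
rewrite -c0 in dl fut.
have cv : {for 0, continuous (velocity l c)}.
  apply: continuous_at_mx => ? m; rewrite ord1.
  rewrite (_ : (fun _ => _) = derive1 (coord l c m)); last by apply/funext => t; rewrite mxE.
  by apply: differentiable_continuous; apply/derivable1_diffP; have [] := gl l al dl m.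
have ccrd : {for 0, continuous (fun t => crd l (c t))}.
  by apply: (@continuous_comp _ _ _ c (crd l)) => //; exact: (cts_crd HM al dl).
have cg : {for 0, continuous (fun t => ip l (par l (crd l (c t))) (velocity l c t)
     (tdir l (par l (crd l (c t)))))}.
  have ct := @continuous_tdir_comp _ _ HM _ 0 l (fun t : R => crd l (c t)) al (img_crd dl) ccrd.
  exact: (@continuous_ip _ _ HM _ 0 l (fun t : R => crd l (c t)) (velocity l c) _ al
    (img_crd dl) ccrd cv ct).
have g0 : ip l (par l (crd l (c 0))) (velocity l c 0) (tdir l (par l (crd l (c 0)))) < 0.
  by rewrite (crdK HM al dl).
have near1 : \forall t \near (0 : R), ip l (par l (crd l (c t))) (velocity l c t)
     (tdir l (par l (crd l (c t)))) < 0 by exact: (cvgr_lt _ cg).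
have near2 : \forall t \near (0 : R), dom l (c t).
  by apply: cc; apply: open_nbhs_at => //; exact: (open_dom HM al).
have /nbhs_normP[d /= d0 dP] : \forall t \near (0 : R), ip l (par l (crd l (c t))) (velocity l c t)
     (tdir l (par l (crd l (c t)))) < 0 /\ dom l (c t) by apply: filterS2 near1 near2 => t; split.
exists d => // s s0 sd sm.
have [] : ip l (par l (crd l (c s))) (velocity l c s) (tdir l (par l (crd l (c s)))) < 0 /\ dom l (c s).
  by apply: dP => /=; rewrite sub0r normrN gtr0_norm.
move=> + dls; rewrite (crdK HM al dls) (cE s s0 sm) => h.
have [s' ss' sm'] := ereal_room sm.
have E : {near s, c =1 retpoint k u ^~ n}.
  have n2 : \forall t \near s, 0 < t by exact: lt_nbhsr.
  have n3 : \forall t \near s, t < s' by exact: lt_nbhsl.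
  apply: filterS2 n2 n3 => t t0 ts'; apply: cE => //.
  by apply: lt_trans sm'; rewrite lte_fin.
have ds := ret_dom Ju n1 s0 sm.
have lineE : (fun t => par k (upoint u 0 + t *: upoint 0 n)) = retpoint k u ^~ n.
  by apply/funext => t; rewrite upoint_line add0r.
have iis : img k (upoint u 0 + s *: upoint 0 n).
  by rewrite upoint_line add0r; exact: ret_imgP.
have dv i : is_derive s 1 (coord k c i) (ds_vec n 0 i).
  have := line_velocity HM ak iis i; rewrite lineE -ds_vecE.
  apply: near_eq_is_derive; apply: filterS E => t; by rewrite /coord => ->.
have ccs : {for s, continuous c}.
  have crs : {for s, continuous (retpoint k u ^~ n)}.
    apply: (@continuous_comp _ _ _ (fun s => upoint u (s *: n)) (par k)).
      exact: continuous_ret_ray.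
    by apply: (cts_par HM ak); exact: ret_imgP.
  have Es := nbhs_singleton E; rewrite /prop_for /continuous_at Es.
  apply: cvg_trans crs; apply: near_eq_cvg; by apply: filterS E => t ->.
have dks : dom k (c s) by rewrite cE.
have velk : velocity k c s = ds_vec n.
  by apply/rowP => i; rewrite mxE derive1E; have [_ ->] := dv i.
have dl' : dom l (retpoint k u s n) by rewrite -cE.
have dvd i : derivable (coord k c i) s 1 by have [] := dv i.
have velE := velocity_change HM ak al ccs dks dls dvd; rewrite velk in velE.
move: h; rewrite velE cE // (st_tdir_change HM ak al ds dl').
by rewrite -(ip_change HM _ _ ak al ds dl').
Qed.

End Rays.

Lemma ivt_zero {R : realType} (g : R -> R) a b : a <= b ->
  (forall t, a <= t <= b -> {for t, continuous g}) -> g a <= 0 -> 0 <= g b ->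
  exists2 c, a <= c <= b & g c = 0.
Proof.
move=> ab cg ga gb.
have [c ci gc] : exists2 c, c \in `[a, b] & g c = 0.
  apply: IVT => //; last by rewrite ge_min ga le_max gb orbT.
  apply: continuous_in_subspaceT => t; rewrite inE /= in_itv /= => ht; exact: cg.
by exists c => //; rewrite in_itv in ci.
Qed.

Section CausalRays.
Context {R : realType} {M : spacetime R} (HM : is_spacetime M).
Context (J : set R) (gamma : R -> M) (HJ : worldline J gamma).
Context (rot : 'M[R]_3 -> M -> M) (k : chart R M) (A r : R -> R -> R) (smax : R -> \bar R).
Context (HR : retarded_coordinates J gamma rot k A r smax).
Implicit Types (x y q : M) (n p : 'rV[R]_3) (u s : R).
Local Notation dom := Defs.dom.

Let ak : atlas M k := ret_atlas HR.

(** A change of sign along the ray would give a point where the null vector ds is orthogonal to the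
    timelike field [tdir], hence zero, which a unit direction excludes. *)
Lemma ray_future u s n : J u -> unit_sphere n -> 0 < s -> (s%:E < smax u)%E ->
  future_causal k (retpoint k u s n) (ds_vec n).
Proof.
move=> Ju n1 s0 sm; split; first by rewrite (ds_null HM HR).
pose g t := ip k (retpoint k u t n) (ds_vec n) (tdir k (retpoint k u t n)).
rewrite -/(g s) ltNge; apply/negP => gs.
have [d d0 near0] := ray_future_near HM HR Ju n1.
pose t := Num.min d s / 2.
have m0 : 0 < Num.min d s by rewrite lt_min d0.
have t0 : 0 < t by rewrite divr_gt0.
have : t < Num.min d s by rewrite /t; lra.
rewrite lt_min => /andP[td ts].
have sma (y : R) : y <= s -> (y%:E < smax u)%E by move=> ys; apply: le_lt_trans sm; rewrite lee_fin.
have gt : g t < 0 by apply: near0 => //; apply: sma; exact: ltW.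
have [|c /andP[tc cs] gc] := ivt_zero (ltW ts) _ (ltW gt) gs.
  move=> y /andP[ty ys]; have y0 : 0 < y by exact: lt_le_trans ty.
  have cr := continuous_ret_ray Ju n1 y0 (sma _ ys).
  have iy := ret_imgP HR Ju n1 y0 (sma _ ys).
  have ct := @continuous_tdir_comp _ _ HM _ y k (fun s => upoint u (s *: n)) ak iy cr.
  have cc : {for y, continuous (fun=> ds_vec n : 'rV[R]_4)} by exact: cst_continuous.
  have cg := @continuous_ip _ _ HM _ y k (fun s => upoint u (s *: n)) (fun=> ds_vec n) _ ak iy cr cc ct.
  exact: cg.
have c0 : 0 < c by exact: lt_le_trans tc.
have := causal_orthogonal HM ak (ret_dom HM HR Ju n1 c0 (sma _ cs)) _ gc.
rewrite (ds_null HM HR Ju n1 c0 (sma _ cs)) => /(_ (lexx _)).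
rewrite ds_vecE => /(congr1 (@pcoord R)); rewrite pcoord_upoint => n0.
by apply: (unit_neq0 n1); rewrite n0; apply/rowP => i; rewrite pcoordE !mxE.
Qed.

(** A ray is a straight line of the chart [k]; the margin [e] keeps its extension between the tip
    and a distance s3 below the end of the range. *)
Lemma ray_le u s s' n : J u -> unit_sphere n -> 0 < s -> s <= s' -> (s'%:E < smax u)%E ->
  causal_le (retpoint k u s n) (retpoint k u s' n).
Proof.
move=> Ju n1 s0; rewrite le_eqVlt => /predU1P[->|ss' sm]; first by move=> _; exact: causal_le_refl.
have [s3 s3s sm3] := ereal_room sm.
pose v := (s' - s) *: upoint 0 n.
pose e := Num.min (s / (s' - s)) ((s3 - s') / (s' - s)).
have d0 : 0 < s' - s by lra.
have e0 : 0 < e by rewrite lt_min !divr_gt0 //; lra.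
have [e1 e2] : e * (s' - s) <= s /\ e * (s' - s) <= s3 - s'.
  by split; rewrite -ler_pdivlMr // ge_min lexx ?orbT.
have lineE t : upoint u (s *: n) + t *: v = upoint u ((s + t * (s' - s)) *: n).
  by rewrite /v scalerA upoint_line scalerDl.
have endE : upoint u (s *: n) + v = upoint u (s' *: n).
  by rewrite -[v]scale1r lineE mul1r addrC subrK.
apply: causal_segment_le; rewrite !ret_upoint -endE.
apply: (line_segment HM ak e0) => t /andP[t1 t2]; rewrite lineE.
have h1 : 0 < s + t * (s' - s).
  have : - e * (s' - s) < t * (s' - s) by rewrite ltr_pM2r.
  lra.
have h2 : ((s + t * (s' - s))%:E < smax u)%E.
  apply: lt_trans sm3; rewrite lte_fin.
  have : t * (s' - s) < (1 + e) * (s' - s) by rewrite ltr_pM2r.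
  lra.
split; first exact: (ret_imgP HR).
by rewrite -ret_upoint; apply: future_causal_scale => //; rewrite -ds_vecE; exact: ray_future.
Qed.

(** The tip lies outside the chart, so an earlier point of [gamma] is joined to a point of the ray
    close to the tip, and the ray is followed from there; hence the strict inequality u' < u. *)
Lemma gamma_le_ret u u' s n : J u -> J u' -> u' < u -> unit_sphere n -> 0 < s ->
  (s%:E < smax u)%E -> causal_le (gamma u') (retpoint k u s n).
Proof.
move=> Ju Ju' uu' n1 s0 sm; have e0 : 0 < u - u' by lra.
have [u1 [Ju1 h1 h2 nW]] := past_nbhd HM HJ Ju e0.
have [d d0 dW] := ray_tip HR Ju n1 nW.
pose t := Num.min d s / 2.
have m0 : 0 < Num.min d s by rewrite lt_min d0.
have t0 : 0 < t by rewrite divr_gt0.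
have : t < Num.min d s by rewrite /t; lra.
rewrite lt_min => /andP[td ts].
apply: causal_le_trans (ray_le Ju n1 t0 (ltW ts) sm).
apply: causal_le_trans (dW t t0 td (lt_trans _ sm)); last by rewrite lte_fin.
by apply: (gamma_le HJ) => //; lra.
Qed.

(** Each ray has a point in an open set of the past of [gamma u1]. Rays of neighbouring directions
    meet that open set at the same distance, and smaller distances come earlier along the ray;
    compactness of the sphere of directions then makes [d] uniform. *)
Lemma ret_le_gamma u u' : J u -> J u' -> u < u' -> exists2 d, 0 < d &
  forall n s, unit_sphere n -> 0 < s -> s <= d -> (s%:E < smax u)%E ->
    causal_le (retpoint k u s n) (gamma u').
Proof.
move=> Ju Ju' uu'; have e0 : 0 < u' - u by lra.
have [u1 [Ju1 h1 h2 nW]] := future_nbhd HM HJ Ju e0.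
have le1 : causal_le (gamma u1) (gamma u') by apply: (gamma_le HJ) => //; lra.
have [b b0 bs] := smax_ge HR Ju.
pose P (d : R) n := unit_sphere n -> forall s, 0 < s -> s <= d -> (s%:E < smax u)%E ->
  causal_le (retpoint k u s n) (gamma u').
have cov := (compact_near_coveringP _).1 (@compact_unit_sphere R).
have : \forall d \near 0^'+, @unit_sphere R `<=` P d.
  apply: cov => n n1.
  have [V [oV Vg VW]] : exists V : set M, [/\ open V, V (gamma u) & forall q, V q -> causal_le q (gamma u1)].
    have : nbhs (gamma u) [set q | causal_le q (gamma u1)] := nW.
    by rewrite nbhsE => -[V [oV Vg] VW]; exists V.
  have [d d0 dW] := ray_tip HR Ju n1 (open_nbhs_at oV Vg).
  pose t := Num.min d b / 2.
  have m0 : 0 < Num.min d b by rewrite lt_min d0.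
  have t0 : 0 < t by rewrite divr_gt0.
  have : t < Num.min d b by rewrite /t; lra.
  rewrite lt_min => /andP[td tb].
  have tsm : (t%:E < smax u)%E by apply: lt_le_trans bs; rewrite lte_fin.
  have near1 : \forall m \near n, V (retpoint k u t m).
    have cm : {for n, continuous (fun m : 'rV[R]_3 => par k (upoint u (t *: m)))}.
      apply: (@continuous_comp _ _ _ (fun m : 'rV[R]_3 => upoint u (t *: m)) (par k)).
        apply: continuous_upoint; first exact: cst_continuous.
        exact: scaler_continuous.
      by apply: (cts_par HM ak); exact: (ret_imgP HR).
    by apply: cm; apply: open_nbhs_at => //; apply: dW.
  have near2 : \forall d' \near (0 : R)^'+, d' <= t by exact: nbhs_right_le.
  exists ([set m : 'rV[R]_3 | V (retpoint k u t m)], [set d' : R | d' <= t]); first by split.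
  move=> [m d'] /= [Vm d't] m1 s s0 sd sm.
  apply: causal_le_trans (ray_le Ju m1 s0 (le_trans sd d't) tsm) _.
  exact: causal_le_trans (VW _ Vm) le1.
move=> H; have [d [Pd d0]] : exists d, (@unit_sphere R `<=` P d) /\ 0 < d.
  near (0 : R)^'+ => d; exists d; split; near: d; first exact: H.
  exact: nbhs_right_gt.
by exists d => // n s n1; exact: Pd.
Unshelve. all: by end_near. Qed.

End CausalRays.

(** * Retarded coordinates near the axis *)

Section AxisComplement.
Context {R : realType} {M : spacetime R} (HM : is_spacetime M).
Context (J : set R) (gamma : R -> M) (HJ : worldline J gamma) (GH : globally_hyperbolic M).
Implicit Types (x y q : M) (z w : 'rV[R]_4) (u : R).
Local Notation dom := Defs.dom.
Local Notation coord := Defs.coord.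

(** The velocity is not zero, so some coordinate of [gamma] has a nonzero derivative at u0. Nearby
    the derivative stays within half of that value, and the coordinate separates the points of the
    axis. *)
Lemma gamma_slope l u0 : J u0 -> atlas M l -> dom l (gamma u0) ->
  exists i c e, [/\ 0 < c, 0 < e, forall u, `|u - u0| < e -> J u /\ dom l (gamma u) &
    forall u u', `|u - u0| < e -> `|u' - u0| < e ->
    c * `|u - u'| <= `|coord l gamma i u - coord l gamma i u'|].
Proof.
move=> Ju al dl; set v0 := velocity l gamma u0.
have [i v0i] : exists i, v0 0 i != 0.
  apply: contrapT => H; have := wl_proper_time HJ Ju al dl; rewrite -/v0.
  have -> : v0 = 0.
    by apply/rowP => i; rewrite [RHS]mxE; apply/eqP; apply: contrapT => /negP ne; apply: H; exists i.
  by rewrite /ip mul0mx mul0mx mxE => /eqP; rewrite eq_sym oppr_eq0 oner_eq0.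
pose g := coord l gamma i; pose c := `|v0 0 i| / 2.
have c0 : 0 < c by rewrite divr_gt0 // normr_gt0.
have cd : {for u0, continuous (derive1 g)}.
  apply: differentiable_continuous; apply/derivable1_diffP.
  exact: (@wl_smooth _ _ _ _ HJ _ l i 1 Ju al dl).
have n1 : \forall u \near u0, `|derive1 g u0 - derive1 g u| < c.
  by have /cvgr_dist_lt/(_ c c0) := cd; exact.
have n2 : \forall u \near u0, J u by exact: open_J HJ _ Ju.
have n3 : \forall u \near u0, dom l (gamma u).
  by apply: (wl_continuous HJ Ju); apply: open_nbhs_at => //; exact: (open_dom HM al).
have /nbhs_normP[d /= d0 dP] : \forall u \near u0,
    [/\ `|derive1 g u - v0 0 i| <= c, derivable g u 1, J u & dom l (gamma u)].
  apply: filterS3 n1 n2 n3 => u h Ju' dl'; split; [|exact: (@wl_smooth _ _ _ _ HJ _ l i 0 Ju' al dl')|exact: Ju'|exact: dl'].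
  by rewrite distrC ltW //; move: h; rewrite /v0 mxE.
exists i, c, (d / 3); split; [exact: c0|by rewrite divr_gt0| |].
  by move=> u hu; have [|_ _ Jd dd] := dP u; [rewrite /= distrC; lra|split].
move=> u u' hu hu'.
have K (t : R) : `|t| <= `|u - u'| -> is_derive t 1 (fun t => g (t + u')) (derive1 g (t + u')) /\
    `|derive1 g (t + u') - v0 0 i| <= c.
  move=> ht.
  have [|h1 h2 _ _] := dP (t + u').
    rewrite /= distrC; have -> : t + u' - u0 = t + (u' - u0) by rewrite addrA.
    apply: le_lt_trans (ler_normD _ _) _.
    have : `|u - u'| <= `|u - u0| + `|u' - u0|.
      have -> : u - u' = (u - u0) - (u' - u0) by ring.
      exact: ler_normB.
    lra.
  split; last exact: h1.
  have h3 : is_derive (t + u') 1 g (derive1 g (t + u')) by rewrite derive1E; exact: DeriveDef.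
  have h4 : is_derive t 1 (shift u') 1.
    have := is_deriveD (is_derive_id t (1 : R)) (is_derive_cst u' t (1 : R)).
    by move=> h; apply: (is_derive_eq h); rewrite addr0.
  have h5 := @is_derive1_comp _ g (shift u') t _ _ h3 h4.
  by apply: (is_derive_eq h5); rewrite mulr1.
have := @mean_value_le _ (fun t => g (t + u')) (v0 0 i) c (u - u').
move=> /(_ _)/wrap[t /K[h1 h2]|].
  by have [dv ->] := h1.
rewrite subrK add0r => h.
have : `|v0 0 i * (u - u')| <= `|g u - g u'| + `|g u - g u' - v0 0 i * (u - u')|.
  by have := ler_normB (g u - g u') (g u - g u' - v0 0 i * (u - u')); rewrite subKr.
rewrite normrM; have -> : `|v0 0 i| = 2 * c by rewrite /c; field.
rewrite /g in h *; lra.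
Qed.

(** Points close to [gamma u0] lie causally between two points of [gamma] with parameters close to
    u0, so a return of [gamma] at a distant parameter would close a causal loop. *)
Lemma gamma_local u0 e : J u0 -> 0 < e ->
  \forall q \near gamma u0, forall u, J u -> q = gamma u -> `|u - u0| < e.
Proof.
move=> Ju e0.
have [u1 [Ju1 a1 b1 n1]] := future_nbhd HM HJ Ju e0.
have [u2 [Ju2 a2 b2 n2]] := past_nbhd HM HJ Ju e0.
apply: filterS2 n1 n2 => q h1 h2 u Jq qE; rewrite qE in h1 h2.
have := gamma_not_ge HM HJ GH Ju1 Jq; have := gamma_not_ge HM HJ GH Jq Ju2.
move=> H1 H2; rewrite ltr_norml; apply/andP; split.
  by apply: contrapT => /negP; rewrite -leNgt => ?; apply: H1 => //; lra.
by apply: contrapT => /negP; rewrite -leNgt => ?; apply: H2 => //; lra.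
Qed.

Definition segment_in (l : chart R M) (D : set M) z w :=
  forall t, 0 <= t <= 1 -> img l (z + t *: (w - z)) /\ D (par l (z + t *: (w - z))).

Lemma segment_abs_lt (a b t rho : R) : `|a| < rho -> `|b| < rho -> 0 <= t <= 1 ->
  `|a + t * (b - a)| < rho.
Proof.
move=> ha hb /andP[t0 t1]; have hm : Num.max `|a| `|b| < rho by rewrite gt_max ha hb.
apply: le_lt_trans hm; have -> : a + t * (b - a) = (1 - t) * a + t * b by ring.
apply: le_trans (ler_normD _ _) _; rewrite !normrM (ger0_norm t0) (ger0_norm (_ : 0 <= 1 - t)); last lra.
set m := Num.max _ _; have am : `|a| <= m by rewrite le_max lexx.
have bm : `|b| <= m by rewrite le_max lexx orbT.
have -> : m = (1 - t) * m + t * m by ring.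
by apply: lerD; apply: ler_wpM2l => //; lra.
Qed.

(* The axis meets each slice of constant i-th coordinate in at most one point,
   so a point off the axis escapes from it in one of two directions. *)
Lemma axis_complement_connected l u0 (W : set M) : J u0 -> atlas M l -> dom l (gamma u0) ->
  nbhs (gamma u0) W -> exists P, \forall q \near gamma u0, ~ (gamma @` J) q -> dom l q /\
    exists w, segment_in l (W `\` gamma @` J) (crd l q) w /\
              segment_in l (W `\` gamma @` J) w P.
Proof.
move=> Ju al dl nW; set z0 := crd l (gamma u0).
have [i [c [e [c0 e0 ge slope]]]] := gamma_slope Ju al dl.
(* Along either of these two directions the i-th coordinate is constant, so a line in such a
   direction meets the nearby axis at most once. *)
have [j1 [j2 [j1i j2i j12]]] : exists j1 j2 : 'I_4, [/\ j1 != i, j2 != i & j1 != j2].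
  exists (lift i (0 : 'I_3)), (lift i (1 : 'I_3)); split; rewrite 1?eq_sym ?neq_lift //.
  by apply/eqP => /lift_inj /eqP.
have iz : img l z0 by exact: img_crd.
have cp := cts_par HM al iz.
have p0 : par l z0 = gamma u0 by rewrite (crdK HM al dl).
have n1 : \forall z \near z0, img l z by apply: open_nbhs_at => //; exact: (open_img HM al).
have n2 : \forall z \near z0, W (par l z) by apply: cp; rewrite p0.
have n3 : \forall z \near z0, forall u, J u -> par l z = gamma u -> `|u - u0| < e.
  have G : nbhs (par l z0) [set q | forall u, J u -> q = gamma u -> `|u - u0| < e].
    by rewrite p0; exact: (gamma_local Ju e0).
  exact: (cp _ G).
have /nbhs_normP[rho /= rho0 rhoP] : \forall z \near z0, [/\ img l z, W (par l z) &
    forall u, J u -> par l z = gamma u -> `|u - u0| < e] by apply: filterS3 n1 n2 n3.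
have cg := continuous_crd_gamma HM HJ Ju al dl.
have r20 : 0 < rho / 2 by rewrite divr_gt0.
have /nbhs_normP[eta /= eta0 etaP] : \forall u \near u0, `|crd l (gamma u) - z0| < rho / 2.
  by have /cvgr_distC_lt/(_ _ r20) := cg; exact.
(* The box is thin in the i-th coordinate: by the slope bound its axis points have parameters within
   [eta] of u0, hence coordinates within rho / 2 of [z0], while the paths below escape to a
   displacement of 3/4 rho. *)
pose ri := Num.min rho (c * eta).
have ri0 : 0 < ri by rewrite lt_min rho0 mulr_gt0.
have [ri1 ri2] : ri <= rho /\ ri <= c * eta by split; rewrite ge_min lexx ?orbT.
pose Q z := `|z 0 i - z0 0 i| < ri /\ forall j, `|z 0 j - z0 0 j| < rho.
have Qball z : Q z -> `|z0 - z| < rho.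
  move=> [_ h]; rewrite distrC; apply: mx_norm_lt => // a j; rewrite ord1 !mxE; exact: h.
have convQ z w t : Q z -> Q w -> 0 <= t <= 1 -> Q (z + t *: (w - z)).
  have E j : (z + t *: (w - z)) 0 j - z0 0 j =
    (z 0 j - z0 0 j) + t * ((w 0 j - z0 0 j) - (z 0 j - z0 0 j)) by rewrite !mxE; ring.
  by move=> [a1 a2] [b1 b2] ht; split=> [|j]; rewrite E; apply: segment_abs_lt.
pose P : 'rV[R]_4 := z0 + (3 / 4 * rho) *: (delta_mx 0 j1 + delta_mx 0 j2).
have Pj j : P 0 j - z0 0 j = 3 / 4 * rho * ((j == j1)%:R + (j == j2)%:R).
  by rewrite !mxE eqxx /=; ring.
have QP : Q P.
  split=> [|j]; rewrite Pj; first by rewrite eq_sym (negbTE j1i) eq_sym (negbTE j2i) addr0 mulr0 normr0.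
  have [->|_] := eqVneq j j1; first by rewrite (negbTE j12) addr0 mulr1 ger0_norm; lra.
  by case: (j == j2); rewrite add0r ?mulr1 ?mulr0 ?normr0 // ger0_norm; lra.
exists P.
have m1 : \forall q \near gamma u0, dom l q by apply: open_nbhs_at => //; exact: (open_dom HM al).
have m2 : \forall q \near gamma u0, `|crd l q - z0| < ri.
  by have /cvgr_distC_lt/(_ ri ri0) := cts_crd HM al dl; exact.
apply: filterS2 m1 m2 => q dq qz qax; split=> //; set z := crd l q.
have Qz : Q z.
  have h j : `|z 0 j - z0 0 j| < ri.
    have -> : z 0 j - z0 0 j = (z - z0) 0 j by rewrite !mxE.
    exact: le_lt_trans (le_mx_entry _ _ _) qz.
  by split=> // j; apply: lt_le_trans (h j) ri1.
have axis_crd w u : img l w -> par l w = gamma u -> w = crd l (gamma u).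
  by move=> iy <-; rewrite (parK HM al).
(* If both lines met the axis, their common i-th coordinate would make the two axis points equal;
   lines of different directions through z meet only at z, so q would lie on the axis. *)
have [j [jj jP]] : exists j, (j = j1 \/ j = j2) /\
    forall t u, `|u - u0| < e -> z + t *: delta_mx 0 j != crd l (gamma u).
  apply: contrapT => H.
  have bad j : j = j1 \/ j = j2 -> exists t u, `|u - u0| < e /\ z + t *: delta_mx 0 j = crd l (gamma u).
    move=> jj; apply: contrapT => H'; apply: H; exists j; split=> // t u ue.
    by apply/eqP => E; apply: H'; exists t, u.
  have [t1 [u1 [h1 E1]]] := bad j1 (or_introl erefl).
  have [t2 [u2 [h2 E2]]] := bad j2 (or_intror erefl).
  have zi u t j : j != i -> z + t *: delta_mx 0 j = crd l (gamma u) -> coord l gamma i u = z 0 i.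
    by move=> ji E; rewrite /coord -E !mxE eqxx eq_sym (negbTE ji) mulr0 addr0.
  have := slope u1 u2 h1 h2; rewrite (zi _ _ _ j1i E1) (zi _ _ _ j2i E2) subrr normr0.
  rewrite pmulr_rle0 // normr_le0 subr_eq0 => /eqP u12.
  have := E2; rewrite -u12 -E1 => /addrI /(congr1 (fun v : 'rV[R]_4 => v 0 j1)).
  rewrite !mxE !eqxx (negbTE j12) mulr0 mulr1 => t10.
  apply: qax; have zE : z = crd l (gamma u1) by rewrite -E1 -t10 scale0r addr0.
  have [Ju1 du1] := ge u1 h1.
  by exists u1 => //; rewrite -(crdK HM al du1) -zE (crdK HM al dq).
have ji : j != i by case: jj => ->.
pose tau := z0 0 j + 3 / 4 * rho - z 0 j.
pose w := z + tau *: delta_mx 0 j.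
have wj : w 0 j = z0 0 j + 3 / 4 * rho by rewrite !mxE !eqxx mulr1 /tau; ring.
have wn m : m != j -> w 0 m = z 0 m by move=> mj; rewrite !mxE eqxx (negbTE mj) mulr0 addr0.
have Qw : Q w.
  case: Qz => qi qn; split=> [|m]; first by rewrite wn // eq_sym.
  have [->|mj] := eqVneq m j; last by rewrite wn.
  have -> : w 0 j - z0 0 j = 3 / 4 * rho by rewrite wj; ring.
  by rewrite ger0_norm; lra.
exists w; split=> t ht.
  have [iy Wy ey] := rhoP _ (Qball _ (convQ _ _ _ Qz Qw ht)).
  split; first exact: iy.
  split; first exact: Wy.
  move=> [u Ju' E]; have := ey u Ju' (esym E) => ue.
  have [_ du] := ge u ue.
  have := jP (t * tau) u ue; rewrite E (parK HM al iy) /w.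
  by rewrite addrAC subrr add0r scalerA eqxx.
have [iy Wy ey] := rhoP _ (Qball _ (convQ _ _ _ Qw QP ht)).
split; first exact: iy.
split; first exact: Wy.
move=> [u Ju' E]; have := ey u Ju' (esym E) => ue.
have yE := axis_crd _ u iy (esym E).
have [yi _] := convQ _ _ _ Qw QP ht.
have : `|u - u0| < eta.
  have u00 : `|u0 - u0| < e by rewrite subrr normr0.
  have := slope u u0 ue u00.
  rewrite /coord -yE => h; have := le_lt_trans h yi.
  by move=> /lt_le_trans/(_ ri2); rewrite ltr_pM2l.
move=> ueta; have := etaP u; rewrite /= distrC => /(_ ueta) h.
have := le_lt_trans (le_mx_entry _ 0 j) h; rewrite -yE.
have PJ : P 0 j = z0 0 j + 3 / 4 * rho.
  rewrite -[P 0 j](subrK (z0 0 j)) Pj addrC; congr (_ + _).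
  by case: jj => ->; rewrite eqxx ?(negbTE j12) ?[j2 == j1]eq_sym ?(negbTE j12) ?addr0 ?add0r mulr1.
have -> : (w + t *: (P - w) - z0) 0 j = 3 / 4 * rho.
  have -> : (w + t *: (P - w) - z0) 0 j = w 0 j + t * (P 0 j - w 0 j) - z0 0 j.
    by clearbody w P z0; rewrite !mxE.
  by rewrite wj PJ; clearbody z0; ring.
rewrite ger0_norm; lra.
Qed.

End AxisComplement.

Section NearAxis.
Context {R : realType} {M : spacetime R} (HM : is_spacetime M) (GH : globally_hyperbolic M).
Context (J : set R) (gamma : R -> M) (HJ : worldline J gamma).
Context (rot : 'M[R]_3 -> M -> M) (k : chart R M) (A r : R -> R -> R) (smax : R -> \bar R).
Context (HR : retarded_coordinates J gamma rot k A r smax).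
Implicit Types (x y q : M) (n p : 'rV[R]_3) (u s : R).
Local Notation dom := Defs.dom.

Let ak : atlas M k := ret_atlas HR.

Let radius q : R := enorm (pcoord (crd k q)).
Let time q : R := ucoord (crd k q).

(** The openness of the chart image acts as lower semicontinuity of [smax]. *)
Lemma smax_room u0 : J u0 -> exists2 d, 0 < d &
  forall u, `|u - u0| <= d -> J u /\ (d%:E < smax u)%E.
Proof.
move=> Ju; have [b b0 bs] := smax_ge HR Ju.
pose n : 'rV[R]_3 := direction 0 0; pose s := b / 2.
have n1 : unit_sphere n by exact: unit_direction.
have s0 : 0 < s by rewrite divr_gt0.
have sm : (s%:E < smax u0)%E by apply: lt_le_trans bs; rewrite lte_fin /s; lra.
have iz := ret_imgP HR Ju n1 s0 sm.
have cu : {for u0, continuous (fun u => upoint u (s *: n))}.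
  by apply: continuous_upoint; [exact: cvg_id|exact: cst_continuous].
have nn : \forall u \near u0, img k (upoint u (s *: n)).
  by apply: cu; apply: open_nbhs_at => //; exact: (open_img HM ak).
have /nbhs_normP[e /= e0 eP] := nn.
pose d := Num.min e s / 2.
have m0 : 0 < Num.min e s by rewrite lt_min e0.
have : d < Num.min e s by rewrite /d; lra.
rewrite lt_min => /andP[de ds].
exists d; first by rewrite divr_gt0.
move=> u ud; have [|Ju' [_ h]] := (img_upoint HR _ _).1 (eP u _).
  by rewrite /= distrC; exact: le_lt_trans ud de.
split=> //; apply: lt_trans h; rewrite enorm_unit ?(ltW s0) // lte_fin.
Qed.

Lemma continuous_radius q : dom k q -> {for q, continuous radius}.
Proof.
move=> dq; have cc := cts_crd HM ak dq.
have c1 := @continuous_comp _ _ _ (crd k) (@pcoord R) q cc (@continuous_pcoord R _).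
exact: (@continuous_comp _ _ _ (fun q => pcoord (crd k q)) (@enorm R 3) q c1 (@continuous_enorm R 3 _)).
Qed.

Lemma continuous_time q : dom k q -> {for q, continuous time}.
Proof.
move=> dq; have cc := cts_crd HM ak dq.
exact: (@continuous_comp _ _ _ (crd k) (@ucoord R) q cc (@continuous_ucoord R _)).
Qed.

(** The sup norm of (u - u0, s): its spheres are boxes, whose faces u = u0 + d, u = u0 - d and s = d
    can be treated by separate arguments. *)
Let size u0 q : R := Num.max `|time q - u0| (radius q).

(* Near gamma u0 the points with retarded distance in [a, d] are excluded by
   compactness, and the other faces of the box by causality. *)
Lemma size_avoids u0 d : J u0 -> 0 < d ->
  (forall u, `|u - u0| <= d -> J u /\ (d%:E < smax u)%E) ->
  \forall q \near gamma u0, dom k q -> size u0 q <> d.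
Proof.
move=> Ju d0 room.
have absE (t : R) : `|t| <= d -> - d <= t <= d by rewrite ler_norml.
have d20 : 0 < d / 2 by rewrite divr_gt0.
have Jh (t : R) : `|t| <= d -> J (u0 + t).
  by move=> ht; apply: (room _ _).1; rewrite addrC addKr.
have Jp : J (u0 + d) by apply: Jh; rewrite gtr0_norm.
have Jm : J (u0 - d) by apply: Jh; rewrite normrN gtr0_norm.
have Jp2 : J (u0 + d / 2) by apply: Jh; rewrite gtr0_norm; lra.
have Jm2 : J (u0 - d / 2) by apply: Jh; rewrite normrN gtr0_norm; lra.
have mlt : u0 - d < u0 - d / 2 by lra.
(* At distances up to [sg], the points with u = u0 - d lie in the past of gamma (u0 - d/2); this
   handles the lower face of the box. *)
have [sg sg0 sgP] := ret_le_gamma HM HJ HR Jm Jm2 mlt.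
pose a := Num.min sg d.
have a0 : 0 < a by rewrite lt_min sg0.
have ad : a <= d by rewrite ge_min lexx orbT.
pose K : set 'rV[R]_4 := [set z | `|ucoord z - u0| <= d /\ a <= enorm (pcoord z) <= d].
have Kk : K `<=` img k.
  move=> z [zu /andP[za zd]]; apply/(ret_img HR z).
  have [Jz zm] := room _ zu; split=> //; split.
    move=> p0; move: za; rewrite p0 leNgt (_ : enorm 0 = 0) ?a0 //.
    by rewrite /enorm big1 ?sqrtr0 // => i _; rewrite mxE expr0n.
  by apply: le_lt_trans zm; rewrite lee_fin.
have cK : compact K.
  have -> : K = (@ucoord R @^-1` [set t | `|t - u0| <= d]) `&`
      (@pcoord R @^-1` [set p | a <= enorm p <= d]) by [].
  apply: (@subclosed_compact _ _ [set v : 'rV[R]_4 | forall i, `|v 0 i| <= `|u0| + d]).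
  - apply: closedI; apply: closed_comp.
    + by move=> z _; exact: continuous_ucoord.
    + have -> : [set t : R | `|t - u0| <= d] = closed_ball_ Num.norm u0 d.
        by apply/seteqP; split=> t /=; rewrite distrC.
      exact: closed_closed_ball_.
    + by move=> z _; exact: continuous_pcoord.
    + by apply: compact_closed; [exact: norm_hausdorff|exact: compact_shell].
  - exact: compact_box.
  - move=> z /= [zu /andP[_ zd]] i; case: (unliftP ord0 i) => [j ->|->].
      by rewrite -pcoordE; have := enorm_coord (pcoord z) j; have := normr_ge0 u0; lra.
    rewrite -ucoordE -[ucoord z](subrK u0); apply: le_trans (ler_normD _ _) _; lra.
have near1 : \forall q \near gamma u0, ~ (par k @` K) q.
  apply: open_nbhs_at; last first.
    by move=> [z /Kk iz zE]; apply: (ret_axis HR Ju); rewrite -zE; exact: (img_par HM ak).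
  rewrite openC; apply: compact_closed; first exact: st_hausdorff HM.
  exact: (compact_par_image HM ak cK Kk).
have [u1 [Ju1 a1 b1 near2]] := future_nbhd HM HJ Ju d20.
have [u2 [Ju2 a2 b2 near3]] := past_nbhd HM HJ Ju d20.
apply: filterS3 near1 near2 near3 => q q1 q2 q3 dq mq.
have [n [Jq n1 r0 rm qE]] := domP HM HR dq.
rewrite -/(radius q) -/(time q) in Jq r0 rm qE.
have tq : `|time q - u0| <= d by rewrite -mq /size le_max lexx.
have rq : radius q <= d by rewrite -mq /size le_max lexx orbT.
have ra : radius q < a.
  rewrite ltNge; apply/negP => ar; apply: q1; exists (crd k q); last by rewrite (crdK HM ak dq).
  by split=> //; rewrite -/(radius q) ar.
have tE : `|time q - u0| = d.
  move: mq; rewrite /size; case: ltP => // _ E.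
  by move: ra; rewrite E ltNge ad.
have [tE'|tE'] : time q = u0 + d \/ time q = u0 - d.
- have [h|h] := leP 0 (time q - u0).
    by left; move: tE; rewrite ger0_norm //; lra.
  by right; move: tE; rewrite ltr0_norm //; lra.
(* On the face u = u0 + d the point lies after gamma (u0 + d/2), whereas neighbours of [gamma u0]
   lie before [gamma u1], where u1 < u0 + d/2. The other face is the time reverse. *)
- have lt1 : u0 + d / 2 < time q by rewrite tE'; lra.
  have h1 := gamma_le_ret HM HJ HR Jq Jp2 lt1 n1 r0 rm.
  apply: (gamma_not_ge HM HJ GH Ju1 Jp2); first lra.
  by apply: causal_le_trans q2; rewrite qE.
- have rsg : radius q <= sg by apply: ltW; apply: lt_le_trans ra _; rewrite ge_min lexx.
  have h1 := sgP n (radius q) n1 r0 rsg; rewrite -tE' -qE in h1.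
  apply: (gamma_not_ge HM HJ GH Jm2 Ju2); first lra.
  by apply: causal_le_trans q3 (h1 rm).
Qed.

(* The complement of the axis is connected near gamma u0, so size u0, which is
   small at some of its points and avoids d, stays below d. *)
Lemma time_near_axis u0 e : J u0 -> 0 < e ->
  \forall q \near gamma u0, dom k q -> `|ucoord (crd k q) - u0| < e.
Proof.
move=> Ju e0; have [d1 d10 room1] := smax_room Ju.
pose d := Num.min d1 e.
have d0 : 0 < d by rewrite lt_min d10.
have [dd1 de] : d <= d1 /\ d <= e by split; rewrite ge_min lexx ?orbT.
have room u : `|u - u0| <= d -> J u /\ (d%:E < smax u)%E.
  move=> ud; have [Ju' sm] := room1 u (le_trans ud dd1); split=> //.
  by apply: le_lt_trans sm; rewrite lee_fin.
have near1 := size_avoids Ju d0 room.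
have near2 : \forall q \near gamma u0, ret_region k J gamma q.
  by apply: open_nbhs_at; [exact: ret_open HR|right; exists u0].
have [l al dl] := st_cover HM (gamma u0).
pose W : set M := [set q | (dom k q -> size u0 q <> d) /\ ret_region k J gamma q].
have nW : nbhs (gamma u0) W by apply: filterS2 near1 near2 => q; split.
have [P nP] := axis_complement_connected HM HJ GH Ju al dl nW.
have WD q : (W `\` gamma @` J) q -> dom k q /\ size u0 q <> d.
  by move=> [[h1 [dq|//]] _]; split=> //; exact: h1.
(* Off the axis [size] is continuous, and along the segment it avoids d, so by the intermediate
   value theorem a segment cannot change sides. *)
have seg z w : segment_in l (W `\` gamma @` J) z w ->
    (size u0 (par l z) < d) = (size u0 (par l w) < d).
  move=> H; pose g (t : R) := size u0 (par l (z + t *: (w - z))) - d.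
  have cg t : 0 <= t <= 1 -> {for t, continuous g}.
    move=> ht; have [it /WD[dt _]] := H t ht.
    have cp : {for t, continuous (fun t : R => par l (z + t *: (w - z)))}.
      apply: (@continuous_comp _ _ _ (fun t : R => z + t *: (w - z)) (par l)).
        exact: continuous_line.
      exact: (cts_par HM al it).
    pose tm (t : R) := time (par l (z + t *: (w - z))).
    pose rd (t : R) := radius (par l (z + t *: (w - z))).
    have c1 : {for t, continuous tm} by exact: (continuous_comp cp (continuous_time dt)).
    have c2 : {for t, continuous rd} by exact: (continuous_comp cp (continuous_radius dt)).
    have cu : {for t, continuous (fun _ : R => u0)} by exact: cst_continuous.
    have cd : {for t, continuous (fun _ : R => d)} by exact: cst_continuous.
    have c3 : {for t, continuous (fun t => `|tm t - u0|)}.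
      have c3' := continuous_at_sub c1 cu.
      exact: (continuous_comp c3' (@norm_continuous _ _ _)).
    have c4 := @continuous_max _ _ _ _ t c3 c2.
    exact: (continuous_at_sub c4 cd).
  have g0E : g 0 = size u0 (par l z) - d by rewrite /g scale0r addr0.
  have g1E : g 1 = size u0 (par l w) - d by rewrite /g scale1r subrKC.
  have g_neq t : 0 <= t <= 1 -> g t <> 0.
    by move=> /H[_ /WD[_ ne]] /eqP; rewrite subr_eq0 => /eqP.
  have [h0|h0] := ltP (size u0 (par l z)) d; have [h1|h1] := ltP (size u0 (par l w)) d => //.
    have [||t ht gt] := ivt_zero ler01 cg; rewrite ?g0E ?g1E; first lra.
      lra.
    by have := g_neq t ht.
  have cg' t : 0 <= t <= 1 -> {for t, continuous (fun t => - g t)}.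
    by move=> /cg; exact: continuous_at_opp.
  have [||t ht gt] := ivt_zero ler01 cg'; rewrite ?g0E ?g1E; first lra.
    lra.
  by have := g_neq t ht; move: gt => /eqP; rewrite oppr_eq0 => /eqP.
have offaxis q : dom k q -> ~ (gamma @` J) q by move=> dq [u Ju' E]; apply: (ret_axis HR Ju'); rewrite E.
have conn q : dom k q -> (~ (gamma @` J) q -> dom l q /\ exists w,
    segment_in l (W `\` gamma @` J) (crd l q) w /\ segment_in l (W `\` gamma @` J) w P) ->
    (size u0 q < d) = (size u0 (par l P) < d).
  by move=> /offaxis dq /(_ dq)[dlq [w [/seg + /seg]]]; rewrite (crdK HM al dlq) => -> ->.
have n1 : unit_sphere (direction 0 0 : 'rV[R]_3) by exact: unit_direction.
(* A point of a ray close to the tip has size s < d. It is connected to [P], which puts [P], and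
   with it every nearby point off the axis, on the inner side. *)
have [d2 d20 d2P] := ray_tip HR Ju n1 nP.
pose s := Num.min d2 d / 2.
have m0 : 0 < Num.min d2 d by rewrite lt_min d20.
have s0 : 0 < s by rewrite divr_gt0.
have : s < Num.min d2 d by rewrite /s; lra.
rewrite lt_min => /andP[sd2 sd].
have u00 : `|u0 - u0| <= d by rewrite subrr normr0 ltW.
have sm : (s%:E < smax u0)%E.
  by have [_] := room u0 u00; apply: lt_trans; rewrite lte_fin.
have db := ret_dom HM HR Ju n1 s0 sm.
have := conn _ db (d2P s s0 sd2 sm).
rewrite {1}/size /time /radius (ret_crd HM HR Ju n1 s0 sm) ucoord_upoint pcoord_upoint.
rewrite subrr normr0 enorm_unit ?(ltW s0) // max_r ?(ltW s0) // sd => /esym PE.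
apply: filterS nP => q hq dq; have := conn q dq hq; rewrite PE /size gt_max => /andP[+ _].
by move=> h; apply: lt_le_trans h de.
Qed.

End NearAxis.

Lemma derive_ge0_le {R : realType} (f df : R -> R) (a b : R) : a <= b ->
  (forall t : R, a <= t <= b -> is_derive t 1 f (df t) /\ 0 <= df t) -> f a <= f b.
Proof.
move=> ab H; have oc t : t \in `]a, b[ -> a <= t <= b.
  by rewrite in_itv /= => /andP[h1 h2]; rewrite !ltW.
apply: (@ger0_derive1_ndecr R f a b) => //.
- by move=> t /oc /H[[]].
- by move=> t /oc /H[h1 h2]; rewrite derive1E; have [_ ->] := h1.
- apply: continuous_in_subspaceT => t; rewrite inE /= in_itv /= => /H[[h1 _] _].
  by apply: differentiable_continuous; apply/derivable1_diffP.
Qed.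

(** * The retarded solution on the cone *)

Section RetardedSupport.
Context {R : realType} {M : spacetime R} (HM : is_spacetime M) (GH : globally_hyperbolic M).
Context (J : set R) (gamma : R -> M) (HJ : worldline J gamma).
Context (rot : 'M[R]_3 -> M -> M) (k : chart R M) (A r : R -> R -> R) (smax : R -> \bar R).
Context (HR : retarded_coordinates J gamma rot k A r smax).
Implicit Types (x y q : M) (n p : 'rV[R]_3) (u s : R).
Local Notation dom := Defs.dom.
Local Notation coord := Defs.coord.
Local Notation C0 := (light_cone k gamma smax).

Let ak : atlas M k := ret_atlas HR.
Let J0 : J 0 := wl_zero HJ.

(** du(v) is minus the product of [v] with the future null vector ds, and two future causal vectors
    have a nonpositive product. *)
Lemma future_causal_du x (v : 'rV[R]_4) : dom k x -> future_causal k x v -> 0 <= v 0 ord0.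
Proof.
move=> dx fv; have [n [Ju n1 s0 sm xE]] := domP HM HR dx.
have := ray_future HM HR Ju n1 s0 sm; rewrite -xE => fd.
have := future_causal_le0 HM ak dx fd fv.
by rewrite {1}xE (ip_ds HM HR _ Ju n1 s0 sm) oppr_le0.
Qed.

(** For u < 0 the later point gamma (u/2) still precedes every point of the cone other than the tip,
    so finding [gamma u] after the cone would close a causal loop. *)
Lemma cone_axis_ge0 u : J u -> Jplus C0 (gamma u) -> 0 <= u.
Proof.
move=> Ju [x [->|[s [s0 sm [n n1 ->]]]] le]; rewrite leNgt; apply/negP => u0.
  exact: (gamma_not_ge HM HJ GH Ju J0 u0 le).
have Ju2 : J (u / 2).
  by apply: ((wl_interval HJ).2 _ _ Ju J0); apply/andP; split; lra.
have u20 : u / 2 < 0 by lra.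
have h := gamma_le_ret HM HJ HR J0 Ju2 u20 n1 s0 sm.
apply: (gamma_not_ge HM HJ GH Ju Ju2); first lra.
exact: causal_le_trans h le.
Qed.

(** Vacuous on the axis, where the chart gives no retarded time. *)
Definition after_cone y := dom k y -> 0 <= ucoord (crd k y).

(** Off the axis u does not decrease along the curve. If the curve leaves the chart, the last
    parameter m at which it does so is an axis point with u >= 0, and just after m the retarded time
    is close to that value, so the endpoint cannot have negative u. *)
Lemma after_cone_segment x y : causal_segment x y -> Jplus C0 x ->
  (forall q, causal_le x q -> causal_le q y -> ret_region k J gamma q) ->
  after_cone x -> after_cone y.
Proof.
move=> [c [a [b [a0 [b0 [[a0a ab bb0 ca cb] H]]]]]] Cx reg ix dy.
have le1 t : a <= t -> t <= b -> causal_le x (c t).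
  rewrite le_eqVlt => /predU1P[<-|at' tb]; first by rewrite ca => _; exact: causal_le_refl.
  by apply: causal_segment_le; exists c, a, t, a0, b0; split=> //; split=> //; apply: le_lt_trans bb0.
have le2 t : a <= t -> t <= b -> causal_le (c t) y.
  move=> at'; rewrite le_eqVlt => /predU1P[->|tb]; first by rewrite cb; exact: causal_le_refl.
  by apply: causal_segment_le; exists c, t, b, a0, b0; split=> //; split=> //; apply: lt_le_trans at'.
have cc t : a <= t -> t <= b -> {for t, continuous c}.
  by move=> at' tb; have [|//] := H t; rewrite (lt_le_trans a0a at') (le_lt_trans tb bb0).
pose phi := coord k c ord0.
have phiE t : phi t = ucoord (crd k (c t)) by rewrite ucoordE.
have dphi t : a <= t -> t <= b -> dom k (c t) ->
    is_derive t 1 phi (velocity k c t 0 ord0) /\ 0 <= velocity k c t 0 ord0.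
  move=> at' tb dt; have [|_ /(_ k ak dt)[dv fv]] := H t.
    by rewrite (lt_le_trans a0a at') (le_lt_trans tb bb0).
  split; last exact: (future_causal_du dt).
  by rewrite mxE derive1E; have [h _] := dv ord0; exact: DeriveDef.
have mono t : a <= t -> t <= b -> (forall s, t <= s <= b -> dom k (c s)) -> phi t <= phi b.
  move=> at' tb hd; apply: (derive_ge0_le (df := fun t => velocity k c t 0 ord0)) => // s hs.
  have := hd s hs; move: hs => /andP[ts sb] ds.
  exact: dphi (le_trans at' ts) sb ds.
rewrite leNgt; apply/negP; rewrite -cb -phiE => neg.
pose E := [set t | a <= t <= b /\ ~ dom k (c t)].
have [E0|En0] := pselect (forall t, ~ E t).
  have hd s : a <= s <= b -> dom k (c s) by move=> hs; apply: contrapT => nd; apply: (E0 s).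
  have aa : a <= a <= b by rewrite lexx ltW.
  have := ix; rewrite /after_cone -ca -phiE => /(_ (hd a aa)).
  have := mono a (lexx a) (ltW ab) hd; lra.
have [t0 Et0] : exists t, E t by apply: contrapT => /forallNP.
have hs : has_sup E.
  by split; [exists t0|exists b => t [/andP[_ tb] _]].
pose m := sup E.
have ubm t : E t -> t <= m by move=> Et; exact: (sup_upper_bound hs).
have mb : m <= b by apply: sup_le_ub; [exists t0|move=> t [/andP[]]].
have am : a <= m by have [/andP[at0 _] _] := Et0; apply: le_trans at0 (ubm _ Et0).
have cm := cc m am mb.
have nm : ~ dom k (c m).
  move=> dm; have : \forall t \near m, dom k (c t).
    by apply: cm; apply: open_nbhs_at => //; exact: (open_dom HM ak).
  move=> /nbhs_normP[e /= e0 eP].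
  have [t Et mt] := sup_adherent e0 hs.
  have [_ ndt] := Et; apply: ndt; apply: eP => /=.
  by have := ubm _ Et; rewrite -/m in mt *; move=> ?; rewrite ger0_norm; lra.
have mb' : m < b.
  by rewrite lt_neqAle mb andbT; apply/eqP => mE; apply: nm; rewrite mE cb.
have hd t : m < t -> t <= b -> dom k (c t).
  move=> mt tb; apply: contrapT => nd; have Et : E t by split=> //; rewrite tb andbT ltW // (le_lt_trans am).
  by have := ubm t Et; rewrite leNgt mt.
have [//|[u Ju uE]] := reg _ (le1 m am mb) (le2 m am mb).
have u0 : 0 <= u.
  apply: cone_axis_ge0 => //; rewrite uE; have [x0 Cx0 h] := Cx; exists x0 => //.
  exact: causal_le_trans h (le1 m am mb).
(* With the tolerance - phi b, just after the crossing phi exceeds phi b, against monotonicity. *)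
have nb0 : 0 < - phi b by lra.
have := time_near_axis HM GH HJ HR Ju nb0; rewrite uE => nt.
have /nbhs_normP[e /= e0 eP] := cm _ nt.
pose t := m + Num.min e (b - m) / 2.
have p0 : 0 < Num.min e (b - m) by rewrite lt_min e0; lra.
have [p1 p2] : Num.min e (b - m) <= e /\ Num.min e (b - m) <= b - m by split; rewrite ge_min lexx ?orbT.
have mt : m < t by rewrite /t; lra.
have tb : t <= b by rewrite /t; lra.
have tm : `|m - t| < e by rewrite distrC gtr0_norm /t; lra.
have := eP t tm (hd t mt tb); rewrite -phiE.
have hd' s : t <= s <= b -> dom k (c s).
  by move=> /andP[ts sb]; apply: hd => //; exact: lt_le_trans mt ts.
have at' : a <= t by lra.
have := mono t at' tb hd'.
by move=> h1; rewrite ltr_norml => /andP[h2 h3]; lra.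
Qed.

Context (Reg : Jplus C0 `&` Jminus C0 `<=` ret_region k J gamma).

(** Induction over the chain of causal segments: intermediate points lie after the start and before
    the end, hence in the region covered by the retarded coordinates. *)
Lemma after_coneP z : Jplus C0 z -> Jminus C0 z -> after_cone z.
Proof.
move=> [x Cx le].
have ix : after_cone x.
  case: Cx => [->|[s [s0 sm [n n1 ->]]]]; first by move=> /(ret_axis HR J0).
  by move=> _; rewrite (ret_crd HM HR J0 n1 s0 sm) ucoord_upoint.
have Cx' : Jplus C0 x by exists x => //; exact: causal_le_refl.
move: le Cx' ix; clear Cx; elim=> {x z}[x z seg|x|x y z xy IH1 yz IH2] Cx ix Cz //.
  apply: (after_cone_segment seg Cx _ ix) => q xq qz; apply: Reg; split.
    by have [x0 Cx0 h] := Cx; exists x0 => //; exact: causal_le_trans h xq.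
  by have [x0 Cx0 h] := Cz; exists x0 => //; exact: causal_le_trans qz h.
apply: IH2 => //.
  by have [x0 Cx0 h] := Cx; exists x0 => //; exact: causal_le_trans h xy.
apply: IH1 => //.
by have [x0 Cx0 h] := Cz; exists x0 => //; exact: causal_le_trans yz h.
Qed.

(* A nonzero value at a point of the cone would persist slightly to its
   past, where the retarded time is negative; but the retarded time cannot
   become negative in the causal future of the cone. *)
Lemma retarded_cone0 E f s n : fundamental_solution (@Jplus R M) E -> test f ->
  supp f `<=` Jplus C0 -> unit_sphere n -> 0 < s -> (s%:E < smax 0)%E ->
  E f (retpoint k 0 s n) = 0.
Proof.
move=> HE tf fC n1 s0 sm; apply/eqP; apply: contrapT => /negP ne.
set x := retpoint k 0 s n in ne *; set g := E f in ne *.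
have dx : dom k x := ret_dom HM HR J0 n1 s0 sm.
have Cx : C0 x by right; exists s; split=> //; exists n.
have [fd1 fd2] := ray_future HM HR J0 n1 s0 sm.
rewrite (ip_ds HM HR _ J0 n1 s0 sm) -/x oppr_lt0 in fd2.
(* The product of ds with [tdir] is negative, so du(v) > 0, and a step along - v makes u negative, u
   being 0 on the cone. *)
set v := tdir k x in fd2.
have iz := img_crd dx; set z0 := crd k x in iz.
have p0 : par k z0 = x by rewrite (crdK HM ak dx).
have v1 : ip k (par k z0) v v < 0 by rewrite p0; exact: (st_tdir_timelike HM ak dx).
have v2 : ip k (par k z0) v (tdir k (par k z0)) < 0 by rewrite p0; exact: (st_tdir_timelike HM ak dx).
have [rd rd0 seg] := segment_near HM ak iz v1 v2.
have gc : {for par k z0, continuous g}.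
  by rewrite p0; exact: (smooth_continuous HM (x := x) (fs_smooth HE tf)).
have ct : {for 0, continuous (fun t : R => z0 + t *: - v)} by exact: continuous_line.
have iz0 : img k (z0 + 0 *: - v) by rewrite scale0r addr0.
have cp : {for 0, continuous (fun t : R => par k (z0 + t *: - v))}.
  exact: (continuous_comp ct (cts_par HM ak iz0)).
have gc' : {for par k (z0 + 0 *: - v), continuous g} by rewrite scale0r addr0.
have cgt : {for 0, continuous (fun t : R => g (par k (z0 + t *: - v)))}.
  exact: (continuous_comp cp gc').
have near1 : \forall t \near (0 : R), g (par k (z0 + t *: - v)) != 0.
  have : \forall y \near g (par k (z0 + 0 *: - v)), y != 0.
    by apply: open_nbhs_at; [exact: open_neq|rewrite scale0r addr0 p0].
  exact: cgt.
have near2 : \forall t \near (0 : R), img k (z0 + t *: - v).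
  by apply: ct; apply: open_nbhs_at => //; exact: (open_img HM ak).
have near3 : \forall t \near (0 : R), `|z0 + t *: - v - z0| < rd.
  have /cvgr_distC_lt/(_ rd rd0) := ct; rewrite scale0r addr0; exact.
have /nbhs_normP[e /= e0 eP] : \forall t \near (0 : R), [/\ g (par k (z0 + t *: - v)) != 0,
    img k (z0 + t *: - v) & `|z0 + t *: - v - z0| < rd] by apply: filterS3 near1 near2 near3.
have [|h1 h2 h3] := eP (e / 2); first by rewrite /= sub0r normrN gtr0_norm; lra.
set z := z0 + (e / 2) *: - v in h1 h2 h3.
have e20 : 0 < e / 2 by rewrite divr_gt0.
have le : causal_le (par k z) x.
  rewrite -p0; apply: causal_segment_le; apply: (seg z z0 (e / 2) e20 h3); first by rewrite subrr normr0.
  by rewrite /z scalerN opprD addNKr opprK scalerK ?lt0r_neq0 // subrr normr0.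
have [y sy yz] := fs_supp HE tf h1.
have [x0 Cx0 x0y] := fC y sy.
have := after_coneP (z := par k z).
move=> /(_ _)/wrap[|/(_ _)/wrap[|/(_ (img_par HM ak h2))]].
- by exists x0 => //; exact: causal_le_trans x0y yz.
- by exists x.
rewrite (parK HM ak h2) ucoordE /z mxE [X in _ + X]mxE [X in _ * X]mxE.
rewrite -ucoordE /z0 (ret_crd HM HR J0 n1 s0 sm) ucoord_upoint.
have := mulr_gt0 e20 fd2; lra.
Qed.

End RetardedSupport.

(** * Norms on the cone *)

Section NonnegativeIntegral.
Import HBNNSimple.
Context (d : measure_display) (T : measurableType d) (R : realType) (mu : {measure set T -> \bar R}).
Local Open Scope ereal_scope.

(* No measurability is needed, as the integral of a nonnegative function is a
   supremum over simple functions. *)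
Lemma nn_integral_le (D E : set T) (f g : T -> \bar R) :
  (forall x, D x -> 0 <= f x) -> (forall x, E x -> 0 <= g x) ->
  (forall x, D x -> f x = 0 \/ (E x /\ f x <= g x)) ->
  \int[mu]_(x in D) f x <= \int[mu]_(x in E) g x.
Proof.
move=> f0 g0 fg; rewrite !ge0_integralE //; apply: ereal_sup_le => _ [h hf <-].
exists h => // x; apply: le_trans (hf x) _; rewrite !patchE.
have [Dx|_] := boolP (x \in D); last by case: ifPn => // /set_mem /g0.
have [->|[Ex le]] := fg x (set_mem Dx); last by rewrite mem_set.
by case: ifPn => // /set_mem /g0.
Qed.

(** A simple function below c f becomes, divided by c, one below f. Like the preceding comparison
    this serves the angular integrals, whose integrands are not shown to be measurable. *)
Lemma nn_integral_scale_le (D : set T) (f : T -> \bar R) (c : R) : (0 < c)%R ->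
  (forall x, D x -> 0 <= f x) ->
  \int[mu]_(x in D) (c%:E * f x) <= c%:E * \int[mu]_(x in D) f x.
Proof.
move=> c0 f0; have ci : (0 <= c^-1)%R by rewrite invr_ge0 ltW.
have c0' : 0 <= c%:E by rewrite lee_fin ltW.
rewrite [X in X <= _]ge0_integralE; last by move=> x /f0; exact: mule_ge0.
apply: ge_ereal_sup => _ [h hf <-].
have -> : sintegral mu h = c%:E * sintegral mu (scale_nnsfun h ci).
  rewrite [in RHS](_ : (scale_nnsfun h ci : T -> R) = (cst c^-1 \* h)%R) //.
  by rewrite sintegralrM muleA -EFinM mulfV ?gt_eqF // mul1e.
apply: lee_wpmul2l => //; rewrite ge0_integralE //; apply: ereal_sup_ubound.
exists (scale_nnsfun h ci) => // x; have := hf x; rewrite !patchE /=.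
case: ifPn => _ hx; last first.
  by move: hx; rewrite !lee_fin => hx; rewrite mulr_ge0_le0.
by rewrite EFinM lee_pdivrMl.
Qed.

End NonnegativeIntegral.

(** The primitive starts at a' < c and is considered up to b' > e, so that its derivative is
    two-sided at both ends of [c, e]. *)
Lemma antiderivative {R : realType} (g : R -> R) (a b c e : R) :
  a < c -> c < e -> e < b -> (forall t, a < t < b -> {for t, continuous g}) ->
  exists G : R -> R, (forall t : R, c <= t <= e -> is_derive t 1 G (g t)) /\
    (\int[lebesgue_measure]_(t in `[c, e]) (g t)%:E)%E = (G e - G c)%:E.
Proof.
move=> ac ce eb cg; pose a' := (a + c) / 2; pose b' := (e + b) / 2.
have cab t : a' <= t <= b' -> {for t, continuous g}.
  by move=> /andP[h1 h2]; apply: cg; rewrite /a' /b' in h1 h2; apply/andP; split; lra.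
have ig : (@lebesgue_measure R).-integrable `[a', b'] (EFin \o g).
  apply: continuous_compact_integrable; first exact: segment_compact.
  by apply: continuous_in_subspaceT => t; rewrite inE /= in_itv /= => /cab.
pose G x := (\int[lebesgue_measure]_(t in `[a', x]) g t)%R.
have dG t : a' < t -> t < b' -> is_derive t 1 G (g t).
  move=> h1 h2; have [|dd dE] := continuous_FTC1_closed h2 ig h1.
    by apply: cab; rewrite !ltW.
  by apply: DeriveDef; [exact: dd|rewrite -derive1E; exact: dE].
have dG' t : c <= t <= e -> is_derive t 1 G (g t).
  by move=> /andP[h1 h2]; apply: dG; rewrite /a' /b'; lra.
have cG t : c <= t <= e -> {for t, continuous G}.
  by move=> /dG'[dd _]; apply: differentiable_continuous; apply/derivable1_diffP.
exists G; split=> //.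
rewrite (@continuous_FTC2 R g G c e ce) ?EFinB //.
- apply: continuous_in_subspaceT => t; rewrite inE /= in_itv /= => /andP[h1 h2].
  by apply: cab; rewrite /a' /b'; apply/andP; split; lra.
- split.
  + by move=> t; rewrite in_itv /= => /andP[h1 h2]; have [] := dG' t; rewrite ?ltW.
  + by apply: cvg_at_right_filter; apply: cG; rewrite lexx ltW.
  + by apply: cvg_at_left_filter; apply: cG; rewrite lexx ltW.
- move=> t; rewrite in_itv /= => /andP[h1 h2].
  by have [|_] := dG' t; rewrite ?derive1E ?ltW.
Qed.

Section Profile.
Context {R : realType} (S : \bar R) (f df : R -> R) (s2 : R).
Context (deriv : forall s : R, 0 < s -> (s%:E < S)%E ->
  is_derive s 1 f (df s) /\ {for s, continuous df}).
Context (s20 : 0 < s2) (s2S : (s2%:E < S)%E).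
Context (vanish : forall s, s2 <= s -> (s%:E < S)%E -> f s = 0).

Let D : set R := [set s | 0 < s /\ (s%:E < S)%E].
Let P : \bar R := (\int[lebesgue_measure]_(s in D) (df s ^+ 2)%:E)%E.

Let P_ge0 : (0 <= P)%E.
Proof. by apply: integral_ge0 => s _; rewrite lee_fin sqr_ge0. Qed.

Lemma profile_energy_seg c e (G : R -> R) : 0 < c -> (e%:E < S)%E ->
  (\int[lebesgue_measure]_(t in `[c, e]) (df t ^+ 2)%:E)%E = (G e - G c)%:E ->
  ((G e - G c)%:E <= P)%E.
Proof.
move=> c0 eS <-; apply: nn_integral_le => [s _|s _|s]; rewrite ?lee_fin ?sqr_ge0 //.
rewrite /= in_itv /= => /andP[cs se]; right; split=> //; split; first exact: lt_le_trans cs.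
by apply: le_lt_trans eS; rewrite lee_fin.
Qed.

(* Cauchy-Schwarz on [s, s2], as the nonnegativity of the integral of
   ((s2 - s) f' + f s)^2. *)
Lemma profile_sqr s : D s -> ((f s ^+ 2)%:E <= s2%:E * P)%E.
Proof.
move=> [s0 sS]; have [ss2|s2s] := ltP s s2; last first.
  by rewrite vanish // expr0n mule_ge0 // lee_fin ltW.
have [b s2b bS] := ereal_room s2S.
have rng t : s / 2 < t < b -> 0 < t /\ (t%:E < S)%E.
  by move=> /andP[h1 h2]; split; [lra|apply: lt_trans bS; rewrite lte_fin].
have cg t : s / 2 < t < b -> {for t, continuous (fun t => df t ^+ 2)}.
  by move=> /rng[t0 tS]; have [_ c] := deriv t0 tS; exact: (continuous_at_mul c c).
have [|G [dG GE]] := antiderivative _ ss2 s2b cg; first lra.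
pose L := s2 - s.
(* The derivative of [H] is ((s2 - s) f' + f(s))^2. As f(s2) = 0, its growth over [s, s2] says that
   (s2 - s) f(s)^2 is at most (s2 - s)^2 times the energy on the segment. *)
pose H t := L ^+ 2 * G t + (2 * L * f s * f t + f s ^+ 2 * t).
have := @derive_ge0_le _ H (fun t => (L * df t + f s) ^+ 2) s s2 (ltW ss2).
move=> /(_ _)/wrap[t /[dup] ht /andP[h1 h2]|].
  split; last exact: sqr_ge0.
  have [|t0 tS] := rng t; first lra.
  have [d1 _] := deriv t0 tS; have d2 := dG t ht.
  have e1 := is_deriveM (is_derive_cst (L ^+ 2) t (1 : R)) d2.
  have e2 := is_deriveM (is_derive_cst (2 * L * f s) t (1 : R)) d1.
  have e3 := is_deriveM (is_derive_cst (f s ^+ 2) t (1 : R)) (is_derive_id t (1 : R)).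
  have e := is_deriveD e1 (is_deriveD e2 e3).
  by apply: (is_derive_eq e); rewrite !scaler0 !addr0 /cst /GRing.scale /=; ring.
rewrite /H (vanish (lexx _) s2S) => h.
have L0 : 0 < L by rewrite /L; lra.
have GL : f s ^+ 2 <= L * (G s2 - G s).
  rewrite -(ler_pM2l L0).
  have E : L ^+ 2 * (G s2 - G s) - L * f s ^+ 2 =
   L ^+ 2 * G s2 + (2 * L * f s * 0 + f s ^+ 2 * s2) -
    (L ^+ 2 * G s + (2 * L * f s * f s + f s ^+ 2 * s)) by rewrite /L; ring.
  by rewrite [leRHS]mulrA -[L * L]expr2 -subr_ge0 E subr_ge0.
have X0 : 0 <= G s2 - G s by rewrite -(pmulr_rge0 _ L0) (le_trans _ GL) // sqr_ge0.
apply: (@le_trans _ _ (s2%:E * (G s2 - G s)%:E)%E).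
  rewrite -EFinM lee_fin; apply: le_trans GL _; apply: ler_wpM2r => //; rewrite /L; lra.
apply: lee_wpmul2l; first by rewrite lee_fin ltW.
exact: profile_energy_seg GE.
Qed.

Let E : set R := `]0, s2]%classic.

Let E_D s : E s -> D s.
Proof.
rewrite /E /= in_itv /= => /andP[s0 ss2]; split=> //.
by apply: le_lt_trans s2S; rewrite lee_fin.
Qed.

Let E_of s : 0 < s -> s <= s2 -> E s.
Proof. by move=> s0 ss2; rewrite /E /= in_itv /= s0. Qed.

Let integral_E (c : \bar R) : (0 <= c)%E ->
  (\int[lebesgue_measure]_(s in E) c = c * s2%:E)%E.
Proof.
move=> c0; rewrite integral_cst; last exact: measurable_itv.
congr (c * _)%E; have m : (lebesgue_measure E = s2%:E :> \bar R)%E.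
  by rewrite /E lebesgue_measure_itv /= lte_fin s20 oppr0 adde0.
exact: m.
Qed.

(** On ]0, s2] the integrand is at most s2^2 times s2 [P], and it vanishes beyond; the length s2
    gives the fourth power. *)
Lemma profile_norm_le :
  (\int[lebesgue_measure]_(s in D) ((s * f s) ^+ 2)%:E <= (s2 ^+ 4)%:E * P)%E.
Proof.
pose c := ((s2 ^+ 3)%:E * P)%E.
have c0 : (0 <= c)%E by rewrite mule_ge0 // lee_fin exprn_ge0 // ltW.
have -> : ((s2 ^+ 4)%:E * P = \int[lebesgue_measure]_(s in E) c)%E.
  by rewrite integral_E // /c muleAC -EFinM -exprSr.
apply: nn_integral_le => // [s _|s Ds]; first by rewrite lee_fin sqr_ge0.
have [s0 sS] := Ds; have [s2s|ss2] := ltP s2 s.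
  by left; rewrite vanish ?(ltW s2s) // mulr0 expr0n.
right; split; first exact: E_of.
rewrite exprMn /c [s2 ^+ 3]exprSr (EFinM (s ^+ 2)) (EFinM (s2 ^+ 2)) -muleA.
apply: lee_pmul; rewrite ?lee_fin ?sqr_ge0 //; last exact: profile_sqr.
by rewrite ler_pXn2r // nnegrE ltW.
Qed.

Let df0 s : s2 < s -> (s%:E < S)%E -> df s = 0.
Proof.
move=> s2s sS; have [d _] := deriv (lt_trans s20 s2s) sS.
have [b sb bS] := ereal_room sS.
have near0 : \forall t \near s, (fun=> 0) t = f t.
  have n1 : \forall t \near s, s2 < t by exact: lt_nbhsr.
  have n2 : \forall t \near s, t < b by exact: lt_nbhsl.
  apply: filterS2 n1 n2 => t t1 t2; rewrite vanish ?ltW //.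
  by apply: lt_trans bS; rewrite lte_fin.
have [_ <-] := d; have [_ ->] := near_eq_is_derive near0 (is_derive_cst (0 : R) s (1 : R)).
by [].
Qed.

Let measurable_df : measurable_fun E (fun s => (df s ^+ 2)%:E).
Proof.
have [b s2b bS] := ereal_room s2S.
have cd : measurable_fun (`]0, b[%classic : set R) (fun s => df s ^+ 2).
  apply: open_continuous_measurable_fun; first exact: interval_open.
  move=> s; rewrite inE /= in_itv /= => /andP[s0 sb].
  have [|_ c] := deriv s0; first by apply: lt_trans bS; rewrite lte_fin.
  exact: (continuous_at_mul c c).
apply/measurable_EFinP; apply: measurable_funS cd; first exact: measurable_itv.
by move=> s; rewrite /E /= !in_itv /= => /andP[-> ss2]; exact: le_lt_trans ss2 s2b.
Qed.

(** From (f + s f')^2 <= 2 f^2 + 2 s^2 f'^2: the pointwise bound makes the first term integrate to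
    at most 2 s2^2 [P], and s <= s2 does the same for the second. *)
Lemma profile_derive_norm_le :
  (\int[lebesgue_measure]_(s in D) ((f s + s * df s) ^+ 2)%:E <= (4 * s2 ^+ 2)%:E * P)%E.
Proof.
pose c := ((2 * s2)%:E * P)%E.
have c0 : (0 <= c)%E by rewrite mule_ge0 // lee_fin mulr_ge0 // ltW.
have q0 s : (0 <= (df s ^+ 2)%:E)%E by rewrite lee_fin sqr_ge0.
have k0 : 0 < 2 * s2 ^+ 2 by rewrite mulr_gt0 // exprn_gt0.
have k0' : (0 <= (2 * s2 ^+ 2)%:E)%E by rewrite lee_fin ltW.
apply: (@le_trans _ _ (\int[lebesgue_measure]_(s in E) (c + (2 * s2 ^+ 2)%:E * (df s ^+ 2)%:E))%E).
  apply: nn_integral_le => [s _|s _|s Ds].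
  - by rewrite lee_fin sqr_ge0.
  - by apply: adde_ge0 => //; exact: mule_ge0.
  have [s0 sS] := Ds; have [s2s|ss2] := ltP s2 s.
    by left; rewrite vanish ?(ltW s2s) // df0 // mulr0 addr0 expr0n.
  right; split; first exact: E_of.
  apply: (@le_trans _ _ ((2 * f s ^+ 2)%:E + (2 * s2 ^+ 2 * df s ^+ 2)%:E)%E).
    rewrite -EFinD lee_fin.
    have h1 : (s * df s) ^+ 2 <= s2 ^+ 2 * df s ^+ 2.
      by rewrite exprMn; apply: ler_wpM2r; rewrite ?sqr_ge0 // ler_pXn2r // nnegrE ltW.
    have := sqr_ge0 (f s - s * df s).
    have -> : (f s - s * df s) ^+ 2 = 2 * f s ^+ 2 + 2 * (s * df s) ^+ 2 - (f s + s * df s) ^+ 2 by ring.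
    lra.
  apply: leeD; last by rewrite EFinM.
  rewrite /c !EFinM -muleA; apply: lee_wpmul2l; first by rewrite lee_fin.
  exact: profile_sqr.
rewrite ge0_integralD; [|exact: measurable_itv|by []|exact: measurable_cst|
  by move=> s _; exact: mule_ge0|exact: (measurable_funeM _ measurable_df)].
rewrite integral_E //.
apply: (@le_trans _ _ (c * s2%:E + (2 * s2 ^+ 2)%:E * P)%E).
  apply: leeD => //; apply: (le_trans (nn_integral_scale_le _ k0 _)) => //.
  apply: lee_wpmul2l => //; apply: nn_integral_le => // s Es; right; split=> //; exact: E_D.
rewrite /c muleAC -EFinM -ge0_muleDl ?lee_fin ?(ltW k0) //; last first.
  by rewrite !mulr_ge0 // ltW.
by rewrite -EFinD; apply: lee_wpmul2r => //; rewrite lee_fin le_eqVlt; apply/orP; left; apply/eqP; ring.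
Qed.

End Profile.

Section ConeNorms.
Context {R : realType}.
Implicit Types (n : 'rV[R]_3).

Lemma sphere_integral_le (h g : 'rV[R]_3 -> \bar R) :
  (forall n, unit_sphere n -> (0 <= h n)%E) ->
  (forall n, unit_sphere n -> (h n <= g n)%E) ->
  (sphere_integral h <= sphere_integral g)%E.
Proof.
move=> h0 hg; have s0 (t : R) : 0 <= t <= pi -> (0 <= (sin t)%:E)%E.
  by move=> ht; rewrite lee_fin; exact: sin_ge0_pi.
have g0 n : unit_sphere n -> (0 <= g n)%E by move=> n1; apply: le_trans (h0 n n1) (hg n n1).
apply: nn_integral_le => t ht.
- by apply: integral_ge0 => p _; apply: mule_ge0; [exact: s0|apply: h0; exact: unit_direction].
- by apply: integral_ge0 => p _; apply: mule_ge0; [exact: s0|apply: g0; exact: unit_direction].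
right; split=> //; apply: nn_integral_le => p hp.
- by apply: mule_ge0; [exact: s0|apply: h0; exact: unit_direction].
- by apply: mule_ge0; [exact: s0|apply: g0; exact: unit_direction].
right; split=> //; apply: lee_wpmul2l; first exact: s0.
by apply: hg; exact: unit_direction.
Qed.

Lemma sphere_integral_scale_le (h : 'rV[R]_3 -> \bar R) (c : R) : 0 < c ->
  (forall n, unit_sphere n -> (0 <= h n)%E) ->
  (sphere_integral (fun n => c%:E * h n) <= c%:E * sphere_integral h)%E.
Proof.
move=> c0 h0; have s0 (t : R) : 0 <= t <= pi -> (0 <= (sin t)%:E)%E.
  by move=> ht; rewrite lee_fin; exact: sin_ge0_pi.
have f0 (t p : R) : 0 <= t <= pi -> (0 <= (sin t)%:E * h (direction t p))%E.
  by move=> ht; apply: mule_ge0; [exact: s0|apply: h0; exact: unit_direction].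
have c0' : (0 <= c%:E)%E by rewrite lee_fin ltW.
apply: le_trans (nn_integral_scale_le _ c0 _); last first.
  by move=> t ht; apply: integral_ge0 => p _; exact: f0.
apply: nn_integral_le => t ht.
- apply: integral_ge0 => p _; apply: mule_ge0; first exact: s0.
  by apply: mule_ge0 => //; apply: h0; exact: unit_direction.
- by apply: mule_ge0 => //; apply: integral_ge0 => p _; exact: f0.
right; split=> //; apply: le_trans (nn_integral_scale_le _ c0 _); last by move=> p _; exact: f0.
apply: nn_integral_le => p hp.
- apply: mule_ge0; first exact: s0.
  by apply: mule_ge0 => //; apply: h0; exact: unit_direction.
- by apply: mule_ge0 => //; exact: f0.
by right; split=> //; rewrite muleCA.
Qed.

Lemma cone_L2sq_ge0 (S : \bar R) (h : R -> 'rV[R]_3 -> R) : (0 <= cone_L2sq S h)%E.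
Proof.
apply: integral_ge0 => t ht; apply: integral_ge0 => p _; apply: mule_ge0.
  by rewrite lee_fin; exact: sin_ge0_pi.
by apply: integral_ge0 => s _; rewrite lee_fin sqr_ge0.
Qed.

Lemma cone_L2normE (S : \bar R) (h : R -> 'rV[R]_3 -> R) :
  cone_L2norm S h = sqrte (cone_L2sq S h).
Proof. exact: (poweR12_sqrt (cone_L2sq_ge0 S h)). Qed.

Section Bounds.
Context (S : \bar R) (f df g h : R -> 'rV[R]_3 -> R) (s2 : R).
Context (deriv : forall n s, unit_sphere n -> 0 < s -> (s%:E < S)%E ->
  is_derive s 1 (f ^~ n) (df s n) /\ {for s, continuous (df ^~ n)}).
Context (s20 : 0 < s2) (s2S : (s2%:E < S)%E).
Context (vanish : forall n s, unit_sphere n -> s2 <= s -> (s%:E < S)%E -> f s n = 0).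
Context (gE : forall n s, unit_sphere n -> 0 < s -> (s%:E < S)%E -> g s n = s * f s n).
Context (hE : forall n s, unit_sphere n -> 0 < s -> (s%:E < S)%E -> h s n = f s n + s * df s n).

Let nonneg (F : R -> R) : (0 <= \int[lebesgue_measure]_(s in [set s | (0 < s)%R /\ (s%:E < S)%E])
  ((F s) ^+ 2)%:E)%E.
Proof. by apply: integral_ge0 => s _; rewrite lee_fin sqr_ge0. Qed.

Lemma cone_norm_le : (cone_L2sq S g <= (s2 ^+ 4)%:E * cone_L2sq S df)%E.
Proof.
have c0 : 0 < s2 ^+ 4 by exact: exprn_gt0.
apply: le_trans (sphere_integral_scale_le c0 _) => [|n _]; last exact: nonneg.
apply: sphere_integral_le => n n1; first exact: nonneg.
have d := deriv n1; have v := vanish n1.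
apply: le_trans (profile_norm_le (fun s => @d s) s20 s2S (fun s => @v s)).
apply: nn_integral_le => s Ds; rewrite ?lee_fin ?sqr_ge0 //.
by have [s0 sS] := Ds; right; split=> //; rewrite gE.
Qed.

Lemma cone_derive_norm_le : (cone_L2sq S h <= (4 * s2 ^+ 2)%:E * cone_L2sq S df)%E.
Proof.
have c0 : 0 < 4 * s2 ^+ 2 by rewrite mulr_gt0 // exprn_gt0.
apply: le_trans (sphere_integral_scale_le c0 _) => [|n _]; last exact: nonneg.
apply: sphere_integral_le => n n1; first exact: nonneg.
have d := deriv n1; have v := vanish n1.
apply: le_trans (profile_derive_norm_le (fun s => @d s) s20 s2S (fun s => @v s)).
apply: nn_integral_le => s Ds; rewrite ?lee_fin ?sqr_ge0 //.
by have [s0 sS] := Ds; right; split=> //; rewrite hE.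
Qed.

(** The constants s2^4 and 4 s2^2 of the two norms multiply to the square of 2 s2^3. *)
Lemma cone_norm_product_le (Y : R) : (cone_L2norm S df ^+ 2 <= Y%:E)%E ->
  (cone_L2norm S g * cone_L2norm S h <= (2 * s2 ^+ 3 * Y)%:E)%E.
Proof.
rewrite !cone_L2normE (sqr_sqrte (cone_L2sq_ge0 S df)) => NY.
have Y0 : 0 <= Y by rewrite -lee_fin; apply: le_trans NY; exact: (cone_L2sq_ge0 S df).
have c1 : 0 <= s2 ^+ 4 by rewrite exprn_ge0 // ltW.
have c2 : 0 <= 4 * s2 ^+ 2 by rewrite mulr_ge0 // exprn_ge0 // ltW.
have h1 : (cone_L2sq S g <= (s2 ^+ 4 * Y)%:E)%E.
  by apply: le_trans cone_norm_le _; rewrite (EFinM (s2 ^+ 4) Y); apply: lee_wpmul2l; [rewrite lee_fin|exact: NY].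
have h2 : (cone_L2sq S h <= (4 * s2 ^+ 2 * Y)%:E)%E.
  by apply: le_trans cone_derive_norm_le _; rewrite (EFinM (4 * s2 ^+ 2) Y); apply: lee_wpmul2l; [rewrite lee_fin|exact: NY].
have y1 : 0 <= s2 ^+ 4 * Y by rewrite mulr_ge0.
have y2 : 0 <= 4 * s2 ^+ 2 * Y by rewrite mulr_ge0.
apply: (@le_trans _ _ (sqrte (s2 ^+ 4 * Y)%:E * sqrte (4 * s2 ^+ 2 * Y)%:E)%E).
  by apply: lee_pmul; rewrite ?sqrte_ge0 // lee_sqrt ?lee_fin.
rewrite /= -EFinM lee_fin -sqrtrM //.
have -> : s2 ^+ 4 * Y * (4 * s2 ^+ 2 * Y) = (2 * s2 ^+ 3 * Y) ^+ 2 by ring.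
have s23 : 0 <= s2 ^+ 3 by rewrite exprn_ge0 // ltW.
by rewrite sqrtr_sqr ger0_norm // mulr_ge0 // mulr_ge0.
Qed.

End Bounds.
End ConeNorms.

(** * Focusing *)

Section Focusing.
Context {R : realType} (smax S : \bar R) (Rss theta e : R -> R) (kap s1 s2 X : R).
Context (exp : expansion smax Rss theta S).
Context (Rss_ge : forall s : R, 0 < s -> (s%:E < smax)%E -> 0 <= kap * e s <= Rss s).
Context (cont_e : forall s : R, 0 < s -> (s%:E < smax)%E -> {for s, continuous e}).

(** Without a zero, theta keeps the positive sign imposed by its behaviour at the tip, which also
    rules out a caustic before s2. The bound 2 / s1 at s1 and the loss of at least kap X over
    [s1, s2] then contradict positivity at s2. *)
Lemma expansion_vanishes : 0 < s1 -> s1 < s2 -> (s2%:E < smax)%E ->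
  (\int[lebesgue_measure]_(s in `[s1, s2]) (e s)%:E = X%:E)%E -> 2 / s1 <= kap * X ->
  exists s, [/\ 0 < s, (s%:E < S)%E & theta s = 0].
Proof.
move=> s10 s12 s2m intX X_ge; apply: contrapT => no_zero.
have nz s : 0 < s -> (s%:E < S)%E -> theta s <> 0 by move=> s0 sS t0; case: no_zero; exists s.
have [/andP[S0 Smax] ray tip maxi] := exp.
have S_le x y : x <= y -> (y%:E < S)%E -> (x%:E < S)%E.
  by move=> xy; apply: le_lt_trans; rewrite lee_fin.
have ct s : 0 < s -> (s%:E < S)%E -> {for s, continuous theta}.
  move=> s0 sS; have [dd _] := ray s s0 sS.
  by apply: differentiable_continuous; apply/derivable1_diffP.
have pos s : 0 < s -> (s%:E < S)%E -> 0 < theta s.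
  move=> s0 sS; rewrite ltNge; apply/negP => ts.
  have : \forall t \near (0 : R)^'+, 0 < t * theta t.
    by apply: (cvgr_gt (2 : R)); [exact: tip|lra].
  move=> tip0; have : \forall t \near (0 : R)^'+, t < s by exact: nbhs_right_lt.
  move=> tip1; have tip2 : \forall t \near (0 : R)^'+, 0 < t by exact: nbhs_right_gt.
  have [t [h1 h2 h3]] : exists t, [/\ 0 < t * theta t, t < s & 0 < t].
    near (0 : R)^'+ => t; exists t; split; near: t; [exact: tip0|exact: tip1|exact: tip2].
  have tt : 0 < theta t by rewrite pmulr_rgt0 in h1.
  have [|||c /andP[c1 c2] c0] := @ivt_zero _ (fun s => - theta s) t s (ltW h2).
  - move=> y /andP[y1 y2]; apply: continuous_at_opp; apply: ct; first exact: lt_le_trans y1.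
    exact: S_le sS.
  - lra.
  - lra.
  apply: (nz c); [exact: lt_le_trans c1|exact: S_le sS|lra].
(* At a caustic theta would tend to - infinity, against its positivity; hence s2 lies in the
   interval of existence. *)
have SE : S = smax.
  case: maxi => // -[S' [SE' lim]]; exfalso.
  have S'0 : 0 < S' by move: S0; rewrite SE' lte_fin.
  have n1 : \forall t \near S'^'-, theta t < 0 by exact: (cvgrNy_lt lim).
  have n2 : \forall t \near S'^'-, t < S' by exact: nbhs_left_lt.
  have n3 : \forall t \near S'^'-, 0 < t by exact: nbhs_left_gt.
  have [t [h1 h2 h3]] : exists t, [/\ theta t < 0, t < S' & 0 < t].
    near S'^'- => t; exists t; split; near: t; [exact: n1|exact: n2|exact: n3].
  by have := pos t h3; rewrite SE' lte_fin h2 => /(_ isT); lra.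
rewrite SE in S_le ray pos ct nz; clear SE S0 Smax maxi no_zero tip.
have s20 : 0 < s2 by lra.
have upper s : 0 < s -> (s%:E < smax)%E -> theta s <= 2 / s.
  move=> s0 sm.
  (* By the Raychaudhuri equation 1 / theta has derivative at least 1/2, and it is positive at t.
     The bound 2 / s is the limit t -> 0 of this inequality. *)
  have key t : 0 < t -> t < s -> theta s * (s - t) <= 2.
    move=> t0 ts; pose G y := (theta y)^-1 + - 2^-1 * y.
    have th0 y : t <= y -> y <= s -> 0 < theta y.
      by move=> ty ys; apply: pos; [exact: lt_le_trans ty|exact: S_le sm].
    have := @derive_ge0_le _ G (fun y => - (theta y) ^- 2 * (- (theta y) ^+ 2 / 2 - Rss y) - 2^-1) t s (ltW ts).
    move=> /(_ _)/wrap[y /andP[y1 y2]|].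
      have y0 : 0 < y by exact: lt_le_trans y1.
      have ysm : (y%:E < smax)%E by exact: S_le sm.
      have ty := th0 y y1 y2.
      split.
        have e1 := is_deriveV (lt0r_neq0 ty) (ray y y0 ysm).
        have e2 := is_deriveM (is_derive_cst (- 2^-1 : R) y (1 : R)) (is_derive_id y (1 : R)).
        have e3 := is_deriveD e1 e2.
        by apply: (is_derive_eq e3); rewrite /cst /GRing.scale /=; ring.
      have /andP[e0 eR] := Rss_ge y0 ysm.
      have -> : - theta y ^- 2 * (- theta y ^+ 2 / 2 - Rss y) - 2^-1 = Rss y * theta y ^- 2.
        by field; exact: lt0r_neq0.
      by apply: mulr_ge0; [exact: le_trans e0 eR|rewrite invr_ge0 exprn_ge0 // ltW].
    rewrite /G => h.
    have ts0 := th0 s (ltW ts) (lexx _); have tt0 := th0 t (lexx _) (ltW ts).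
    have it : 0 < (theta t)^-1 by rewrite invr_gt0.
    have : (s - t) / 2 <= (theta s)^-1 by lra.
    by rewrite -(ler_pM2l ts0) mulfV ?gt_eqF //; lra.
  rewrite ler_pdivlMr // leNgt; apply/negP => h.
  have ts0 := pos s s0 sm.
  (* Half of s - 2 / theta(s), which is positive if the bound fails; then theta(s) (s - t) =
     (theta(s) s + 2) / 2 > 2, instead of a passage to the limit. *)
  pose t := (theta s * s - 2) / (2 * theta s).
  have tE : theta s * t = (theta s * s - 2) / 2 by rewrite /t; field; exact: lt0r_neq0.
  have t0 : 0 < t by rewrite /t divr_gt0 //; lra.
  have ts : t < s by rewrite -(ltr_pM2l ts0) tE; lra.
  by have := key t t0 ts; rewrite mulrBr tE; lra.
have [b s2b bm] := ereal_room s2m.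
have [||G [dG GE]] := @antiderivative _ e (s1 / 2) b s1 s2 _ s12 s2b; first lra.
  move=> t /andP[h1 h2]; apply: cont_e; [lra|exact: S_le (ltW h2) bm].
move: GE; rewrite intX => -[GX].
have := @derive_ge0_le _ (fun s => - theta s - kap * G s)
  (fun s => theta s ^+ 2 / 2 + Rss s - kap * e s) s1 s2 (ltW s12).
move=> /(_ _)/wrap[t ht|].
  have /andP[h1 h2] := ht; have t0 : 0 < t by lra.
  have tm : (t%:E < smax)%E by exact: S_le h2 s2m.
  split.
    have e1 := is_deriveN (ray t t0 tm).
    have e2 := is_deriveM (is_derive_cst kap t (1 : R)) (dG t ht).
    have e3 := is_deriveB e1 e2.
    by apply: (is_derive_eq e3); rewrite scaler0 addr0 /cst /GRing.scale /=; ring.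
  have /andP[e0 eR] := Rss_ge t0 tm.
  have := sqr_ge0 (theta t); lra.
have -> : kap * G s2 = kap * G s1 + kap * X by rewrite GX; ring.
have := pos s2 s20 s2m; have := upper s1 s10 (S_le _ _ (ltW s12) s2m).
lra.
Unshelve. all: by end_near. Qed.

End Focusing.

(** * Derivatives and null contractions along the rays of the cone *)

Section Energy.
Context {R : realType} {M : spacetime R} (HM : is_spacetime M).
Context (J : set R) (gamma : R -> M) (HJ : worldline J gamma).
Context (rot : 'M[R]_3 -> M -> M) (k : chart R M) (A r : R -> R -> R) (smax : R -> \bar R).
Context (HR : retarded_coordinates J gamma rot k A r smax).
Implicit Types (n : 'rV[R]_3) (s : R).
Local Notation dom := Defs.dom.

Let ak : atlas M k := ret_atlas HR.
Let J0 : J 0 := wl_zero HJ.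

Lemma ray_derive (Psi : M -> R) n s : smooth Psi -> unit_sphere n ->
  0 < s -> (s%:E < smax 0)%E -> is_derive s 1 (fun s => Psi (retpoint k 0 s n))
    (\sum_j ds_vec n 0 j * pd j (rep k Psi) (upoint 0 (s *: n))).
Proof.
move=> sP n1 s0 sm.
have lineE t : upoint 0 (t *: n) = upoint 0 0 + t *: upoint 0 n by rewrite upoint_line add0r.
have is' : img k (upoint 0 0 + s *: upoint 0 n).
  by rewrite -lineE; exact: (ret_imgP HR J0 n1 s0 sm).
have := is_derive_line_pd (open_img HM ak) (sP k ak 1%N) is'.
have -> : (fun t : R => rep k Psi (upoint 0 0 + t *: upoint 0 n)) = fun t => Psi (retpoint k 0 t n).
  by apply/funext => t; rewrite -lineE.
by rewrite -lineE ds_vecE.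
Qed.

Lemma ray_derive_continuous (Psi : M -> R) n s : smooth Psi -> unit_sphere n ->
  0 < s -> (s%:E < smax 0)%E ->
  let psi := fun s => Psi (retpoint k 0 s n) in
  is_derive s 1 psi (derive1 psi s) /\ {for s, continuous (derive1 psi)}.
Proof.
move=> sP n1 s0 sm psi.
have dE t : 0 < t -> (t%:E < smax 0)%E ->
    derive1 psi t = \sum_j ds_vec n 0 j * pd j (rep k Psi) (upoint 0 (t *: n)).
  by move=> t0 tm; have [_ h] := ray_derive sP n1 t0 tm; rewrite derive1E -[RHS]h.
split; first by rewrite (dE s s0 sm); exact: ray_derive.
have [b sb bm] := ereal_room sm.
have E : \forall t \near s, \sum_j ds_vec n 0 j * pd j (rep k Psi) (upoint 0 (t *: n)) = derive1 psi t.
  have h1 : \forall t \near s, 0 < t by exact: lt_nbhsr.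
  have h2 : \forall t \near s, t < b by exact: lt_nbhsl.
  apply: filterS2 h1 h2 => t t0 tb; rewrite dE //.
  by apply: lt_trans bm; rewrite lte_fin.
have cs : {for s, continuous (fun t : R => \sum_j ds_vec n 0 j * pd j (rep k Psi) (upoint 0 (t *: n)))}.
  apply: continuous_at_sum => j _; apply: continuous_at_mul; first exact: continuous_at_cst.
  have cl := continuous_ret_ray J0 n1 s0 sm.
  have ii := ret_imgP HR J0 n1 s0 sm.
  have cp : {for upoint 0 (s *: n), continuous (pd j (rep k Psi))}.
    exact: (smooth_on_continuous (smooth_on_pd j (sP k ak)) ii).
  exact: (@continuous_comp _ _ _ (fun t : R => upoint 0 (t *: n)) (pd j (rep k Psi)) s cl cp).
rewrite /prop_for /continuous_at -(nbhs_singleton E).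
exact: cvg_trans (near_eq_cvg E) cs.
Qed.

Lemma contract_point_split (F : M -> M -> R) n s : unit_sphere n ->
  0 < s -> (s%:E < smax 0)%E -> let x := retpoint k 0 s n in
  contract_ss (point_split k F x) n =
  \sum_i \sum_j ds_vec n 0 i * ds_vec n 0 j *
    pd (lsh i) (pd (rsh j) (rep2 k k F)) (pair8 (crd k x) (crd k x)).
Proof.
move=> n1 s0 sm x; rewrite /contract_ss /point_split; set c := 2^-1 * _; set B := \matrix_(i, j) _.
rewrite mulmxBr mulmxBl mxE [X in _ + X]mxE -scalemxAr -scalemxAl [X in _ - X]mxE.
have -> : (ds_vec n *m metric k x *m (ds_vec n)^T) 0 0 = 0 by exact: (ds_null HM HR J0 n1 s0 sm).
rewrite mulr0 subr0 mxE exchange_big /=; apply: eq_bigr => j _.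
rewrite !mxE mulr_suml; apply: eq_bigr => i _; rewrite !mxE.
by rewrite mulrAC.
Qed.

End Energy.

Theorem theorem2p1 (R : realType) (M : spacetime R)
  (J : set R) (gamma : R -> M) (rot : 'M[R]_3 -> M -> M)
  (k : chart R M) (Auu r : R -> R -> R) (smax : R -> \bar R)
  (I : (M -> R) -> R) (Eret Eadv : (M -> R) -> (M -> R))
  (A : algType R[i]) (star : A -> A) (phi : (M -> R[i]) -> A)
  (omega : A -> R[i])
  (lam alpha beta C : R) (T0 : chart R M -> M -> 'M[R]_4)
  (f : M -> R) (O : set M) (s1 s2 : R)
  (tau : chart R M -> M -> 'M[R]_4) (Rss theta : R -> R) (S : \bar R) :
  let C0 := light_cone k gamma smax in
  let Delta := propagator Eret Eadv in
  let omega2 := two_point phi omega in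
  let psi := fun (h : M -> R) (s : R) (n : 'rV[R]_3) =>
    Delta h (retpoint k 0 s n) in
  let ds_psi := fun (h : M -> R) (s : R) (n : 'rV[R]_3) =>
    derive1 (fun s' => psi h s' n) s in
  let s_psi := fun (h : M -> R) (s : R) (n : 'rV[R]_3) => s * psi h s n in
  let ds_s_psi := fun (h : M -> R) (s : R) (n : 'rV[R]_3) =>
    derive1 (fun s' => s' * psi h s' n) s in
  (* the spacetime *)
  is_spacetime M -> globally_hyperbolic M ->
  rotation_action rot -> worldline J gamma ->
  retarded_coordinates J gamma rot k Auu r smax ->
  (* the field and the state *)
  volume_integral I ->
  fundamental_solution (@Jplus R M) Eret ->
  fundamental_solution (@Jminus R M) Eadv ->
  field_algebra I Delta star phi ->
  state star omega -> quasi_free phi omega ->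
  0 < lam -> hadamard I lam omega2 ->
  (* the semiclassical Einstein equations *)
  renormalized_stress I lam alpha beta omega2 T0 -> einstein_equation T0 ->
  (* positivity of R_ss *)
  (forall s n, unit_sphere n -> 0 < s -> (s%:E < smax 0%R)%E ->
     0 < contract_ss (ricci k (retpoint k 0 s n)) n) ->
  (* the bound on the two-point function *)
  0 < C ->
  (forall h, test h -> supp h `<=` Jplus C0 ->
     ((complex.Re `|omega2 (toC h) (toC h)|)%:E <=
      C%:E * (cone_L2norm (smax 0%R) (s_psi h) *
              cone_L2norm (smax 0%R) (ds_s_psi h)))%E) ->
  (* the test function *)
  test f -> spherical rot f -> omega2 (toC f) (toC f) != 0 ->
  open O -> O `<=` Jplus C0 -> supp f `<=` O ->
  (* the retarded coordinates cover the relevant part of M *)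
  Jplus C0 `&` Jminus (C0 `|` O) `<=` ret_region k J gamma ->
  (s2%:E < smax 0%R)%E ->
  (forall s n, unit_sphere n -> 0 < s -> (s%:E < smax 0%R)%E ->
     Jminus O (retpoint k 0 s n) -> s < s2) ->
  s1 < s2 -> s2 < 3 / 2 * s1 ->
  (forall n, unit_sphere n ->
     ((cone_L2norm (smax 0%R) (ds_psi f)) ^+ 2 <=
      (8 * pi)%:E * \int[lebesgue_measure]_(s in `[s1, s2])
                      ((ds_psi f s n) ^+ 2)%:E)%E) ->
  (* the perturbation *)
  stress_difference I phi omega (prepared phi omega f) tau ->
  perturbed_Rss k smax tau Rss ->
  expansion (smax 0%R) Rss theta S ->
  s2 < 1 / Num.sqrt (12 * C) ->
  (exists s, [/\ 0 < s, (s%:E < S)%E, theta s = 0 &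
                 cone_sphere k s `<=` C0]) /\
  contains_trapped_sphere k theta S (Jplus C0).
Proof.
move=> C0 Delta omega2 psi ds_psi s_psi ds_s_psi HM GH _ HJ HR HI Hret Hadv HA Hw Hq _ _ _ _.
move=> ric_pos C_gt0 bound tf _ w_neq0 oO OC0 suppO cover s2m past_s2 s12 s23 conc stress Rss_eq Hexp s2C.
have s10 : 0 < s1 by lra.
have s20 : 0 < s2 by lra.
have J0 := wl_zero HJ.
have ak := ret_atlas HR.
(* One ray is enough, and any direction serves: theta and [Rss] depend on s only, and the
   concentration hypothesis is made along every direction. *)
have n1 : unit_sphere (direction 0 0 : 'rV[R]_3) by exact: unit_direction.
set n := direction 0 0 : 'rV[R]_3 in n1.
have S_le (x y : R) : x <= y -> (y%:E < smax 0%R)%E -> (x%:E < smax 0%R)%E.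
  by move=> xy; apply: le_lt_trans; rewrite lee_fin.
have sPsi : smooth (Delta f) := smooth_propagator HM Hret Hadv tf.
have suppC0 : supp f `<=` Jplus C0 by apply: subset_trans OC0.
have deriv n' s : unit_sphere n' -> 0 < s -> (s%:E < smax 0%R)%E ->
    is_derive s 1 (psi f ^~ n') (ds_psi f s n') /\ {for s, continuous (ds_psi f ^~ n')}.
  by move=> n1' s0 sm; exact: (ray_derive_continuous HM HJ HR sPsi n1' s0 sm).
have cover' : Jplus C0 `&` Jminus C0 `<=` ret_region k J gamma.
  by move=> q [q1 [y Cy qy]]; apply: cover; split=> //; exists y => //; left.
(* The advanced part of the propagator lives in the past of [supp f], which meets the cone only at
   distances below s2. *)
have vanish n' s : unit_sphere n' -> s2 <= s -> (s%:E < smax 0%R)%E -> psi f s n' = 0.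
  move=> n1' s2s sm; have s0 : 0 < s by exact: lt_le_trans s2s.
  rewrite /psi /Delta /propagator (retarded_cone0 HM GH HJ HR cover' Hret tf suppC0 n1' s0 sm) sub0r.
  apply/eqP; rewrite oppr_eq0; apply: contraT => ne.
  have [y sy le] := fs_supp Hadv tf ne.
  have := past_s2 s n' n1' s0 sm; rewrite ltNge s2s => /(_ _)/wrap[|//].
  by exists y => //; exact: suppO.
have ds_sE n' s : unit_sphere n' -> 0 < s -> (s%:E < smax 0%R)%E ->
    ds_s_psi f s n' = psi f s n' + s * ds_psi f s n'.
  move=> n1' s0 sm; have [d _] := deriv n' s n1' s0 sm.
  have [_ e] := is_deriveM (is_derive_id s (1 : R)) d.
  rewrite /ds_s_psi derive1E; apply: etrans e _; rewrite /GRing.scale /=; ring.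
have [b s2b bm] := ereal_room s2m.
have [||G [_ GE]] := @antiderivative _ (fun s => ds_psi f s n ^+ 2) (s1 / 2) b s1 s2 _ s12 s2b.
- by move: s10; clear; lra.
- move=> t /andP[h1 h2]; have t0 : 0 < t by move: s10 h1; clear; lra.
  have [_ c] := deriv n t n1 t0 (S_le _ _ (ltW h2) bm).
  exact: (continuous_at_mul c c).
set X := G s2 - G s1 in GE.
have X0 : 0 <= X.
  by rewrite -lee_fin -GE; apply: integral_ge0 => s _; rewrite lee_fin sqr_ge0.
have [w w0 wE] := two_point_gt0 HA Hw tf w_neq0.
(* Here the concentration hypothesis enters: 8 pi X, with X the energy along the chosen ray between
   s1 and s2, bounds the squared norm of the derivative over the whole cone. *)
have w_le : w <= C * (2 * s2 ^+ 3 * (8 * pi * X)).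
  have NY : (cone_L2norm (smax 0%R) (ds_psi f) ^+ 2 <= (8 * pi * X)%:E)%E.
    by rewrite EFinM -GE; exact: conc.
  have gE n' s : unit_sphere n' -> 0 < s -> (s%:E < smax 0%R)%E -> s_psi f s n' = s * psi f s n' by [].
  have NN := cone_norm_product_le deriv s20 s2m vanish gE ds_sE NY.
  rewrite -lee_fin EFinM; apply: le_trans (lee_wpmul2l _ NN); last by rewrite lee_fin ltW.
  apply: le_trans (bound f tf suppC0); rewrite lee_fin.
  by rewrite /omega2 wE normc_def /= expr0n addr0 sqrtr_sqr ger0_norm // ltW.
have [F [sF FE tauE]] := stress.
(* The factor 4 pi / w is the 8 pi of the Einstein equations times the 1 / (2 w) of the prepared
   state; the positive background term is dropped. *)
have Rss_ge s : 0 < s -> (s%:E < smax 0%R)%E -> 0 <= 4 * pi / w * ds_psi f s n ^+ 2 <= Rss s.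
  move=> s0 sm; have pi0 := pi_gt0 R.
  have k0 : 0 <= 4 * pi / w by rewrite divr_ge0 ?mulr_ge0 // ltW.
  apply/andP; split; first by rewrite mulr_ge0 // sqr_ge0.
  rewrite (Rss_eq s n n1 s0 sm).
  have dx := ret_dom HM HR J0 n1 s0 sm.
  rewrite (tauE k _ ak dx) (contract_point_split HM HJ HR F n1 s0 sm).
  have c0 : 0 <= (2 * w)^-1 by rewrite invr_ge0 mulr_ge0 // ltW.
  have H h : test h -> supp h `<=` Defs.dom k -> (2 * w)^-1 * I (fun x => h x * Delta f x) ^+ 2 <=
      I (fun x => h x * I (fun y => F x y * h y)).
    by move=> th _; exact: (prepared_kernel_bound HM HI Hret Hadv HA Hw Hq tf w0 wE FE th).
  have := point_split_bound HM HI sF sPsi (ds_vec n) ak c0 H dx.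
  rewrite (ret_crd HM HR J0 n1 s0 sm).
  have [_ dE] := ray_derive HM HJ HR sPsi n1 s0 sm.
  rewrite -dE -derive1E; set B := \sum_i _ => hB'.
  have hB : (2 * w)^-1 * ds_psi f s n ^+ 2 <= B by exact: hB'.
  have := ric_pos s n n1 s0 sm; set Q := contract_ss _ _ => Q0.
  have -> : 4 * pi / w * ds_psi f s n ^+ 2 = 8 * pi * ((2 * w)^-1 * ds_psi f s n ^+ 2).
    by field; exact: lt0r_neq0.
  have p8 : 0 <= 8 * pi :> R by rewrite mulr_ge0 // ltW.
  move: (ler_wpM2l p8 hB) Q0; clear; lra.
have cont s : 0 < s -> (s%:E < smax 0%R)%E -> {for s, continuous (fun s => ds_psi f s n ^+ 2)}.
  by move=> s0 sm; have [_ c] := deriv n s n1 s0 sm; exact: (continuous_at_mul c c).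
have X_ge : 2 / s1 <= 4 * pi / w * X.
  have q0 : 0 < Num.sqrt (12 * C) by rewrite sqrtr_gt0 mulr_gt0.
  have sC : 12 * C * s2 ^+ 2 < 1.
    have h : s2 * Num.sqrt (12 * C) < 1 by rewrite -ltr_pdivlMr.
    have h0 : 0 <= s2 * Num.sqrt (12 * C) by rewrite mulr_ge0 // ltW.
    have : (s2 * Num.sqrt (12 * C)) ^+ 2 < 1 by rewrite expr_lt1.
    by rewrite exprMn sqr_sqrtr ?mulr_ge0 ?(ltW C_gt0) // mulrC.
  (* The constants 12 and 3/2 of the statement meet here: 8 C s2^3 = (2/3) s2 (12 C s2^2), where the
     last factor is below 1 and (2/3) s2 < s1. *)
  have sC1 : 8 * C * s2 ^+ 3 <= s1.
    have -> : 8 * C * s2 ^+ 3 = 2 / 3 * s2 * (12 * C * s2 ^+ 2) by field.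
    apply: (@le_trans _ _ (2 / 3 * s2 * 1)); last by move: s23; clear; lra.
    by apply: ler_wpM2l; [move: s20; clear; lra|exact: ltW].
  have piX : 0 <= 2 * pi * X by rewrite !mulr_ge0 // ltW // pi_gt0.
  have w2 : w <= 2 * pi * X * s1.
    apply: le_trans w_le _; have -> : C * (2 * s2 ^+ 3 * (8 * pi * X)) = 2 * pi * X * (8 * C * s2 ^+ 3) by ring.
    exact: ler_wpM2l.
  rewrite ler_pdivrMr // -(ler_pM2l w0).
  have -> : w * (4 * pi / w * X * s1) = 2 * (2 * pi * X * s1) by field; exact: lt0r_neq0.
  by move: w2; clear; lra.
have [s [s0 sS ts]] := expansion_vanishes Hexp Rss_ge cont s10 s12 s2m GE X_ge.
have sub : cone_sphere k s `<=` C0.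
  move=> x Hx; right; exists s; split=> //; apply: lt_le_trans sS _.
  by have [/andP[]] := Hexp.
split; first by exists s.
exists s; split=> // x /sub Cx; exists x => //; exact: causal_le_refl.
Qed.
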